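(* Let assumptions (a) and (b) of the context hold and let $L$ and $\mathbb{M}$ be as in the context. Let $N_0\in\mathbb{N}$ and let $g\in C^2(\mathbb{R}^d\setminus\overline{B}_{N_0})\cap C(\mathbb{R}^d)$, $g\ge0$, with $$\lim_{r\to\infty}\big(\inf_{\partial B_r}g\big)=\infty,$$ and assume that $$Lg\le0\quad\text{a.e. on }\mathbb{R}^d\setminus\overline{B}_{N_0}.$$ Then $\mathbb{M}$ is recurrent in the probabilistic sense.
   Context: Let $d\ge2$, $p\in(d,\infty)$, $q=\frac{pd}{p+d}$. $B_r$ is the open Euclidean ball of radius $r$ about $0$. For a matrix $B=(b_{ij})$ of functions, $\nabla B$ is the vector field with $i$-th component $\sum_j\partial_jb_{ij}$. Assumption (a): $A=(a_{ij})$ with $a_{ji}=a_{ij}\in H^{1,2}_{loc}(\mathbb{R}^d)\cap C(\mathbb{R}^d)$, such that for every relatively compact $V$ there is $\nu_V>0$ with $\nu_V^{-1}\|\xi\|^2\le\langle A(x)\xi,\xi\rangle\le\nu_V\|\xi\|^2$ for all $\xi\in\mathbb{R}^d$, $x\in V$; $C=(c_{ij})$ with $-c_{ji}=c_{ij}\in H^{1,2}_{loc}(\mathbb{R}^d)\cap C(\mathbb{R}^d)$; $\mathbf{H}\in L^p_{loc}(\mathbb{R}^d,\mathbb{R}^d)$. Put $\mathbf{G}=(g_1,\dots,g_d)=\tfrac12\nabla(A+C^T)+\mathbf{H}$ and $Lf=\tfrac12\sum_{i,j}a_{ij}\partial_{ij}f+\sum_ig_i\partial_if$ for $C^2$-functions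 $f$. Assumption (b): $\mathbf{G}\in L^q_{loc}(\mathbb{R}^d,\mathbb{R}^d)$. Measure: $\mu=\rho\,dx$, where $\rho\in H^{1,p}_{loc}(\mathbb{R}^d)\cap C(\mathbb{R}^d)$, $\rho>0$ everywhere, and $\int Lf\,d\mu=0$ for all $f\in C_0^\infty(\mathbb{R}^d)$ (such $\rho$ exists under (a); one is fixed). Semigroup: put $\beta^{\rho,A}_i=\tfrac12\sum_j(\partial_ja_{ij}+a_{ij}\tfrac{\partial_j\rho}\rho)$, $\mathbf{B}=\mathbf{G}-\beta^{\rho,A}$. For relatively compact open $V$ let $(L^{0,V},D(L^{0,V}))$ be the self-adjoint generator on $L^2(V,\mu)$ of the closure of $\tfrac12\int_V\langle A\nabla u,\nabla v\rangle d\mu$, $u,v\in C_0^\infty(V)$. The operator $L^{0,V}u+\langle\mathbf{B},\nabla u\rangle$ on bounded $u\in D(L^{0,V})$ is closable in $L^1(V,\mu)$ and its closure generates a sub-Markovian $C_0$-semigroup of contractions, with resolvent $\overline{G}^V_\alpha$; put $\overline{G}^V_\alpha f:=\overline{G}^V_\alpha(f1_V)$ (zero outside $V$) for $f\in L^1(\mathbb{R}^d,\mu)$. For relatively compact open $V_n\uparrow\mathbb{R}^d$ the limits $\overline{G}_\alpha f=\lim_n\overline{G}^{V_n}_\alpha f$ exist in $L^1(\mathbb{R}^d,\mu)$, do not depend on $(V_n)$, and form the resolvent of a sub-Markovian $C_0$-semigroup of contractions $(\overline{T}_t)_{t>0}$ on $L^1(\mathbb{R}^d,\mu)$, whose generator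 extends $(L,C_0^\infty(\mathbb{R}^d))$. $(T_t)_{t>0}$ denotes the sub-Markovian semigroup on every $L^s(\mathbb{R}^d,\mu)$, $s\in[1,\infty]$, obtained by restricting $(\overline{T}_t)$ to $L^1\cap L^\infty$ and extending. For $f\in\bigcup_{s\in[1,\infty]}L^s(\mathbb{R}^d,\mu)$ and $t>0$, $T_tf$ has a continuous $\mu$-version, denoted $P_tf$; $P_0=\mathrm{id}$. Process: under (a) and (b), $\mathbb{M}=(\Omega,\mathcal{F},(\mathcal{F}_t)_{t\ge0},(X_t)_{t\ge0},(\mathbb{P}_x)_{x\in\mathbb{R}^d\cup\{\Delta\}})$ is the Hunt process with state space $\mathbb{R}^d$, with continuous sample paths on the one-point compactification $\mathbb{R}^d_\Delta$ (absorbed at $\Delta$ after the lifetime $\zeta=\inf\{t\ge0:X_t=\Delta\}$), such that $P_tf(x)=\mathbb{E}_x[f(X_t)]$ for all $t\ge0$, $x\in\mathbb{R}^d$, $f$ bounded Borel, with $f(\Delta):=0$. Definition. For $E\in\mathcal{B}(\mathbb{R}^d)$ let $L_E=\sup\{t\ge0:X_t\in E\}$ ($\sup\emptyset:=0$). $\mathbb{M}$ is recurrent in the probabilistic sense if $\mathbb{P}_x(L_U=\infty)=1$ for all $x\in\mathbb{R}^d$ and all non-empty open $U\subset\mathbb{R}^d$. *)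

(* Defs.v *)
From HB Require Import structures.
From mathcomp Require Import all_boot all_order all_algebra.
From mathcomp Require Import all_classical all_reals all_analysis.
From mathcomp Require Import measurable_realfun.

Set Implicit Arguments.
Unset Strict Implicit.
Unset Printing Implicit Defensive.

Import Order.TTheory GRing.Theory Num.Theory.
Import numFieldNormedType.Exports.

Local Open Scope classical_set_scope.
Local Open Scope ring_scope.

(* Borel sigma-algebras. *)
HB.instance Definition _ (R : realType) m n :=
  Measurable.copy 'M[R]_(m, n) (g_sigma_algebraType (@open 'M[R]_(m, n))).

HB.instance Definition _ (R : realType) n :=
  Measurable.copy (one_point_compactification 'rV[R]_n)
    (g_sigma_algebraType (@open (one_point_compactification 'rV[R]_n))).

Section lebesgue_tuple.
Context {R : realType}.

Local Notation T n := (n.-tuple (measurableTypeR R)).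

Definition tcons n (z : measurableTypeR R * T n) : T n.+1 :=
  [tuple of z.1 :: z.2].

Lemma measurable_tcons n : measurable_fun setT (@tcons n).
Proof. exact: measurable_cons. Qed.

Section step.
Variables (n : nat) (m : {sigma_finite_measure set (T n) -> \bar R}).

Definition lebesgue_step : set (T n.+1) -> \bar R :=
  pushforward ((@lebesgue_measure R \x m)%E) (@tcons n).

Let step0 : lebesgue_step set0 = 0%E.
Proof. by rewrite /lebesgue_step /pushforward preimage_set0 measure0. Qed.

Let step_ge0 B : (0 <= lebesgue_step B)%E.
Proof. by rewrite /lebesgue_step /pushforward; exact: measure_ge0. Qed.

Let mpre (B : set (T n.+1)) : measurable B -> measurable (@tcons n @^-1` B).
Proof.
by move=> mB; rewrite -[X in measurable X]setTI; exact: measurable_tcons.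
Qed.

Let step_additive : semi_sigma_additive lebesgue_step.
Proof.
move=> F mF tF mUF; rewrite /lebesgue_step /pushforward preimage_bigcup.
apply: measure_semi_sigma_additive.
- by move=> k; exact: mpre.
- apply/trivIsetP => /= i j _ _ ij; rewrite -preimage_setI.
  by move/trivIsetP : tF => /(_ _ _ _ _ ij) ->//; rewrite preimage_set0.
- by rewrite -preimage_bigcup; exact: mpre.
Qed.

HB.instance Definition _ := isMeasure.Build _ _ _ lebesgue_step
  step0 step_ge0 step_additive.

Let step_sigma_finite : sigma_finite setT lebesgue_step.
Proof.
have /sigma_finiteP[F [FT ndF Ffin]] := sigma_finiteT (@lebesgue_measure R).
have /sigma_finiteP[G [GT ndG Gfin]] := sigma_finiteT m.
pose h (t : T n.+1) : measurableTypeR R * T n :=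
  (thead t, [tuple of behead t]).
have hm : measurable_fun setT h.
  apply/measurable_fun_pairP; split.
  - exact: measurable_tnth.
  - exact: measurable_behead.
have hK z : h (tcons z) = z.
  by case: z => z1 z2; rewrite /h /tcons; congr pair; apply: val_inj.
exists (fun k => h @^-1` (F k `*` G k)).
  apply/seteqP; split=> // t _.
  have [i _ Fi] : (\bigcup_k F k) (h t).1 by rewrite -FT.
  have [j _ Gj] : (\bigcup_k G k) (h t).2 by rewrite -GT.
  exists (maxn i j) => //; split.
  - by move: Fi; exact/subsetPset/ndF/leq_maxl.
  - by move: Gj; exact/subsetPset/ndG/leq_maxr.
move=> k; have [mF Fk] := Ffin k; have [mG Gk] := Gfin k.
have mFG : measurable (F k `*` G k) by exact: measurableX.
split; first by rewrite -[X in measurable X]setTI; exact: hm.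
rewrite /lebesgue_step /pushforward.
rewrite (_ : @tcons n @^-1` (h @^-1` (F k `*` G k)) = F k `*` G k); last first.
  by apply/seteqP; split=> z; rewrite /preimage /mkset hK.
by rewrite product_measure1E// lte_mul_pinfty// ge0_fin_numE.
Qed.

HB.instance Definition _ := Measure_isSigmaFinite.Build _ _ _ lebesgue_step
  step_sigma_finite.

End step.

(* d-dimensional Lebesgue measure, as the d-fold product of lebesgue_measure. *)
Fixpoint lebesgue_tuple n : {sigma_finite_measure set (T n) -> \bar R} :=
  if n is k.+1 then lebesgue_step (lebesgue_tuple k)
  else \d_([tuple] : T 0).

End lebesgue_tuple.

Lemma lebesgue_tuple_box (R : realType) n (B : 'I_n -> set (measurableTypeR R)) :
  (forall i, measurable (B i)) ->
  lebesgue_tuple n [set t | forall i, B i (tnth t i)] =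
  (\prod_(i < n) lebesgue_measure (B i))%E.
Proof.
elim: n B => [|n IH] B mB /=.
  rewrite big_ord0 diracE mem_set//=; by case.
have mbox : measurable [set t : n.-tuple (measurableTypeR R) |
    forall i, B (lift ord0 i) (tnth t i)].
  rewrite (_ : mkset _ = \bigcap_(i in [set: 'I_n])
      ((@tnth n _)^~ i @^-1` B (lift ord0 i))).
    apply: fin_bigcap_measurable => // i _.
    by rewrite -[X in measurable X]setTI; exact: measurable_tnth.
  by apply/seteqP; split=> t /= h i; [move=> _; exact: h|exact: h].
rewrite big_ord_recl -IH// /lebesgue_step /pushforward -product_measure1E//.
congr (_ _); apply/seteqP; split=> -[x t] /=.
  move=> h; split; first by have := h ord0; rewrite tnth0.
  by move=> i; have := h (lift ord0 i); rewrite tnthS.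
move=> [hx ht] i; case: (unliftP ord0 i) => [j ->|->].
  by rewrite tnthS; exact: ht.
by rewrite tnth0.
Qed.

Definition row_of_tuple (R : realType) n (t : n.-tuple (measurableTypeR R)) :
  'rV[R]_n := \row_i tnth t i.

Lemma measurable_row_of_tuple (R : realType) n :
  measurable_fun setT (@row_of_tuple R n).
Proof.
apply: (@measurability _ _ _ _ _ _ (@open 'rV[R]_n)) => //.
move=> _ [U oU <-]; rewrite setTI.
pose box (z : {ffun 'I_n -> rat} * nat) : set 'rV[R]_n :=
  [set v | forall i, ball (ratr (z.1 i) : R) z.2.+1%:R^-1 (v ord0 i)].
have -> : U = \bigcup_(z in [set z | box z `<=` U]) box z.
  apply/seteqP; split=> [x Ux|x [z zU]]; last exact: zU.
  have /nbhs_ballP[e /= e0 eU] : nbhs x U by exact: open_nbhs_nbhs.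
  have [k ke] : exists k : nat, k.+1%:R^-1 < e / 2 :> R.
    have e20 : 0 < e / 2 by rewrite divr_gt0.
    near \oo => k; exists k; near: k.
    exact: near_infty_natSinv_lt (PosNum e20).
  have k0 : 0 < k.+1%:R^-1 :> R by rewrite invr_gt0.
  have hq i : exists q : rat, ball (ratr q : R) k.+1%:R^-1 (x ord0 i).
    have /rat_in_itvoo[q] : x ord0 i - k.+1%:R^-1 < x ord0 i + k.+1%:R^-1 :> R.
      by rewrite ltrBlDr -addrA ltrDl addr_gt0.
    rewrite in_itv /= => /andP[q1 q2].
    by exists q; rewrite /ball /= ltr_distl q1 q2.
  have [q hqx] := choice hq.
  exists ([ffun i => q i], k); last by move=> i; rewrite ffunE; exact: hqx.
  move=> y yq; apply: eU; split=> // j i; rewrite ord1.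
  have := yq i; rewrite /= ffunE => qy.
  apply: le_ball (ball_triangle (ball_sym (hqx i)) qy).
  by rewrite [leRHS]splitr lerD// ltW.
rewrite preimage_bigcup bigcup_mkcond.
apply: countable_bigcupT_measurable => [|z]; first exact: countableP.
case: ifPn => // _.
rewrite (_ : _ @^-1` _ = \bigcap_(i in [set: 'I_n])
    ((@tnth n _)^~ i @^-1` ball (ratr (z.1 i) : R) z.2.+1%:R^-1)).
  apply: fin_bigcap_measurable => // i _.
  rewrite -[X in measurable X]setTI; apply: measurable_tnth => //.
  by rewrite ball_itv; exact: measurable_itv.
apply/seteqP; split=> t /= h i; first by move=> _; have := h i; rewrite mxE.
by rewrite mxE; exact: h.
Unshelve. all: by end_near. Qed.

Section lebesgue_rV.
Context {R : realType} (n : nat).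

Definition lebesgue_rV : set 'rV[R]_n -> \bar R :=
  pushforward (lebesgue_tuple n) (@row_of_tuple R n).

Let mpre (B : set 'rV[R]_n) :
  measurable B -> measurable (@row_of_tuple R n @^-1` B).
Proof.
move=> mB; rewrite -[X in measurable X]setTI.
exact: measurable_row_of_tuple.
Qed.

Let lebesgue_rV0 : lebesgue_rV set0 = 0%E.
Proof. by rewrite /lebesgue_rV /pushforward preimage_set0 measure0. Qed.

Let lebesgue_rV_ge0 B : (0 <= lebesgue_rV B)%E.
Proof. by rewrite /lebesgue_rV /pushforward; exact: measure_ge0. Qed.

Let lebesgue_rV_additive : semi_sigma_additive lebesgue_rV.
Proof.
move=> F mF tF mUF; rewrite /lebesgue_rV /pushforward preimage_bigcup.
apply: measure_semi_sigma_additive.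
- by move=> k; exact: mpre.
- apply/trivIsetP => /= i j _ _ ij; rewrite -preimage_setI.
  by move/trivIsetP : tF => /(_ _ _ _ _ ij) ->//; rewrite preimage_set0.
- by rewrite -preimage_bigcup; exact: mpre.
Qed.

HB.instance Definition _ := isMeasure.Build _ _ _ lebesgue_rV
  lebesgue_rV0 lebesgue_rV_ge0 lebesgue_rV_additive.

End lebesgue_rV.
Arguments lebesgue_rV {R} n.

Section euclidean.
Context {R : realType} {d : nat}.
Local Notation E := 'rV[R]_d.
Local Notation leb := (@lebesgue_rV R d).

(* The library norm on 'rV[R]_d is the sup norm. *)
Definition enorm (x : E) : R := Num.sqrt (\sum_(i < d) x 0 i ^+ 2).

Definition eball (r : R) : set E := [set x | enorm x < r].

Definition dotp (x y : E) : R := \sum_(i < d) x 0 i * y 0 i.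

Definition mapv (M : 'M[R]_d) (x : E) : E := \row_i \sum_(j < d) M i j * x 0 j.

Definition pd (i : 'I_d) (f : E -> R) : E -> R := fun x => 'D_(delta_mx 0 i) f x.

Definition grad (f : E -> R) (x : E) : E := \row_i pd i f x.

Definition iter_pd (s : seq 'I_d) (f : E -> R) : E -> R := foldr pd f s.

Definition Ck (k : nat) (U : set E) (f : E -> R) : Prop :=
  forall s : seq 'I_d, (size s <= k)%N ->
    (forall x, U x -> {for x, continuous (iter_pd s f)}) /\
    ((size s < k)%N ->
       forall x i, U x -> derivable (iter_pd s f) x (delta_mx 0 i)).

Definition test_function (V : set E) (f : E -> R) : Prop :=
  [/\ forall k, Ck k setT f,
      compact (closure [set x | f x != 0]) &
      closure [set x | f x != 0] `<=` V].

Definition Lp_loc (p : R) (u : E -> R) : Prop :=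
  forall K : set E, compact K ->
    (fun x => u x * \1_K x) \in Lfun leb p%:E.

Definition weak_pd (i : 'I_d) (u v : E -> R) : Prop :=
  [/\ Lp_loc 1 u, Lp_loc 1 v &
      forall phi, test_function setT phi ->
        \int[leb]_x (u x * pd i phi x) = - \int[leb]_x (v x * phi x)].

(* Weak derivatives are only determined almost everywhere: wpd picks one
   representative, and is 0 when u has no weak derivative. *)
Definition wpd (i : 'I_d) (u : E -> R) : E -> R :=
  xget (fun=> 0) [set v | weak_pd i u v].

Definition wgrad (u : E -> R) (x : E) : E := \row_i wpd i u x.

Definition H1p_loc (p : R) (u : E -> R) : Prop :=
  Lp_loc p u /\
  forall i : 'I_d, exists v, weak_pd i u v /\ Lp_loc p v.

(* (div_rows B)_i = \sum_j \partial_j b_ij *)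
Definition div_rows (B : E -> 'M[R]_d) (x : E) : E :=
  \row_i \sum_(j < d) wpd j (fun y => B y i j) x.

Definition relatively_compact (V : set E) : Prop := compact (closure V).

Definition exhaustion (V : nat -> set E) : Prop :=
  [/\ forall n, open (V n), forall n, relatively_compact (V n),
      forall n, V n `<=` V n.+1 & \bigcup_n V n = setT].

End euclidean.

Section operator.
Context {R : realType} {d : nat}.
Local Notation E := 'rV[R]_d.
Implicit Types (A C : E -> 'M[R]_d) (H G : E -> E).

Definition assumption_a (p : R) A C H : Prop :=
  [/\ forall i j, (forall x, A x j i = A x i j) /\
        H1p_loc 2 (fun x => A x i j) /\ continuous (fun x => A x i j),
      forall V : set E, relatively_compact V -> exists2 nu : R, 0 < nu &
        forall x xi, V x ->
          nu^-1 * enorm xi ^+ 2 <= dotp (mapv (A x) xi) xi <= nu * enorm xi ^+ 2,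
      forall i j, (forall x, - C x j i = C x i j) /\
        H1p_loc 2 (fun x => C x i j) /\ continuous (fun x => C x i j) &
      forall i, Lp_loc p (fun x => H x 0 i)].

Definition drift A C H (x : E) : E :=
  2^-1 *: div_rows (fun y => A y + (C y)^T) x + H x.

Definition assumption_b (q : R) G : Prop := forall i, Lp_loc q (fun x => G x 0 i).

Definition Lop A G (f : E -> R) (x : E) : R :=
  2^-1 * (\sum_(i < d) \sum_(j < d) A x i j * pd i (pd j f) x) + dotp (G x) (grad f x).

Definition is_density (rho : E -> R) (mu : set E -> \bar R) : Prop :=
  forall B : set E, measurable B ->
    mu B = (\int[@lebesgue_rV R d]_(x in B) (rho x)%:E)%E.

Definition invariant_density (p : R) A G (rho : E -> R)
    (mu : {measure set E -> \bar R}) : Prop :=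
  [/\ H1p_loc p rho, continuous rho, forall x, 0 < rho x, is_density rho mu &
      forall f, test_function setT f -> \int[mu]_x Lop A G f x = 0].

Definition log_drift A (rho : E -> R) (x : E) : E :=
  \row_i (2^-1 * \sum_(j < d)
    (wpd j (fun y => A y i j) x + A x i j * (wpd j rho x / rho x))).

Definition residual_drift A G (rho : E -> R) (x : E) : E :=
  G x - log_drift A rho x.

End operator.

Definition Lp_cvg d (T : measurableType d) (R : realType)
    (mu : {measure set T -> \bar R}) (p : \bar R) (un : nat -> T -> R)
    (u : T -> R) : Prop :=
  (fun n => Lnorm mu p (fun x => (un n x - u x)%:E)) @ \oo --> 0%E.

Section local_resolvent.
Context {R : realType} {d : nat}.
Local Notation E := 'rV[R]_d.
Variables (A : E -> 'M[R]_d) (B : E -> E) (mu : {measure set E -> \bar R}).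
Variable (V : set E).
Implicit Types u v w f : E -> R.

(* L^p(V, mu): functions on the whole space that vanish off V. *)
Definition Lp_on (p : \bar R) u : Prop :=
  u \in Lfun mu p /\ forall x, ~ V x -> u x = 0.

Definition pre_form u v : R :=
  2^-1 * \int[mu]_(x in V) dotp (mapv (A x) (grad u x)) (grad v x).

Definition form_approx u (un : nat -> E -> R) : Prop :=
  [/\ forall n, test_function V (un n),
      forall e, 0 < e -> exists N, forall m n, (N <= m)%N -> (N <= n)%N ->
        pre_form (un m \- un n) (un m \- un n) < e &
      Lp_cvg mu 2 un u].

Definition form_dom u : Prop := Lp_on 2 u /\ exists un, form_approx u un.

Definition closed_form u v (r : R) : Prop :=
  exists un vn, [/\ form_approx u un, form_approx v vn &
    (fun n => pre_form (un n) (vn n)) @ \oo --> r].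

(* Graph of L^{0,V}. *)
Definition sym_generator u w : Prop :=
  [/\ form_dom u, Lp_on 2 w &
      forall v, form_dom v -> closed_form u v (- \int[mu]_(x in V) (w x * v x))].

(* Graph of u |-> L^{0,V} u + <B, \nabla u> on the bounded elements of
   D(L^{0,V}). *)
Definition local_pre_generator u f : Prop :=
  [/\ u \in Lfun mu +oo, Lp_on 1 f & exists2 w, sym_generator u w &
      {ae mu, forall x, V x -> f x = w x + dotp (B x) (wgrad u x)}].

Definition local_generator u f : Prop :=
  [/\ Lp_on 1 u, Lp_on 1 f & exists un fn,
      [/\ forall n, local_pre_generator (un n) (fn n),
          Lp_cvg mu 1 un u & Lp_cvg mu 1 fn f]].

(* u = (alpha - local_generator)^-1 f *)
Definition local_resolvent (alpha : R) f u : Prop :=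
  local_generator u (fun x => alpha * u x - f x).

End local_resolvent.

Section semigroup.
Context {R : realType} {d : nat}.
Local Notation E := 'rV[R]_d.
Variable mu : {measure set E -> \bar R}.
(* Operators act on functions and are constrained up to mu-a.e. equality. *)
Variable T : R -> (E -> R) -> (E -> R).
Implicit Types u v f g : E -> R.

Record subMarkov_C0_contraction_semigroup : Prop := SubMarkovSemigroup {
  sg_L1 : forall t f, 0 < t -> f \in Lfun mu 1 -> T t f \in Lfun mu 1 ;
  sg_ae : forall t f g, 0 < t -> f \in Lfun mu 1 -> g \in Lfun mu 1 ->
    {ae mu, forall x, f x = g x} -> {ae mu, forall x, T t f x = T t g x} ;
  sg_linear : forall t a f g, 0 < t -> f \in Lfun mu 1 -> g \in Lfun mu 1 ->
    {ae mu, forall x, T t (fun y => a * f y + g y) x = a * T t f x + T t g x} ;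
  sg_contraction : forall t f, 0 < t -> f \in Lfun mu 1 ->
    (Lnorm mu 1 (EFin \o T t f) <= Lnorm mu 1 (EFin \o f))%E ;
  sg_subMarkov : forall t f, 0 < t -> f \in Lfun mu 1 ->
    {ae mu, forall x, 0 <= f x <= 1} -> {ae mu, forall x, 0 <= T t f x <= 1} ;
  sg_add : forall s t f, 0 < s -> 0 < t -> f \in Lfun mu 1 ->
    {ae mu, forall x, T (s + t) f x = T s (T t f) x} ;
  sg_continuous : forall f, f \in Lfun mu 1 ->
    Lnorm mu 1 (fun x => (T t f x - f x)%:E) @[t --> 0^'+] --> 0%E }.

(* Graph of the L^1(mu)-generator. *)
Definition generator u v : Prop :=
  [/\ u \in Lfun mu 1, v \in Lfun mu 1 &
      Lnorm mu 1 (fun x => (t^-1 * (T t u x - u x) - v x)%:E) @[t --> 0^'+]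
        --> 0%E].

Definition resolvent (alpha : R) f u : Prop :=
  generator u (fun x => alpha * u x - f x).

(* T is the semigroup whose resolvent is the L^1-limit of the local
   resolvents along any exhaustion. *)
Definition global_semigroup (A : E -> 'M[R]_d) (G : E -> E) (rho : E -> R) :
    Prop :=
  [/\ subMarkov_C0_contraction_semigroup,
      forall alpha f V, 0 < alpha -> f \in Lfun mu 1 -> exhaustion V ->
        exists w u,
          [/\ forall n, local_resolvent A (residual_drift A G rho) mu (V n)
                alpha (fun x => f x * \1_(V n) x) (w n),
              resolvent alpha f u & Lp_cvg mu 1 w u] &
      forall f, test_function setT f -> generator f (Lop A G f)].

(* v is a version of T_t f, where T_t is extended from L^1 n L^oo to
   L^s(mu): by density when s < +oo, and along bounded truncations to the
   sets of an exhaustion when s = +oo. *)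
Definition extension (s : \bar R) (t : R) f v : Prop :=
  v \in Lfun mu s /\
  if s == +oo%E then
    forall V, exhaustion V ->
      {ae mu, forall x,
        (fun n => T t (fun y => f y * \1_(V n) y) x) @ \oo --> v x}
  else
    exists2 fn, (forall n, fn n \in Lfun mu 1 /\ fn n \in Lfun mu +oo) &
      Lp_cvg mu s fn f /\ Lp_cvg mu s (fun n => T t (fn n)) v.

Definition continuous_version (P : R -> (E -> R) -> (E -> R)) : Prop :=
  (forall f, P 0 f = f) /\
  forall s t f, (1 <= s)%E -> 0 < t -> f \in Lfun mu s ->
    continuous (P t f) /\ extension s t f (P t f).

End semigroup.

Section process.
Context {R : realType} {d : nat}.
Local Notation E := 'rV[R]_d.
Local Notation S := (one_point_compactification 'rV[R]_d).
Context {d' : measure_display} {Om : measurableType d'}.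
Variables (F : R -> set (set Om)) (X : R -> Om -> S) (P : S -> probability Om R).

Definition lifetime (w : Om) : \bar R :=
  ereal_inf [set t%:E | t in [set t : R | 0 <= t /\ X t w = None]].

Definition stopping_time (tau : Om -> \bar R) : Prop :=
  (forall w, 0 <= tau w)%E /\
  forall t, 0 <= t -> F t [set w | (tau w <= t%:E)%E].

Definition prior_event (tau : Om -> \bar R) (B : set Om) : Prop :=
  measurable B /\
  forall t, 0 <= t -> F t (B `&` [set w | (tau w <= t%:E)%E]).

(* Meaningful where tau is finite. *)
Definition stopped (tau : Om -> \bar R) (s : R) (w : Om) : S :=
  X (fine (tau w) + s) w.

(* The cemetery Delta is None. The process is only relevant at times t >= 0. *)
Record Hunt_process : Prop := HuntProcess {
  hunt_filtration : forall t, 0 <= t ->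
    sigma_algebra setT (F t) /\ F t `<=` measurable ;
  hunt_right_continuous_filtration : forall t, 0 <= t ->
    F t = \bigcap_(s in [set s : R | t < s]) F s ;
  hunt_adapted : forall t B, 0 <= t -> measurable B -> F t (X t @^-1` B) ;
  hunt_kernel : forall B,
    <<s [set X t @^-1` D | t in [set t : R | 0 <= t] & D in measurable] >> B ->
    measurable_fun setT (fun x => P x B) ;
  hunt_normal : forall x, P x [set w | X 0 w = x] = 1%E ;
  hunt_cemetery : forall t w, 0 <= t -> (lifetime w <= t%:E)%E -> X t w = None ;
  hunt_right_continuous : forall t w, 0 <= t -> X s w @[s --> t^'+] --> X t w ;
  hunt_left_limits : forall t w, 0 < t -> cvg (X s w @[s --> t^'-]) ;
  hunt_strong_Markov : forall x tau B s D,
    stopping_time tau -> prior_event tau B -> 0 <= s -> measurable D ->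
    P x (B `&` [set w | (tau w < +oo)%E] `&` [set w | D (stopped tau s w)]) =
    (\int[P x]_(w in B `&` [set w | (tau w < +oo)%E])
        P (stopped tau 0 w) [set w' | D (X s w')])%E ;
  hunt_quasi_left_continuous : forall x (taun : nat -> Om -> \bar R) tau,
    (forall n, stopping_time (taun n)) -> stopping_time tau ->
    (forall w n, taun n w <= taun n.+1 w)%E ->
    (forall w, tau w = ereal_sup [set taun n w | n in setT]) ->
    {ae P x, forall w, (tau w < +oo)%E ->
      (fun n => stopped (taun n) 0 w) @ \oo --> stopped tau 0 w} }.

Definition continuous_paths : Prop :=
  forall w, {within `[0, +oo[, continuous (fun t => X t w)}.

Definition has_transition (Pt : R -> (E -> R) -> (E -> R)) : Prop :=
  forall (t : R) (x : E) (f : E -> R), 0 <= t -> measurable_fun setT f ->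
    (exists M, forall y, `|f y| <= M) ->
    (Pt t f x)%:E = ('E_(P (Some x))[fun w => oapp f 0%R (X t w)])%E.

Definition last_exit (U : set E) (w : Om) : \bar R :=
  ereal_sup (0%E |`
    [set t%:E | t in [set t : R | 0 <= t /\ (Some @` U) (X t w)]]).

Definition recurrent : Prop :=
  forall (x : E) (U : set E), open U -> U !=set0 ->
    P (Some x) [set w | last_exit U w = +oo%E] = 1%E.

End process.

(* Main.v *)
(* Let K be the time-one operator of the semigroup. Composing g with suitable
   smooth cutoffs gives, for every m > 0, a compactly supported C^2 function f_m
   whose value at each point tends to infinity with m, while L f_m is bounded
   below by a bounded function of compact support that does not depend on m.
   Approximating f_m by test functions and telescoping over small time steps
   yields f_m - K f_m <= k' a.e. with one integrable k' >= 0 for all m.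

   By Garsia's maximal inequality for the L^1-contraction K, if f, v >= 0 are
   integrable and the potential of v is bounded, then v vanishes a.e. where the
   potential of f is infinite. Iterating the previous inequality, almost every
   point has infinite potential for f = k' or for f = f_m with m large. Applied
   to the restrictions to balls of v = u - K u, this shows that a superharmonic u
   with 0 <= u <= 1 is harmonic. In particular K 1 = 1.

   Let w(x) be the probability that the chain started at x avoids U at all times
   n >= 1. Then w is harmonic, hence continuous by the strong Feller property,
   and w = 0 on U. The truncations min(k w, 1) are superharmonic, hence harmonic
   and continuous, and increase to the indicator of {w > 0}, which is therefore
   harmonic and continuous. As space is connected and U is non-empty, w = 0.
   By the Markov property U is visited at arbitrarily large integer times. *)
Require Import Defs.
From HB Require Import structures.
From mathcomp Require Import all_boot all_order all_algebra.
From mathcomp Require Import all_classical all_reals all_analysis.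
From mathcomp Require Import measurable_realfun ring lra.

Set Implicit Arguments.
Unset Strict Implicit.
Unset Printing Implicit Defensive.

Import Order.TTheory GRing.Theory Num.Theory.
Import numFieldNormedType.Exports.
Local Open Scope classical_set_scope.
Local Open Scope ring_scope.

(** What shapes the proof is that only test functions are known to lie in the domain of the
    generator, while [g] is C^2 only off a ball and tends to infinity. The cutoffs are therefore
    constant where [g <= M], with [M] the maximum of [g] on a slightly larger ball, and vanish where
    [g] is large. The drift is only locally in L^q, so [L] of a compactly supported C^2 function is
    integrable but possibly unbounded; errors are measured by the integral of the negative part,
    which positive contractions do not increase. The common bound is [k' = e |kap| + |K kap|] with
    [kap = (1 - L)^-1 z], where [z] is a multiple of the indicator of a ball and [L f_m >= - z] for
    all m. Infinite potentials arise as follows: if the potential of [k'] at x is at most C, choose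
    m with [f_m(x) > C + 1]; iterating gives [K^N f_m(x) >= 1] for every N, so the potential of
    [f_m] diverges at x. Which alternative holds may depend on x; both force [v(x) = 0]. Continuity
    of [K f] for bounded f, together with [mu] charging every open set, turns almost everywhere
    statements into pointwise ones. *)

(** * Reflections preserve Lebesgue measure *)

Lemma image_measure d1 d2 (T1 : measurableType d1) (T2 : measurableType d2)
    (R : realType) (m : {measure set T1 -> \bar R}) (f : T1 -> T2) :
  measurable_fun setT f ->
  exists m' : {measure set T2 -> \bar R}, forall A, m' A = m (f @^-1` A).
Proof. by move=> mf; unshelve (exists (pushforward m f)). Qed.

(** Uniqueness of the measure with given values on half-open intervals. Reflections [y |-> c - y]
    are the substitution behind the commutativity of convolution, and they also carry a ball about
    [c] to a ball about 0. *)
Lemma lebesgue_measure_refl (R : realType) (c : R) (A : set (measurableTypeR R)) :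
  measurable A -> lebesgue_measure ((fun z => c - z) @^-1` A) = lebesgue_measure A.
Proof.
have mc : measurable_fun setT ((fun z => c - z) : measurableTypeR R -> measurableTypeR R).
  by apply: measurable_funB => //; exact: measurable_cst.
move=> mA; apply/esym.
have [nu nuE] := image_measure (@lebesgue_measure R) mc.
rewrite -nuE; apply: lebesgue_measure_unique => // _ [[a b]] _ <-; rewrite nuE.
rewrite (_ : _ @^-1` _ = `[c - b, c - a[%classic); last first.
  by apply/seteqP; split=> z /=; rewrite !in_itv /= => /andP[h1 h2]; apply/andP; split; lra.
rewrite lebesgue_measure_itv /= lebesgue_measure_itv /= !lte_fin.
rewrite (_ : (c - b < c - a) = (a < b)); last by apply/idP/idP; lra.
by case: ifP => // _; rewrite -!EFinD; congr EFin; lra.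
Qed.

Definition tuple_refl (R : realType) n (c t : n.-tuple (measurableTypeR R)) :
    n.-tuple (measurableTypeR R) :=
  [tuple (tnth c i - tnth t i : measurableTypeR R) | i < n].

Lemma measurable_tuple_refl (R : realType) n (c : n.-tuple (measurableTypeR R)) :
  measurable_fun setT (tuple_refl c).
Proof.
apply/measurable_fun_tnthP => i.
rewrite (_ : _ \o _ = (fun t => tnth c i - tnth t i : measurableTypeR R)); last first.
  by apply/funext => t; rewrite /= tnth_mktuple.
apply: measurable_funB => //; exact: measurable_tnth.
Qed.

Lemma lebesgue_tuple_refl (R : realType) n (c : n.-tuple (measurableTypeR R)) A :
  measurable A -> lebesgue_tuple n (tuple_refl c @^-1` A) = lebesgue_tuple n A.
Proof.
elim: n c A => [|n IH] c A mA.
  rewrite (_ : _ @^-1` A = A) //; apply/seteqP; split => t /=;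
  by rewrite (tuple0 (tuple_refl c t)) (tuple0 t).
rewrite /= /lebesgue_step /pushforward.
pose c' : n.-tuple (measurableTypeR R) := [tuple of behead c].
pose r (z : measurableTypeR R * n.-tuple (measurableTypeR R)) :
  measurableTypeR R * n.-tuple (measurableTypeR R) :=
  (thead c - z.1, tuple_refl c' z.2).
have mr : measurable_fun setT r.
  apply/measurable_fun_pairP; split.
    by apply: measurable_funB => //; exact: measurable_cst.
  by apply: (measurableT_comp (measurable_tuple_refl c')); exact: measurable_snd.
have mA' : measurable (@tcons R n @^-1` A).
  by rewrite -[X in measurable X]setTI; exact: measurable_tcons.
(* Reflecting a tuple acts separately on head and tail, so uniqueness of product measures gives the
   inductive step. *)
have E : tuple_refl c \o @tcons R n = @tcons R n \o r.
  apply/funext => -[z t]; apply: eq_from_tnth => i; rewrite tnth_mktuple.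
  case: (unliftP ord0 i) => [j ->|->].
    rewrite !tnthS tnth_mktuple tnth_behead (_ : inord j.+1 = lift ord0 j) //.
    by apply/val_inj; rewrite /= inordK // ltnS.
  by rewrite !tnth0.
rewrite -[X in _ X = _]/((tuple_refl c \o @tcons R n) @^-1` A) E.
rewrite -[X in X = _]/((@lebesgue_measure R \x lebesgue_tuple n)%E (r @^-1` (@tcons R n @^-1` A))).
apply/esym.
have [nu nuE] := image_measure ((@lebesgue_measure R \x lebesgue_tuple n)%E) mr.
rewrite -nuE; apply: product_measure_unique => // B D mB mD; rewrite nuE.
rewrite (_ : r @^-1` _ = ((fun z : measurableTypeR R => thead c - z) @^-1` B) `*` (tuple_refl c' @^-1` D)) //.
have mB' : measurable ((fun z : measurableTypeR R => thead c - z) @^-1` B).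
  rewrite -[X in measurable X]setTI.
  have : measurable_fun setT (fun z : measurableTypeR R => thead c - z : measurableTypeR R).
    by apply: measurable_funB => //; exact: measurable_cst.
  exact.
have mD' : measurable (tuple_refl c' @^-1` D).
  by rewrite -[X in measurable X]setTI; exact: measurable_tuple_refl.
apply: (eq_trans (product_measure1E _ _ mB' mD')); rewrite /= IH //.
by congr (_ * _)%E; exact: lebesgue_measure_refl.
Qed.

Lemma continuous_measurable_rV (R : realType) n (f : 'rV[R]_n -> R) :
  continuous f -> measurable_fun setT f.
Proof.
move=> cf; apply: (measurability _ (RGenOpens.measurableE R)) => //.
move=> _ [_ [a [b ->] <-]]; rewrite setTI.
apply: sub_sigma_algebra; move/continuousP : cf; apply; exact: interval_open.
Qed.

Lemma measurable_rV_refl (R : realType) n (x : 'rV[R]_n) :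
  measurable_fun setT (fun y : 'rV[R]_n => x - y).
Proof.
apply: (@measurability _ _ _ _ _ _ (@open 'rV[R]_n)) => //.
move=> _ [U oU <-]; rewrite setTI; apply: sub_sigma_algebra.
apply: open_comp => // y _.
by apply: continuousB; [exact: cst_continuous|exact: cvg_id].
Qed.

Lemma lebesgue_rV_refl (R : realType) n (x : 'rV[R]_n) B :
  measurable B -> lebesgue_rV n ((fun y => x - y) @^-1` B) = lebesgue_rV n B.
Proof.
move=> mB; rewrite /lebesgue_rV /pushforward.
have mB' : measurable (@row_of_tuple R n @^-1` B).
  by rewrite -[X in measurable X]setTI; exact: measurable_row_of_tuple.
rewrite -(lebesgue_tuple_refl [tuple (x 0 i : measurableTypeR R) | i < n] mB').
congr (lebesgue_tuple n _).
have E : (fun y => x - y) \o @row_of_tuple R n =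
    @row_of_tuple R n \o tuple_refl [tuple (x 0 i : measurableTypeR R) | i < n].
  by apply/funext => t; apply/rowP => i; rewrite !mxE !tnth_mktuple.
by rewrite -[LHS]/(((fun y => x - y) \o @row_of_tuple R n) @^-1` B) E.
Qed.

Lemma is_derive_cvg (R : realType) (V : normedModType R) (f : V -> R) x v (l : R) :
  (h^-1 *: (f (h *: v + x) - f x)) @[h --> (0 : R)^'] --> l -> is_derive x v f l.
Proof.
by move=> fl; split; [apply/cvg_ex; exists l|exact: (cvg_lim _ fl)].
Qed.

(** * Approximation of C^k functions by test functions *)

Section calculus.
Context {R : realType} {n : nat}.
Local Notation E := 'rV[R]_n.
Implicit Types (f df : E -> R) (v x y : E).

Lemma is_derive_line f df v :
  (forall x, is_derive x v f (df x)) ->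
  forall x t, is_derive t (1 : R) (fun t => f (t *: v + x)) (df (t *: v + x)).
Proof.
move=> fd x t.
have [d <-] := fd (t *: v + x).
have E : (fun h : R => h^-1 *: (((fun t => f (t *: v + x)) \o shift t) (h *: (1 : R)) - f (t *: v + x))) =
  (fun h : R => h^-1 *: ((f \o shift (t *: v + x)) (h *: v) - f (t *: v + x))).
  by apply/funext => h /=; rewrite scalerDl -addrA /GRing.scale /= mulr1.
by split; rewrite /derivable /derive E.
Qed.

Lemma derive_line_MVT f df v x (h : R) : continuous f ->
  (forall x, is_derive x v f (df x)) ->
  exists2 t, `|t| <= `|h| & f (h *: v + x) - f x = h * df (t *: v + x).
Proof.
move=> cf fd; have fl := is_derive_line fd x.
have cl : continuous (fun t : R => f (t *: v + x)).
  move=> t; apply: (@continuous_comp _ _ _ (fun t : R => t *: v + x) f); last exact: cf.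
  by apply: continuousD; [exact: scalel_continuous|exact: cst_continuous].
case: (ltgtP h 0) => h0.
- have [|t tI E] := MVT h0 (fun t _ => fl t); first exact: continuous_subspaceT.
  exists t; first by move: tI; rewrite in_itv /= => /andP[? ?]; rewrite !ltr0_norm // lerN2 ltW.
  by move: E; rewrite /= scale0r add0r => E; rewrite -[LHS]opprB E; ring.
- have [|t tI E] := MVT h0 (fun t _ => fl t); first exact: continuous_subspaceT.
  exists t; first by move: tI; rewrite in_itv /= => /andP[? ?]; rewrite !gtr0_norm // ltW.
  by move: E; rewrite /= scale0r add0r => ->; ring.
- by exists 0; rewrite ?normr0 ?h0 ?normr_ge0// !scale0r add0r subrr mul0r.
Qed.

Definition unif_cont f := forall e : R, 0 < e -> exists2 r : R, 0 < r &
  forall x y, `|x - y| <= r -> `|f x - f y| <= e.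

(** By the mean value theorem the quotient is a value of [df] within [|h| * |v|] of [x], so uniform
    continuity of [df] makes the convergence uniform in [x]. This is what permits differentiation
    under the integral sign. *)
Lemma derive_unif f df v : continuous f -> unif_cont df ->
  (forall x, is_derive x v f (df x)) ->
  forall e, 0 < e -> exists2 r : R, 0 < r &
  forall x h, h != 0 -> `|h| < r -> `|h^-1 * (f (h *: v + x) - f x) - df x| <= e.
Proof.
move=> cf uf fd e e0; have [r r0 rP] := uf e e0.
have v0 : 0 < `|v| + 1 by rewrite ltr_wpDl.
exists (r / (`|v| + 1)); first by rewrite divr_gt0.
move=> x h h0 hr; have [t th ->] := derive_line_MVT x h cf fd.
rewrite mulKf//; apply: rP; rewrite addrK normrZ.
rewrite ltr_pdivlMr// in hr; apply: le_trans (ltW hr).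
by apply: ler_pM => //; rewrite lerDl.
Qed.

Definition Cc f := continuous f /\ exists2 r : R, 0 < r & forall x, r <= `|x| -> f x = 0.

Lemma closed_ball_compact (r : R) : compact [set x : E | `|x| <= r].
Proof.
apply: bounded_closed_compact.
  exists r; split; first exact: num_real.
  by move=> s rs x /= xr; apply: (le_trans xr); exact: ltW.
apply: (@closed_comp _ _ (fun x : E => `|x|) [set s : R | s <= r]); last exact: closed_le.
by move=> x _; exact: norm_continuous.
Qed.

Lemma Cc_bounded f : Cc f -> exists2 M : R, 0 <= M & forall x, `|f x| <= M.
Proof.
move=> [cf [r r0 fr]].
have cA : {within [set x : E | `|x| <= r], continuous (fun x => `|f x|)}.
  apply: continuous_subspaceT => x.
  by apply: continuous_comp; [exact: cf|exact: norm_continuous].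
have [|c _ cP] := EVT_max_rV _ (@closed_ball_compact r) cA.
  by exists 0; rewrite /= normr0 ltW.
exists `|f c| => // x; case: (leP `|x| r) => xr.
  by apply: cP; exact/mem_set.
by rewrite fr ?normr0 ?normr_ge0 //; exact: ltW.
Qed.

Lemma Cc_unif_cont f : Cc f -> unif_cont f.
Proof.
move=> [cf [r r0 fr]] e e0.
have := @closed_ball_compact (r + 1).
move/compact_near_coveringP => /(_ _ (0 : R)^'+
  (fun d x => forall y, `|x - y| <= d -> `|f x - f y| <= e)).
case=> [x _|d /= d0 dP].
  have e2 : 0 < e / 2 by rewrite divr_gt0.
  have /nbhs_ballP[q /= q0 qP] : \forall z \near x, `|f x - f z| < e / 2.
    by have /cvgrPdist_lt := cf x; exact.
  exists (ball x (q / 2), [set d | d < q / 2]).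
    split; first by apply/nbhs_ballP; exists (q / 2) => //=; rewrite divr_gt0.
    by apply: nbhs_right_lt; rewrite divr_gt0.
  move=> [x' d] /= [xx' dq] y x'y.
  have xy : ball x q y.
    rewrite -ball_normE /= (_ : x - y = (x - x') + (x' - y)); last by rewrite addrA subrK.
    rewrite -ball_normE /= in xx'.
    by apply: (le_lt_trans (ler_normD _ _)); lra.
  have x'q : ball x q x' by apply: le_ball xx'; lra.
  have h1 := qP _ xy; have h2 := qP _ x'q.
  rewrite (_ : f x' - f y = (f x - f y) - (f x - f x')); last by lra.
  by apply: (le_trans (ler_normB _ _)); rewrite /= in h1 h2; lra.
(* Compactness gives the modulus [d / 2] on the ball of radius [r + 1]; the bound 1 ensures that if
   [x] lies outside that ball then both points are off the support. *)
exists (Num.min 1 (d / 2)); first by rewrite lt_min ltr01 divr_gt0.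
have dd : 0 < d / 2 by rewrite divr_gt0.
have dP' := dP (d / 2); rewrite /= in dP'.
have {}dP' : [set x | `|x| <= r + 1] `<=` (fun x => forall y, `|x - y| <= d / 2 -> `|f x - f y| <= e).
  apply: dP' => //; rewrite /ball /= sub0r normrN gtr0_norm //; lra.
move=> x y; rewrite le_min => /andP[xy1 xyd].
case: (leP `|x| (r + 1)) => xr; first exact: dP'.
have yr : r <= `|y|.
  rewrite leNgt; apply/negP => yr.
  have := ler_normD (x - y) y; rewrite subrK; lra.
by rewrite !fr ?subrr ?normr0 //; lra.
Qed.

Lemma Cc_out f df v : Cc f -> continuous df ->
  (forall x, is_derive x v f (df x)) -> Cc df.
Proof.
move=> [cf [r r0 fr]] cdf fd; split => //.
exists (r + 1); first by lra.
move=> x xr; have [_ <-] := fd x; suff [] : is_derive x v f 0 by [].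
  apply: (near_eq_is_derive (f := cst 0)).
  near=> y; rewrite /= fr//.
  have /ltW : `|x - y| < 1 by near: y; apply: cvgr_dist_lt => //; exact: cvg_id.
  by have := ler_normD (x - y) y; rewrite subrK; lra.
Unshelve. all: by end_near. Qed.

End calculus.

(** * Convolution of compactly supported continuous functions *)

Section convolution.
Context {R : realType} {n : nat}.
Local Notation E := 'rV[R]_n.
Local Notation leb := (@lebesgue_rV R n).
Implicit Types (f a b phi : E -> R) (v x y : E).

Lemma near_dist_le x (r : R) : 0 < r -> \forall z \near x, `|x - z| <= r.
Proof.
by move=> r0; apply/nbhs_ballP; exists r => //= z; rewrite -ball_normE /= => /ltW.
Qed.

Lemma coord_le_norm x i : `|x 0 i| <= `|x|.
Proof.
rewrite [leRHS]mx_normrE; exact: (le_bigmax _ (fun ij : 'I_1 * 'I_n => `|x ij.1 ij.2|) (0, i)).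
Qed.

Lemma norm_le_coord x r : 0 <= r -> (forall i, `|x 0 i| <= r) -> `|x| <= r.
Proof.
move=> r0 xr; rewrite [leLHS]mx_normrE; apply/bigmax_leP; split => // -[i j] _ /=.
by rewrite ord1.
Qed.

Lemma measurable_closed_ball (r : R) : measurable [set x : E | `|x| <= r].
Proof.
rewrite -[X in measurable X]setCK; apply: measurableC.
apply: sub_sigma_algebra; apply: closed_openC.
apply: compact_closed; [exact: norm_hausdorff|exact: closed_ball_compact].
Qed.

Lemma lebesgue_rV_box (B : 'I_n -> set (measurableTypeR R)) :
  (forall i, measurable (B i)) ->
  leb [set x | forall i, B i (x 0 i)] = (\prod_(i < n) lebesgue_measure (B i))%E.
Proof.
move=> mB; rewrite -lebesgue_tuple_box // /lebesgue_rV /pushforward.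
congr (lebesgue_tuple n _); apply/seteqP; split => t /= h i; have := h i; by rewrite mxE.
Qed.

Lemma lebesgue_rV_ball (r : R) : 0 <= r ->
  leb [set x : E | `|x| <= r] = (\prod_(i < n) (r *+ 2)%:E)%E.
Proof.
move=> r0.
rewrite (_ : [set x : E | _] = [set x : E | forall i, (`[- r, r]%classic : set (measurableTypeR R)) (x 0 i)]).
  rewrite (lebesgue_rV_box (B := fun=> `[- r, r]%classic)) //; apply: eq_bigr => i _.
  rewrite lebesgue_measure_itv /= lte_fin.
  case: ifPn => h; first by rewrite -EFinD; congr EFin; rewrite mulr2n; lra.
  by congr EFin; rewrite mulr2n; lra.
apply/seteqP; split => x /= h.
  by move=> i; rewrite in_itv /= -ler_norml; exact: le_trans (coord_le_norm x i) h.
by apply: norm_le_coord => // i; have := h i; rewrite in_itv /= -ler_norml.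
Qed.

Lemma lebesgue_rV_ball_fin (r : R) : (leb [set x : E | (`|x| <= r)%R] < +oo)%E.
Proof.
have [r0|r0] := leP 0 r; first by rewrite lebesgue_rV_ball // prodEFin ltry.
rewrite (_ : [set x : E | _] = set0) ?measure0 //.
by apply/seteqP; split => x //= h; have := normr_ge0 x; lra.
Qed.

Lemma Cc_integrable f : Cc f -> leb.-integrable setT (EFin \o f).
Proof.
move=> cf; have [M M0 fM] := Cc_bounded cf.
case: cf => cf [r r0 fr].
have -> : EFin \o f = (EFin \o f) \_ [set x : E | `|x| <= r].
  apply/funext => x; rewrite /patch; case: ifPn => //.
  by move=> /negP; rewrite in_setE => /= /negP; rewrite -ltNge => /ltW /fr /= ->.
apply/(integrable_mkcond _ (measurable_closed_ball r)).
apply: measurable_bounded_integrable.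
- exact: measurable_closed_ball.
- exact: lebesgue_rV_ball_fin.
- by apply: measurable_funTS; exact: continuous_measurable_rV.
- exists M; split; first exact: num_real.
  by move=> K MK x _ /=; exact: le_trans (fM x) (ltW MK).
Qed.

Lemma Cc_refl f x : Cc f -> Cc (fun y => f (x - y)).
Proof.
move=> [cf [r r0 fr]]; split.
  move=> y; apply: (@continuous_comp _ _ _ (fun y : E => x - y) f); last exact: cf.
  by apply: continuousB; [exact: cst_continuous|exact: cvg_id].
exists (r + `|x|); first by rewrite ltr_wpDr.
move=> y ry; apply: fr; have := ler_distD 0 x y.
by have := lerB_dist y x; rewrite distrC; lra.
Qed.

Lemma CcM a b : continuous a -> Cc b -> Cc (fun x => a x * b x).
Proof.
move=> ca [cb [r r0 br]]; split.
  by move=> x; apply: continuousM; [exact: ca|exact: cb].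
by exists r => // x /br ->; rewrite mulr0.
Qed.

Lemma CcB a b : Cc a -> Cc b -> Cc (fun x => a x - b x).
Proof.
move=> [ca [r r0 ar]] [cb [s s0 bs]]; split.
  by move=> x; apply: continuousB; [exact: ca|exact: cb].
exists (r + s); first by lra.
by move=> x xrs; rewrite ar ?bs ?subrr //; lra.
Qed.

Lemma CcZ a (k : R) : Cc a -> Cc (fun x => k * a x).
Proof. by apply: CcM => x; exact: cst_continuous. Qed.

Lemma Cc_norm a : Cc a -> Cc (fun x => `|a x|).
Proof.
move=> [ca [r r0 ar]]; split.
  by move=> x; apply: continuous_comp; [exact: ca|exact: norm_continuous].
by exists r => // x /ar ->; rewrite normr0.
Qed.

Definition conv a b x : R := \int[leb]_y (a y * b (x - y)).

Lemma conv_integrable a b x : Cc a -> Cc b ->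
  leb.-integrable setT (EFin \o (fun y => a y * b (x - y))).
Proof. by move=> ca cb; apply/Cc_integrable/CcM; [exact: ca.1|exact: Cc_refl]. Qed.

Lemma convC a b : Cc a -> Cc b -> conv a b = conv b a.
Proof.
move=> ca cb; apply/funext => x; rewrite /conv /Rintegral; congr fine.
have mr := @measurable_rV_refl R n x.
pose F y := (b y * a (x - y))%:E.
have iF : leb.-integrable setT F by exact: conv_integrable.
rewrite -[RHS]/(\int[leb]_y F y)%E.
have -> : (\int[leb]_y F y = \int[pushforward leb (fun y => (x - y)%R)]_y F y)%E.
  apply: eq_measure_integral => A mA _; rewrite /pushforward.
  by rewrite -[LHS](lebesgue_rV_refl x mA).
rewrite [RHS]integral_pushforward //.
  by rewrite preimage_setT; apply: eq_integral => y _; rewrite /F /= subKr mulrC.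
  exact: measurable_int iF.
rewrite ?preimage_setT (_ : _ \o _ = EFin \o (fun y => a y * b (x - y))).
  exact: conv_integrable.
by apply/funext => y; rewrite /F /= subKr mulrC.
Qed.

Lemma conv_le a f g (e : R) : Cc a -> Cc f -> Cc g ->
  (forall y, `|f y - g y| <= e) ->
  `|\int[leb]_y (a y * f y) - \int[leb]_y (a y * g y)| <= e * \int[leb]_y `|a y|.
Proof.
move=> ca cf cg fg.
have caf : Cc (fun y => a y * f y) by apply: CcM => //; case: ca.
have cag : Cc (fun y => a y * g y) by apply: CcM => //; case: ca.
rewrite -RintegralB //; [|exact: Cc_integrable..].
apply: le_trans (le_normr_Rintegral _ _) _ => //.
  exact/Cc_integrable/CcB.
rewrite -RintegralZl //; last exact/Cc_integrable/Cc_norm.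
apply: le_Rintegral => //.
- exact/Cc_integrable/Cc_norm/CcB.
- exact/Cc_integrable/CcZ/Cc_norm.
- by move=> y _; rewrite -mulrBr normrM mulrC ler_wpM2r.
Qed.

Lemma conv_continuous a b : Cc a -> Cc b -> continuous (conv a b).
Proof.
move=> ca cb x; apply: (iffRL (@cvgrPdist_le _ _ _ (nbhs x) _ _ _)) => e e0.
set I := \int[leb]_y `|a y|.
have I0 : 0 <= I by exact: Rintegral_ge0.
have e'0 : 0 < e / (I + 1) by rewrite divr_gt0 // ltr_wpDl.
have [r r0 rP] := Cc_unif_cont cb e'0.
apply: filterS (near_dist_le x r0) => z xz.
apply: le_trans (conv_le (e := e / (I + 1)) ca _ _ _) _; [exact: Cc_refl|exact: Cc_refl| |].
  by move=> y; apply: rP; rewrite opprB addrA subrK.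
by rewrite -/I mulrAC ler_pdivrMr ?ltr_wpDl //; apply: ler_wpM2l; lra.
Qed.

Lemma conv_Cc a b : Cc a -> Cc b -> Cc (conv a b).
Proof.
move=> ca cb; split; first exact: conv_continuous.
have [_ [r r0 ar]] := ca; have [_ [s s0 bs]] := cb.
exists (r + s); first by lra.
move=> x xrs; rewrite /conv.
rewrite (_ : (fun y => a y * b (x - y)) = cst 0) ?Rintegral_cst ?mul0r //.
apply/funext => y /=; case: (leP r `|y|) => yr; first by rewrite ar ?mul0r.
by rewrite bs ?mulr0 //; have := lerB_dist x y; lra.
Qed.

(** The difference quotient of [b] is uniformly close to [db], and [conv_le] multiplies the error by
    the integral of [|a|]. Dividing by that integral plus 1 covers [a = 0]. *)
Lemma conv_derive a b db v : Cc a -> Cc b -> continuous db ->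
  (forall x, is_derive x v b (db x)) ->
  forall x, is_derive x v (conv a b) (conv a db x).
Proof.
move=> ca cb cdb bd x; have cdb' : Cc db := Cc_out cb cdb bd.
apply: is_derive_cvg; apply/cvgrPdist_le => e e0.
set I := \int[leb]_y `|a y|.
have I0 : 0 <= I by exact: Rintegral_ge0.
have e'0 : 0 < e / (I + 1) by rewrite divr_gt0 // ltr_wpDl.
have [r r0 rP] := derive_unif cb.1 (Cc_unif_cont cdb') bd e'0.
near=> h.
have h0 : h != 0 by near: h; exact: nbhs_dnbhs_neq.
have hr : `|h| < r.
  near: h; apply: dnbhs0_lt => //.
have -> : h^-1 *: (conv a b (h *: v + x) - conv a b x) =
    \int[leb]_y (a y * (h^-1 * (b (h *: v + (x - y)) - b (x - y)))).
  rewrite /conv -RintegralB //; [|exact: conv_integrable..].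
  rewrite /GRing.scale /= -RintegralZl //; last first.
    by apply/Cc_integrable/CcB; apply: CcM; rewrite ?ca.1 //; (try exact: ca.1); exact: Cc_refl.
  by apply: eq_Rintegral => y _; rewrite addrA; ring.
rewrite distrC; apply: le_trans (conv_le (e := e / (I + 1)) ca _ _ _) _.
- have c1 := Cc_refl (h *: v + x) cb; have c2 := Cc_refl x cb.
  have := CcZ h^-1 (CcB c1 c2).
  by under [X in Cc X -> _]funext => y do rewrite -addrA.
- exact: Cc_refl.
- by move=> y; exact: rP.
by rewrite -/I mulrAC ler_pdivrMr ?ltr_wpDl //; apply: ler_wpM2l; lra.
Unshelve. all: by end_near. Qed.

Lemma conv_approx phi f (r e : R) : Cc phi -> Cc f ->
  (forall y, 0 <= phi y) -> (forall y, r < `|y| -> phi y = 0) ->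
  \int[leb]_y phi y = 1 ->
  (forall x y, `|x - y| <= r -> `|f x - f y| <= e) ->
  forall x, `|conv phi f x - f x| <= e.
Proof.
move=> cp cf p0 pr p1 fe x.
have e0 : 0 <= e.
  apply: le_trans (fe x x _); first by rewrite subrr normr0.
  rewrite subrr normr0 leNgt; apply/negP => r0.
  have : \int[leb]_y phi y = 0.
    rewrite (_ : phi = cst 0) ?Rintegral_cst ?mul0r //.
    by apply/funext => y; apply: pr; apply: lt_le_trans r0 _.
  by rewrite p1 => /eqP; rewrite oner_eq0.
rewrite -[X in _ - X]mulr1 -p1 -RintegralZl //; last exact: Cc_integrable.
rewrite /conv -RintegralB //; [|exact: conv_integrable|exact/Cc_integrable/CcZ].
apply: le_trans (le_normr_Rintegral _ _) _ => //.
  apply/Cc_integrable/CcB; last exact: CcZ.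
  by apply: CcM; [exact: cp.1|exact: Cc_refl].
rewrite -[leRHS]mulr1 -p1 -RintegralZl //; last exact: Cc_integrable.
apply: le_Rintegral => //.
- apply/Cc_integrable/Cc_norm/CcB; last exact: CcZ.
  by apply: CcM; [exact: cp.1|exact: Cc_refl].
- exact/Cc_integrable/CcZ.
- move=> y _; rewrite [f x * _]mulrC -mulrBr normrM ger0_norm // mulrC.
  case: (ltP r `|y|) => yr; first by rewrite pr // !mulr0.
  by rewrite ler_wpM2r //; apply: fe; rewrite addrAC subrr sub0r normrN.
Qed.

End convolution.

Section chain.
Context {R : realType} {n : nat}.
Local Notation E := 'rV[R]_n.

Lemma is_derive_line0 (f : E -> R) x v l :
  is_derive x v f l <-> is_derive (0 : R) (1 : R) (fun t => f (t *: v + x)) l.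
Proof.
have E0 : (fun h : R => h^-1 *: (((fun t => f (t *: v + x)) \o shift 0) (h *: (1 : R)) - f (0 *: v + x))) =
  (fun h : R => h^-1 *: ((f \o shift x) (h *: v) - f x)).
  by apply/funext => h /=; rewrite scale0r add0r addr0 /GRing.scale /= mulr1.
by split=> -[d <-]; split; move: d; rewrite /derivable /derive E0.
Qed.

(** Restriction to the line through [x] in direction [v] reduces this to one variable, so
    derivability of [u] in the single direction [v] suffices. *)
Lemma is_derive_chain (phi : R -> R) (u : E -> R) x v (l m : R) :
  is_derive (u x) 1 phi l -> is_derive x v u m ->
  is_derive x v (fun y => phi (u y)) (l * m).
Proof.
move=> dphi /is_derive_line0 du; apply/is_derive_line0.
have {}dphi : is_derive (u (0 *: v + x)) 1 phi l by rewrite scale0r add0r.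
exact: (is_derive1_comp dphi du).
Qed.

End chain.

(** * Mollifiers built from exp(-1/t) *)

Section flat.
Context {R : realType}.

(* The derivatives of exp(-1/t) are combinations of t^-k exp(-1/t). *)
Definition flat (k : nat) (t : R) : R :=
  if 0 < t then t^-1 ^+ k * expR (- t^-1) else 0.

(** Raise [y/(k+1) <= exp(y/(k+1))] to the power k+1 at y = 1/t. For [k.+1] in place of [k] this
    bounds the difference quotient of [flat k] at 0, whence the derivative there is 0. *)
Lemma flat_le k (t : R) : 0 < t -> flat k t <= (k.+1%:R ^+ k.+1) * t.
Proof.
move=> t0; rewrite /flat t0 expRN ler_pdivrMr ?expR_gt0 //.
set y := t^-1; have y0 : 0 < y by rewrite invr_gt0.
have k0 : 0 < k.+1%:R :> R by [].
have : (y / k.+1%:R) ^+ k.+1 <= expR y.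
  have -> : expR y = expR (y / k.+1%:R) ^+ k.+1.
    by rewrite -expRM_natl mulrC divfK // gt_eqF.
  have y1 : 0 <= y / k.+1%:R by rewrite divr_ge0 // ltW.
  apply: lerXn2r; rewrite ?nnegrE ?expR_ge0 //.
  by apply: le_trans (expR_ge1Dx _); rewrite lerDr.
rewrite expr_div_n ler_pdivrMr ?exprn_gt0 // => h.
have : y ^+ k * y <= expR y * k.+1%:R ^+ k.+1 by rewrite -exprSr.
have e1 : y ^+ k = y ^+ k * y * t by rewrite -mulrA mulVf ?mulr1 // gt_eqF.
by move=> h'; rewrite [leLHS]e1 [leRHS]mulrAC; apply: ler_wpM2r; [exact: ltW|rewrite [leRHS]mulrC].
Qed.

Lemma flat_ge0 k (t : R) : 0 <= flat k t.
Proof.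
rewrite /flat; case: ifPn => // t0.
by rewrite mulr_ge0 ?expR_ge0 // exprn_ge0 // invr_ge0 ltW.
Qed.

Lemma is_derive_flat k (t : R) :
  is_derive t 1 (flat k) (flat k.+2 t - k%:R * flat k.+1 t).
Proof.
case: (ltgtP t 0) => t0.
- rewrite /flat ltNge (ltW t0) /= mulr0 subr0.
  apply: (near_eq_is_derive (f := cst 0)).
  near=> s; rewrite /flat ltNge (ltW (_ : s < 0)) //=.
  by near: s; exact: (@cvgr_lt R R (nbhs t) _ id t cvg_id).
- apply: (@near_eq_is_derive R R R (fun s : R => s^-1 ^+ k * expR (- s^-1)) (flat k) t 1).
    near=> s; rewrite /flat (_ : 0 < s) //.
    by near: s; exact: (@cvgr_gt R R (nbhs t) _ id t cvg_id).
  have t0' : t != 0 by rewrite gt_eqF.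
  have dV : is_derive t 1 (fun s : R => s^-1) (- t ^- 2) .
    by have := is_deriveV t0' (is_derive_id t 1); rewrite /GRing.scale /= mulr1.
  have dE := @is_derive1_comp R expR (fun s => - s^-1) t _ _ (is_derive_expR _) (is_deriveN dV).
  have := is_deriveX k dV; rewrite exprfctE => dX.
  apply: (is_derive_eq (is_deriveM dX dE)).
  rewrite /flat t0 /GRing.scale /= opprK.
  case: k dX => [|k] _; rewrite ?mulr0n ?mul0r ?expr0 /=; first by field.
  by rewrite -!exprVn !exprS; ring.
- apply: is_derive_cvg; rewrite t0 /flat ltxx mulr0 subr0.
  set C : R := k.+2%:R ^+ k.+2.
  have C0 : 0 <= C by rewrite exprn_ge0.
  apply/cvgrPdist_le => e e0; near=> h.
  have h0 : h != 0 by near: h; exact: nbhs_dnbhs_neq.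
  have hr : `|h| < e / (C + 1).
    by near: h; apply: dnbhs0_lt; rewrite divr_gt0 // ltr_wpDl.
  rewrite sub0r normrN subr0 addr0 /GRing.scale /= mulr1.
  have [hp|hn] := ltP 0 h; last by rewrite mulr0 normr0 ltW.
  have := @flat_le k.+1 h hp; rewrite /flat hp exprS => H.
  have hi : 0 <= h^-1 by rewrite invr_ge0 ltW.
  rewrite ger0_norm ?mulr_ge0 ?exprn_ge0 ?expR_ge0 // mulrA; apply: le_trans H _; rewrite -/C.
  move: hr; rewrite gtr0_norm // ltr_pdivlMr ?ltr_wpDl // => hr.
  by nra.
Unshelve. all: by end_near. Qed.

End flat.

Section mollify.
Context {R : realType} {n : nat}.
Local Notation E := 'rV[R]_n.
Local Notation leb := (@lebesgue_rV R n).
Local Notation e_ i := (delta_mx 0 i : E).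
Implicit Types (f u phi : E -> R).

(** A class closed under partial derivatives and made of continuous functions: membership yields
    smoothness of every order by one induction, and the class contains the mollifiers. *)
Inductive elementary : (E -> R) -> Prop :=
| elementary_cst c : elementary (fun=> c)
| elementary_flat k i a b : elementary (fun x => flat k (a + b * x 0 i))
| elementaryD f g : elementary f -> elementary g -> elementary (fun x => f x + g x)
| elementaryM f g : elementary f -> elementary g -> elementary (fun x => f x * g x).

Lemma is_derive_coord x v i : is_derive x v (fun y : E => y 0 i) (v 0 i).
Proof.
apply: is_derive_cvg; rewrite (_ : (fun h => _) = fun h => h^-1 * h * v 0 i).
  apply: cvg_near_cst; near=> h; rewrite mulVf ?mul1r //.
  by near: h; exact: nbhs_dnbhs_neq.
by apply/funext => h; rewrite !mxE addrK /GRing.scale /= mulrA.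
Unshelve. all: by end_near. Qed.

Lemma elementary_derive f i : elementary f ->
  exists2 g, elementary g & forall x, is_derive x (e_ i) f (g x).
Proof.
elim=> [c|k j a b|{}f g ef [df edf fd] eg [dg edg gd]|{}f g ef [df edf fd] eg [dg edg gd]].
- by exists (fun=> 0); [exact: elementary_cst|move=> x; exact: is_derive_cst].
- exists (fun x => (flat k.+2 (a + b * x 0 j) + (- k%:R) * flat k.+1 (a + b * x 0 j)) *
     (b * (e_ i) 0 j)).
    apply: elementaryM; last exact: elementary_cst.
    apply: elementaryD; first exact: elementary_flat.
    by apply: elementaryM; [exact: elementary_cst|exact: elementary_flat].
  move=> x; rewrite mulNr.
  apply: (is_derive_chain (phi := flat k) (u := fun x : E => a + b * x 0 j)).
    exact: is_derive_flat.
  apply: (is_derive_eq (is_deriveD (is_derive_cst a x (e_ i))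
    (is_deriveZ b (is_derive_coord x (e_ i) j)))).
  by rewrite add0r.
- exists (fun x => df x + dg x); first exact: elementaryD.
  by move=> x; exact: is_deriveD.
- exists (fun x => f x * dg x + g x * df x).
    by apply: elementaryD; exact: elementaryM.
  by move=> x; exact: is_deriveM.
Qed.

Lemma flat_continuous k : continuous (@flat R k).
Proof.
move=> x; apply/differentiable_continuous/derivable1_diffP.
by have [] := is_derive_flat k x.
Qed.

Lemma elementary_continuous f : elementary f -> continuous f.
Proof.
elim=> [c|k j a b|{}f g _ cf _ cg|{}f g _ cf _ cg] x.
- exact: cst_continuous.
- apply: (@continuous_comp _ _ _ (fun x : E => a + b * x 0 j) (flat k)); last exact: flat_continuous.
  apply: continuousD; first exact: cst_continuous.
  by apply: continuousM; [exact: cst_continuous|exact: coord_continuous].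
- by apply: continuousD; [exact: cf|exact: cg].
- by apply: continuousM; [exact: cf|exact: cg].
Qed.

Lemma elementary_iter_pd s f : elementary f -> elementary (iter_pd s f).
Proof.
move=> ef; elim: s => //= i s IH.
have [g eg gd] := elementary_derive i IH.
by rewrite (_ : pd i _ = g) //; apply/funext => x; have [] := gd x.
Qed.

Lemma elementary_is_derive s f i x : elementary f ->
  is_derive x (e_ i) (iter_pd s f) (iter_pd (i :: s) f x).
Proof.
move=> /(elementary_iter_pd s)/(elementary_derive i) [g eg gd].
by have [d _] := gd x; exact: derivableP.
Qed.

Lemma elementary_prod (I : Type) (s : seq I) (f : I -> E -> R) :
  (forall i, elementary (f i)) -> elementary (fun x => \prod_(i <- s) f i x).
Proof.
move=> ef; elim: s => [|i s IH].
  rewrite (_ : (fun x => _) = fun=> 1); first exact: elementary_cst.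
  by apply/funext => x; rewrite big_nil.
rewrite (_ : (fun x => _) = fun x => f i x * \prod_(j <- s) f j x).
  exact: elementaryM.
by apply/funext => x; rewrite big_cons.
Qed.

Lemma norm_coord_ge (x : E) (r : R) : 0 < r -> r <= `|x| -> exists i, r <= `|x 0 i|.
Proof.
move=> r0 rx; apply: contrapT => /forallNP h; move: rx; apply/negP; rewrite -ltNge.
rewrite [ltLHS]mx_normrE; apply/bigmax_ltP; split => // -[i j] _ /=.
by rewrite ord1 ltNge; apply/negP.
Qed.

Lemma Rintegral_Cc_gt0 f : Cc f -> (forall x, 0 <= f x) -> 0 < f 0 ->
  0 < \int[leb]_x f x.
Proof.
move=> cf f0 f00.
have /nbhs_ballP[r /= r0 rP] : \forall z \near (0 : E), f 0 / 2 < f z.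
  have /cvgrPdist_lt/(_ (f 0 / 2)) H := cf.1 0.
  have : 0 < f 0 / 2 by rewrite divr_gt0.
  move=> /H; apply: filterS => z; rewrite ltr_distlC => /andP[]; lra.
set B := [set x : E | `|x| <= r / 2].
have r2 : 0 <= r / 2 by rewrite divr_ge0 // ltW.
have mB : measurable B by exact: measurable_closed_ball.
have Bfin := lebesgue_rV_ball_fin (R := R) (n := n) (r / 2).
have B0 : 0 < fine (leb B).
  rewrite lebesgue_rV_ball // prodEFin /=; apply: prodr_gt0 => i _.
  by rewrite pmulrn_lgt0 // divr_gt0.
apply: (@lt_le_trans _ _ (\int[leb]_(x in B) (f 0 / 2))).
  by rewrite Rintegral_cst // mulr_gt0 // divr_gt0.
rewrite Rintegral_mkcond; apply: le_Rintegral => //.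
- rewrite -[EFin \o _](_ : (cst (f 0 / 2)%:E \_ B) = _).
    apply/(integrable_mkcond _ mB); apply: (@measurable_bounded_integrable _ _ _ leb (cst (f 0 / 2))) => //.
    exists (f 0 / 2); split; first exact: num_real.
    by move=> M /ltW fM x _ /=; rewrite ger0_norm // divr_ge0.
  by apply/funext => x; rewrite /patch /=; case: ifP.
- exact: Cc_integrable.
- move=> x _; rewrite /patch; case: ifPn => [/set_mem xB|_]; last exact: f0.
  apply/ltW/rP; rewrite -ball_normE /= sub0r normrN.
  by apply: (le_lt_trans xB); rewrite ltr_pdivrMr //; lra.
Qed.

Lemma exists_mollifier (r : R) : 0 < r -> exists phi,
  [/\ elementary phi, Cc phi, forall x, 0 <= phi x,
      forall x, r <= `|x| -> phi x = 0 & \int[leb]_x phi x = 1].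
Proof.
move=> r0.
(* Each factor vanishes once [|x 0 i| >= r], so the product is supported in the sup-norm ball of
   radius [r]. *)
pose phi0 (x : E) : R := \prod_(i < n) (flat 0 (r + 1 * x 0 i) * flat 0 (r + (-1) * x 0 i)).
have e0 : elementary phi0.
  by apply: elementary_prod => i; apply: elementaryM; exact: elementary_flat.
have p0 x : 0 <= phi0 x by apply: prodr_ge0 => i _; rewrite mulr_ge0 ?flat_ge0.
have ps x : r <= `|x| -> phi0 x = 0.
  move=> /(norm_coord_ge r0)[i]; rewrite ler_normr => /orP xi.
  rewrite /phi0 (bigD1 i) //= mul1r mulN1r /flat.
  by case: xi => xi; [rewrite [0 < r - _]ltNge (_ : r - _ <= 0) ?mulr0 ?mul0r //
                   |rewrite [0 < r + _]ltNge (_ : r + _ <= 0) ?mul0r //]; lra.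
have cp : Cc phi0 by split; [exact: elementary_continuous|exists r].
have I0 : 0 < \int[leb]_x phi0 x.
  apply: Rintegral_Cc_gt0 => //.
  apply: prodr_gt0 => i _; rewrite !mxE !mulr0 addr0 /flat r0 expr0 mul1r.
  by rewrite mulr_gt0 ?expR_gt0.
exists (fun x => (\int[leb]_x phi0 x)^-1 * phi0 x); split.
- by apply: elementaryM => //; exact: elementary_cst.
- exact: CcZ.
- by move=> x; rewrite mulr_ge0 // invr_ge0 ltW.
- by move=> x /ps ->; rewrite mulr0.
- by rewrite RintegralZl ?mulVf ?gt_eqF //; exact: Cc_integrable.
Qed.

Lemma elementary_conv_iter_pd phi f s : elementary phi -> Cc phi -> Cc f ->
  Cc (iter_pd s phi) /\ iter_pd s (conv f phi) = conv f (iter_pd s phi).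
Proof.
move=> ep cp cf; elim: s => [|i s [IH1 IH2]] //.
have ei : elementary (iter_pd (i :: s) phi) by exact: elementary_iter_pd.
have dd x := @elementary_is_derive s phi i x ep.
split; first by apply: (Cc_out IH1 _ dd); exact: elementary_continuous.
apply/funext => x; rewrite /= IH2 /pd.
by have [_ ->] := conv_derive cf IH1 (elementary_continuous ei) dd x.
Qed.

Lemma Ck_is_derive k f : Ck k setT f -> forall s i x, (size s < k)%N ->
  is_derive x (e_ i) (iter_pd s f) (iter_pd (i :: s) f x).
Proof. by move=> fk s i x sk; apply: derivableP; exact: (fk s (ltnW sk)).2. Qed.

Lemma Ck_conv_iter_pd k phi f s : Ck k setT f -> Cc phi -> Cc f -> (size s <= k)%N ->
  Cc (iter_pd s f) /\ iter_pd s (conv phi f) = conv phi (iter_pd s f).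
Proof.
move=> fk cp cf; elim: s => [|i s IH] //= sk.
have [IH1 IH2] := IH (ltnW sk).
have dd x := Ck_is_derive fk i x sk.
have cc : continuous (iter_pd (i :: s) f) by move=> x; exact: (fk (i :: s) sk).1.
split; first exact: (Cc_out IH1 cc dd).
apply/funext => x; rewrite IH2 /pd.
by have [_ ->] := conv_derive cp IH1 cc dd x.
Qed.

Lemma test_function_Cc f : (forall k, Ck k setT f) -> Cc f -> test_function setT f.
Proof.
move=> fk [_ [r r0 fr]]; split=> //.
apply: (subclosed_compact (@closed_closure _ _) (@closed_ball_compact R n r)).
rewrite [X in _ `<=` X](closure_id [set x : E | `|x| <= r]).1; last first.
  by apply: compact_closed; [exact: norm_hausdorff|exact: closed_ball_compact].
apply: closure_subset => x /= fx; rewrite leNgt; apply/negP => /ltW /fr fx0.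
by rewrite fx0 eqxx in fx.
Qed.

(** In a convolution with a mollifier, derivatives may fall on the mollifier, which gives
    smoothness, or on [f], which gives the approximation; commutativity of [conv] connects the
    two. *)
Lemma test_function_dense k f (r : R) : Ck k setT f -> 0 < r ->
  (forall x, r <= `|x| -> f x = 0) ->
  forall e, 0 < e -> exists2 u, test_function setT u &
    (forall x, r + 1 <= `|x| -> u x = 0) /\
    forall s, (size s <= k)%N -> forall x, `|iter_pd s u x - iter_pd s f x| <= e.
Proof.
move=> fk r0 fr e e0.
have cf : Cc f by split; [move=> x; exact: (fk [::] isT).1|exists r].
have cs s : (size s <= k)%N -> Cc (iter_pd s f).
  move=> sk; have [phi [_ cp _ _ _]] := exists_mollifier ltr01.
  by have [] := Ck_conv_iter_pd fk cp cf sk.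
(* One modulus serves all derivatives of order at most [k]: take minima over the finitely many index
   tuples, by induction on their length. *)
have [d d0 dP] : exists2 d : R, 0 < d & forall s, (size s <= k)%N ->
    forall x y, `|x - y| <= d -> `|iter_pd s f x - iter_pd s f y| <= e.
  have H m : exists2 d : R, 0 < d & forall s : seq 'I_n, (size s <= k)%N -> (size s <= m)%N ->
    forall x y, `|x - y| <= d -> `|iter_pd s f x - iter_pd s f y| <= e.
    elim: m => [|m [d d0 dP]].
      have [d d0 dP] := Cc_unif_cont cf e0; exists d => // -[|//] _ _; exact: dP.
    have H (t : m.+1.-tuple 'I_n) : exists d : R, 0 < d /\ ((size t <= k)%N ->
      forall x y, `|x - y| <= d -> `|iter_pd t f x - iter_pd t f y| <= e).
      case: (boolP (size t <= k)%N) => tk; last by exists 1.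
      by have [d' ? ?] := Cc_unif_cont (cs t tk) e0; exists d'.
    have [D DP] := choice H.
    exists (\big[Num.min/d]_t D t).
      by apply: lt_bigmin => // t _; have [] := DP t.
    move=> s sk; rewrite leq_eqVlt => /predU1P[sm|sm] x y xy.
      have [_ Dt] := DP (tcast (erefl _) (Tuple (introT eqP sm))).
      by apply: Dt => //; apply: le_trans xy _; exact: bigmin_le_cond.
    by apply: dP => //; apply: le_trans xy _; exact: bigmin_le_id.
  by have [d d0 dP] := H k; exists d => // s sk; exact: dP.
(* Radius at most [d] gives the error [e]; radius at most 1 keeps the support within [r + 1]. *)
have m0 : 0 < Num.min d 1 by rewrite lt_min d0 ltr01.
have [phi [ep cp p0 ps p1]] := exists_mollifier m0.
exists (conv f phi).
  apply: test_function_Cc; last exact: conv_Cc.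
  move=> j s _; have [c1 ->] := elementary_conv_iter_pd s ep cp cf.
  split=> [x _|_ x i _]; first exact: conv_continuous.
  have ei : elementary (iter_pd (i :: s) phi) by exact: elementary_iter_pd.
  have dd y := @elementary_is_derive s phi i y ep.
  by have [] := conv_derive cf c1 (elementary_continuous ei) dd x.
split.
  move=> x rx; rewrite /conv (_ : (fun y => _) = cst 0) ?Rintegral_cst ?mul0r //.
  apply/funext => y /=; case: (leP r `|y|) => yr; first by rewrite fr ?mul0r.
  rewrite ps ?mulr0 //; apply: (@le_trans _ _ 1); first by rewrite ge_min lexx orbT.
  by have := lerB_dist x y; lra.
move=> s sk x; rewrite convC //.
have [c1 ->] := Ck_conv_iter_pd fk cp cf sk.
apply: (conv_approx (r := Num.min d 1)) => //.
- by move=> y /ltW; exact: ps.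
- by move=> y z yz; apply: dP => //; apply: le_trans yz _; rewrite ge_min lexx.
Qed.

End mollify.

(** * Positive contractions of L^1 *)

Section L1.
Context {d : measure_display} {T : measurableType d} {R : realType}.
Variable mu : {measure set T -> \bar R}.
Implicit Types f g : T -> R.

Definition L1 f := mu.-integrable setT (EFin \o f).
Definition I1 f := \int[mu]_x f x.

Lemma L1_measurable f : L1 f -> measurable_fun setT f.
Proof. by move/measurable_int/measurable_EFinP. Qed.

Lemma L1_le f g : measurable_fun setT f -> L1 g -> (forall x, `|f x| <= g x) -> L1 f.
Proof.
move=> mf Lg fg; apply: (le_integrable measurableT _ _ Lg).
  exact/measurable_EFinP.
by move=> x _ /=; rewrite lee_fin (le_trans (fg x)) // ler_norm.
Qed.

Lemma L1D f g : L1 f -> L1 g -> L1 (fun x => f x + g x).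
Proof. by move=> Lf Lg; exact: (integrableD measurableT Lf Lg). Qed.

Lemma L1Z a f : L1 f -> L1 (fun x => a * f x).
Proof. by move=> Lf; exact: (integrableZl measurableT a Lf). Qed.

Lemma L1N f : L1 f -> L1 (fun x => - f x).
Proof. by move=> Lf; exact: (integrableN Lf). Qed.

Lemma L1B f g : L1 f -> L1 g -> L1 (fun x => f x - g x).
Proof. by move=> Lf /L1N; exact: L1D. Qed.

Lemma L1_norm f : L1 f -> L1 (fun x => `|f x|).
Proof. exact: integrable_norm. Qed.

Lemma L1_0 : L1 (fun=> 0).
Proof. exact: integrable0. Qed.

Lemma L1_max f g : L1 f -> L1 g -> L1 (fun x => Num.max (f x) (g x)).
Proof.
move=> Lf Lg; apply: (L1_le _ (L1D (L1_norm Lf) (L1_norm Lg))).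
  by apply: measurable_maxr; exact: L1_measurable.
move=> x /=; rewrite maxEle; case: ifP => _; first by rewrite lerDr.
by rewrite lerDl.
Qed.

Lemma L1_indic f (A : set T) : measurable A -> L1 f -> L1 (fun x => f x * \1_A x).
Proof.
move=> mA Lf; apply: (L1_le _ (L1_norm Lf)).
  by apply: measurable_funM; [exact: L1_measurable|exact: measurable_indic].
move=> x; rewrite normrM indicE; case: (x \in A); first by rewrite normr1 mulr1.
by rewrite normr0 mulr0.
Qed.

Lemma I1D f g : L1 f -> L1 g -> I1 (fun x => f x + g x) = I1 f + I1 g.
Proof. exact: RintegralD. Qed.

Lemma I1B f g : L1 f -> L1 g -> I1 (fun x => f x - g x) = I1 f - I1 g.
Proof. exact: RintegralB. Qed.

Lemma I1Z a f : L1 f -> I1 (fun x => a * f x) = a * I1 f.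
Proof. by move=> Lf; rewrite /I1 RintegralZl. Qed.

Lemma I1_ge0 f : (forall x, 0 <= f x) -> 0 <= I1 f.
Proof. by move=> f0; exact: Rintegral_ge0. Qed.

Lemma le_I1 f g : L1 f -> L1 g -> (forall x, f x <= g x) -> I1 f <= I1 g.
Proof. by move=> Lf Lg fg; apply: le_Rintegral. Qed.

Lemma ae_le_I1 f g : L1 f -> L1 g -> {ae mu, forall x, f x <= g x} -> I1 f <= I1 g.
Proof.
move=> Lf Lg fg; rewrite fine_le //; [exact: integrable_fin_num|exact: integrable_fin_num|].
rewrite -subre_ge0 -?integralB //; last exact: integrable_fin_num.
have Lgf := L1B Lg Lf.
have -> : (\int[mu]_x ((g x)%:E - (f x)%:E) = \int[mu]_x `|(g x - f x)%:E|)%E.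
  apply: ae_eq_integral => //.
  - exact: measurable_int Lgf.
  - by apply: measurableT_comp => //; exact: measurable_int Lgf.
  - by apply: filterS fg => x h _; rewrite gee0_abs ?lee_fin ?subr_ge0.
exact: integral_ge0.
Qed.

Lemma I1_eq0 f : L1 f -> (forall x, 0 <= f x) -> I1 f <= 0 -> {ae mu, forall x, f x = 0}.
Proof.
move=> Lf f0 If.
have : (\int[mu]_x `|(f x)%:E| = 0)%E.
  under eq_integral => x _ do rewrite gee0_abs ?lee_fin //.
  have If0 : I1 f = 0 by apply/eqP; rewrite eq_le If I1_ge0.
  by rewrite -[LHS]fineK ?integrable_fin_num //; exact: (congr1 EFin If0).
move/(ae_eq_integral_abs mu measurableT (measurable_int _ Lf)).
by apply: filterS => x /(_ I) [].
Qed.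

Lemma I1_bigcup f (A : nat -> set T) (C : R) : L1 f -> (forall x, 0 <= f x) ->
  (forall n, measurable (A n)) -> (forall n, A n `<=` A n.+1) ->
  (forall n, I1 (fun x => f x * \1_(A n) x) <= C) ->
  I1 (fun x => f x * \1_(\bigcup_n A n) x) <= C.
Proof.
move=> Lf f0 mA sA IA.
have mU : measurable (\bigcup_n A n) by exact: bigcup_measurable.
have LU := L1_indic mU Lf.
have ndA : {homo A : n m / (n <= m)%N >-> n `<=` m}.
  by apply: homo_leq => // [n|B D F BD DF]; [exact: subset_refl|exact: subset_trans BD DF].
rewrite -lee_fin /I1 /Rintegral fineK ?integrable_fin_num //.
pose g n x := (f x * \1_(A n) x)%:E.
have -> : (\int[mu]_x (f x * \1_(\bigcup_n A n) x)%:E =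
    \int[mu]_x (limn (g ^~ x)))%E.
  apply: eq_integral => x _; apply/esym/cvg_lim => //.
  have [[n _ An]|nA] := pselect ((\bigcup_n A n) x); last first.
    apply: cvg_near_cst; apply: nearW => n; rewrite /g !indicE !memNset //.
    by move=> Anx; apply: nA; exists n.
  apply: cvg_near_cst; near=> m.
  have Am : A m x by apply: ndA An; near: m; exact: nbhs_infty_ge.
  have Ux : (\bigcup_n A n) x by exists n.
  by rewrite /g !indicE (mem_set Am) (mem_set Ux).
rewrite monotone_convergence //.
- apply: lime_le.
    apply: ereal_nondecreasing_is_cvgn => m n mn; apply: ge0_le_integral => //.
    + by move=> x _; rewrite lee_fin mulr_ge0.
    + by have := measurable_int _ (L1_indic (mA m) Lf).
    + by have := measurable_int _ (L1_indic (mA n) Lf).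
    + move=> x _; rewrite lee_fin ler_wpM2l // !indicE.
      have [/set_mem Am|] := boolP (x \in A m); last by rewrite ler0n.
      by rewrite mem_set //; exact: (ndA _ _ mn).
  apply: nearW => n; rewrite -[leLHS]fineK ?integrable_fin_num //.
    by rewrite lee_fin; exact: IA.
  exact: L1_indic.
- by move=> n; have := measurable_int _ (L1_indic (mA n) Lf).
- by move=> n x _; rewrite lee_fin mulr_ge0.
- move=> x _ m n mn; rewrite lee_fin ler_wpM2l // !indicE.
  have [/set_mem Am|] := boolP (x \in A m); last by rewrite ler0n.
  by rewrite mem_set //; exact: (ndA _ _ mn).
Unshelve. all: by end_near. Qed.

End L1.

Section maximal_ergodic.
Context {d : measure_display} {T : measurableType d} {R : realType}.
Variable mu : {measure set T -> \bar R}.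
Variable Q : (T -> R) -> T -> R.
Hypothesis Q_L1 : forall f, L1 mu f -> L1 mu (Q f).
Hypothesis Q_linear : forall a f g x, L1 mu f -> L1 mu g ->
  Q (fun y => a * f y + g y) x = a * Q f x + Q g x.
Hypothesis Q_mono : forall f g, L1 mu f -> L1 mu g ->
  {ae mu, forall x, f x <= g x} -> forall x, Q f x <= Q g x.
Hypothesis Q_contract : forall f, L1 mu f -> (forall x, 0 <= f x) ->
  I1 mu (Q f) <= I1 mu f.
Implicit Types f g h v : T -> R.

(** The partial potential f + Q f + ... + Q^(n-1) f in Horner form. Starting at the empty sum 0
    makes the running maximum [pmax] nonnegative. *)
Fixpoint psum (n : nat) f : T -> R :=
  if n is m.+1 then fun x => f x + Q (psum m f) x else fun=> 0.

Fixpoint pmax (n : nat) f : T -> R :=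
  if n is m.+1 then fun x => Num.max (pmax m f x) (psum m.+1 f x) else fun=> 0.

Lemma psum_L1 n f : L1 mu f -> L1 mu (psum n f).
Proof. by move=> Lf; elim: n => [|n IH] /=; [exact: L1_0|apply: L1D => //; exact: Q_L1]. Qed.

Lemma pmax_L1 n f : L1 mu f -> L1 mu (pmax n f).
Proof.
move=> Lf; elim: n => [|n IH]; first exact: L1_0.
by apply: L1_max => //; exact: (psum_L1 n.+1).
Qed.

Lemma Q0 x : Q (fun=> 0) x = 0.
Proof.
have := @Q_linear 1 (fun=> 0) (fun=> 0) x (L1_0 mu) (L1_0 mu).
rewrite (_ : (fun y => _) = (fun=> 0)); last by apply/funext => y; rewrite mulr0 addr0.
by rewrite mul1r => /eqP; rewrite -subr_eq subrr => /eqP <-.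
Qed.

Lemma psum_linear n a f g x : L1 mu f -> L1 mu g ->
  psum n (fun y => a * f y + g y) x = a * psum n f x + psum n g x.
Proof.
move=> Lf Lg; elim: n x => [|n IH] x /=; first by rewrite mulr0 addr0.
rewrite (_ : psum n _ = fun y => a * psum n f y + psum n g y); last exact/funext.
by rewrite Q_linear; [lra|exact: psum_L1|exact: psum_L1].
Qed.

Lemma pmax_ge0 n f x : 0 <= pmax n f x.
Proof. by elim: n => //= n IH; rewrite le_max IH. Qed.

Lemma psum_le_pmax m n f x : (m <= n)%N -> psum m f x <= pmax n f x.
Proof.
elim: n => [|n IH]; first by rewrite leqn0 => /eqP ->.
rewrite leq_eqVlt => /predU1P[->|mn]; first by rewrite [leRHS]/= le_max lexx orbT.
by rewrite [leRHS]/= le_max IH.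
Qed.

Lemma pmax_mono m n f x : (m <= n)%N -> pmax m f x <= pmax n f x.
Proof.
elim: n => [|n IH]; first by rewrite leqn0 => /eqP ->.
rewrite leq_eqVlt => /predU1P[->//|mn].
by rewrite [leRHS]/= le_max IH.
Qed.

(** A positive maximum is attained at a nonempty sum [f + Q (psum m f)] with [m < n], and [psum m f]
    lies below the maximum. *)
Lemma pmax_gt0_le n f x : L1 mu f -> 0 < pmax n f x ->
  pmax n f x <= f x + Q (pmax n f) x.
Proof.
move=> Lf.
have H : 0 < pmax n f x -> exists2 m, (m < n)%N & pmax n f x = psum m.+1 f x.
  elim: n => [|n IH]; first by rewrite ltxx.
  rewrite [pmax _.+1 _ _]/= -[f x + _]/(psum n.+1 f x) maxEle.
  case: ifP => [_ _|_ /IH[m mn E]]; first by exists n.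
  by exists m => //; exact: leqW.
move=> /H[m mn ->] /=; rewrite lerD2l; apply: Q_mono; [exact: psum_L1|exact: pmax_L1|].
by apply: nearW => y; apply: psum_le_pmax; exact: ltnW.
Qed.

(* Garsia's argument: [h 1_E >= M - Q M] everywhere, for [M] the running
   maximum and [E] the set where it is positive. *)
Lemma maximal_ergodic n h : L1 mu h ->
  0 <= I1 mu (fun x => h x * \1_[set x | 0 < pmax n h x] x).
Proof.
move=> Lh; have LM := pmax_L1 n Lh; have LQM := Q_L1 LM.
have mE : measurable [set x | 0 < pmax n h x].
  rewrite -[X in measurable X]setTI (_ : mkset _ = pmax n h @^-1` `]0, +oo[).
    by apply: (L1_measurable LM) => //; exact: measurable_itv.
  by apply/seteqP; split => x /=; rewrite in_itv /= andbT.
apply: (@le_trans _ _ (I1 mu (fun x => pmax n h x - Q (pmax n h) x))).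
  by rewrite I1B // subr_ge0; apply: Q_contract => // x; exact: pmax_ge0.
apply: le_I1; [exact: L1B|exact: L1_indic|move=> x].
rewrite indicE; have [/set_mem|] := boolP (x \in _).
  by rewrite mulr1 => /(pmax_gt0_le Lh); lra.
move=> /negP; rewrite in_setE /= => /negP; rewrite -leNgt => M0.
rewrite mulr0 subr_le0; apply: (le_trans M0).
rewrite -(Q0 x); apply: Q_mono => //; first exact: L1_0.
by apply: nearW => y; exact: pmax_ge0.
Qed.

(** Apply the maximal inequality to [f - a v]. Where the potential of [f] is infinite and that of
    [v] is bounded, some partial sum of [f - a v] is positive for every [a]; hence [a] times the
    integral of [v] over that set is at most the integral of [f], and [a] tends to infinity. *)
Lemma bounded_potential_vanishes f v : L1 mu f -> L1 mu v ->
  (forall x, 0 <= f x) -> (forall x, 0 <= v x) ->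
  (forall n x, psum n v x <= 1) ->
  {ae mu, forall x, (forall C, exists n, C < psum n f x) -> v x = 0}.
Proof.
move=> Lf Lv f0 v0 v1.
pose h (a : nat) x := (- a%:R) * v x + f x.
have Lh a : L1 mu (h a) by apply: L1D => //; exact: L1Z.
pose E a n := [set x | 0 < pmax n (h a) x].
have mE a n : measurable (E a n).
  rewrite -[X in measurable X]setTI (_ : E a n = pmax n (h a) @^-1` `]0, +oo[).
    by apply: (L1_measurable (pmax_L1 n (Lh a))) => //; exact: measurable_itv.
  by apply/seteqP; split => x /=; rewrite in_itv /= andbT.
pose Z := \bigcap_a \bigcup_n E a n.
have mU a : measurable (\bigcup_n E a n) by exact: bigcup_measurable.
have mZ : measurable Z by exact: bigcap_measurable.
have LvZ := L1_indic mZ Lv.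
have I0 : 0 <= I1 mu f by exact: I1_ge0.
have bound a : a%:R * I1 mu (fun x => v x * \1_Z x) <= I1 mu f.
  have [->|a0] := posnP a; first by rewrite mul0r.
  have a0' : 0 < a%:R :> R by rewrite ltr0n.
  rewrite mulrC -ler_pdivlMr //.
  apply: (@le_trans _ _ (I1 mu (fun x => v x * \1_(\bigcup_n E a n) x))).
    apply: le_I1 => // [|x]; first exact: L1_indic.
    rewrite ler_wpM2l // !indicE; have [/set_mem Zx|] := boolP (x \in Z); last by rewrite ler0n.
    by rewrite mem_set //; exact: Zx.
  apply: I1_bigcup => // [n x|n]; first by move=> /lt_le_trans; apply; apply: pmax_mono.
  have := maximal_ergodic n (Lh a).
  have -> : (fun x => h a x * \1_(E a n) x) =
     (fun x => f x * \1_(E a n) x - a%:R * (v x * \1_(E a n) x)).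
    by apply/funext => x; rewrite /h; ring.
  have LvE := L1_indic (mE a n) Lv; have LfE := L1_indic (mE a n) Lf.
  rewrite I1B //; last exact: L1Z.
  rewrite I1Z // subr_ge0 ler_pdivlMr // mulrC => /le_trans; apply.
  apply: le_I1 => // x; rewrite indicE -[leRHS]mulr1 ler_wpM2l //.
  by case: (_ \in _).
have vZ0 : I1 mu (fun x => v x * \1_Z x) <= 0.
  rewrite leNgt; apply/negP => p0.
  have := bound (Num.bound (I1 mu f / I1 mu (fun x => v x * \1_Z x))); apply/negP; rewrite -ltNge.
  by rewrite -ltr_pdivrMr // archi_boundP // divr_ge0 // ltW.
have vZ x : 0 <= v x * \1_Z x by rewrite mulr_ge0.
have := I1_eq0 LvZ vZ vZ0; apply: filterS => x + Zx.
rewrite indicE mem_set ?mulr1 // => a _.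
(* A partial sum of [f] above [a] beats [a] times the corresponding sum of [v], which is at most
   [a]. *)
have [n hn] := Zx a%:R; exists n => //; rewrite /E /=.
apply: (@lt_le_trans _ _ (psum n (h a) x)); last exact: psum_le_pmax.
rewrite /h psum_linear // mulNr; have := v1 n x.
have : 0 <= a%:R :> R by []. nra.
Qed.

End maximal_ergodic.

(** * Lower bounds on the generator *)

Section negative_part.
Context {d : measure_display} {T : measurableType d} {R : realType}.
Variable mu : {measure set T -> \bar R}.
Implicit Types f g : T -> R.

(** The L^1 norm of the negative part. It is subadditive, not increased by positive contractions,
    and zero only for functions that are nonnegative a.e., so one-sided bounds pass through L^1
    limits. *)
Definition Nneg f := I1 mu (fun x => Num.max (- f x) 0).

Lemma L1_neg f : L1 mu f -> L1 mu (fun x => Num.max (- f x) 0).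
Proof. by move=> Lf; apply: L1_max; [exact: L1N|exact: L1_0]. Qed.

Lemma Nneg_mono f g : L1 mu f -> L1 mu g -> {ae mu, forall x, f x <= g x} -> Nneg g <= Nneg f.
Proof.
move=> Lf Lg fg; apply: ae_le_I1; [exact: L1_neg|exact: L1_neg|].
apply: filterS fg => x fg; rewrite ge_max !le_max lexx orbT andbT.
by rewrite lerN2 fg.
Qed.

Lemma NnegD f g : L1 mu f -> L1 mu g -> Nneg (fun x => f x + g x) <= Nneg f + Nneg g.
Proof.
move=> Lf Lg; rewrite /Nneg -I1D; [|exact: L1_neg..].
apply: le_I1 => [||x]; [exact/L1_neg/L1D|by apply: L1D; exact: L1_neg|].
rewrite ge_max; apply/andP; split; last by rewrite addr_ge0 // le_max lexx orbT.
by rewrite opprD lerD // le_max lexx.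
Qed.

Lemma NnegZ a f : 0 <= a -> L1 mu f -> Nneg (fun x => a * f x) = a * Nneg f.
Proof.
move=> a0 Lf; rewrite /Nneg -I1Z; last exact: L1_neg.
by congr (I1 mu _); apply/funext => x; rewrite maxr_pMr // mulr0 mulrN.
Qed.

Lemma Nneg_le f : L1 mu f -> Nneg f <= I1 mu (fun x => `|f x|).
Proof.
move=> Lf; apply: le_I1 => [||x]; [exact: L1_neg|exact: L1_norm|].
by rewrite ge_max normr_ge0 andbT -normrN ler_norm.
Qed.

Lemma Nneg_eq0 f : L1 mu f -> Nneg f <= 0 -> {ae mu, forall x, 0 <= f x}.
Proof.
move=> Lf /(I1_eq0 (L1_neg Lf)) H.
have : {ae mu, forall x, Num.max (- f x) 0 = 0} by apply: H => x; rewrite le_max lexx orbT.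
by apply: filterS => x /eqP; rewrite eq_maxr oppr_le0.
Qed.

Lemma I1_normD f g : L1 mu f -> L1 mu g ->
  I1 mu (fun x => `|f x + g x|) <= I1 mu (fun x => `|f x|) + I1 mu (fun x => `|g x|).
Proof.
move=> Lf Lg; rewrite -I1D; [|exact: L1_norm..].
apply: le_I1 => [||x]; [exact/L1_norm/L1D|by apply: L1D; exact: L1_norm|exact: ler_normD].
Qed.

End negative_part.

Section semigroup_inequality.
Context {d : measure_display} {T : measurableType d} {R : realType}.
Variable mu : {measure set T -> \bar R}.
Variable Q : R -> (T -> R) -> T -> R.
Hypothesis Q_L1 : forall t f, 0 < t -> L1 mu f -> L1 mu (Q t f).
Hypothesis Q_linear : forall t a f g x, 0 < t -> L1 mu f -> L1 mu g ->
  Q t (fun y => a * f y + g y) x = a * Q t f x + Q t g x.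
Hypothesis Q_mono : forall t f g, 0 < t -> L1 mu f -> L1 mu g ->
  {ae mu, forall x, f x <= g x} -> forall x, Q t f x <= Q t g x.
Hypothesis Q_contract : forall t f, 0 < t -> L1 mu f -> (forall x, 0 <= f x) ->
  I1 mu (Q t f) <= I1 mu f.
Hypothesis Q_add : forall s t f x, 0 < s -> 0 < t -> L1 mu f ->
  Q (s + t) f x = Q s (Q t f) x.
Implicit Types u v z k : T -> R.

Definition in_generator u v := [/\ L1 mu u, L1 mu v &
  I1 mu (fun x => `|t^-1 * (Q t u x - u x) - v x|) @[t --> 0^'+] --> (0 : R)].

(** Positivity puts the negative part of [Q t f] below [Q t] of the negative part of [f]; then
    contract. *)
Lemma Nneg_contract t f : 0 < t -> L1 mu f -> Nneg mu (Q t f) <= Nneg mu f.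
Proof.
move=> t0 Lf; have Ln := L1_neg Lf.
have L0 := L1_0 mu.
have Qz x : Q t (fun=> 0) x = 0 by exact: (Q0 (fun a f g y => @Q_linear t a f g y t0)).
apply: (@le_trans _ _ (I1 mu (Q t (fun x => Num.max (- f x) 0)))); last first.
  by apply: Q_contract => // x; rewrite le_max lexx orbT.
apply: le_I1; [exact/L1_neg/Q_L1|exact: Q_L1|move=> x].
rewrite ge_max; apply/andP; split.
  have -> : - Q t f x = Q t (fun y => -1 * f y + 0) x by rewrite Q_linear // Qz; lra.
  apply: Q_mono => //; first by apply: L1D => //; exact: L1Z.
  by apply: nearW => y; rewrite mulN1r addr0 le_max lexx.
apply: (@le_trans _ _ (Q t (fun=> 0) x)); first by rewrite Qz.
by apply: Q_mono => //; apply: nearW => y; rewrite le_max lexx orbT.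
Qed.

Lemma iter_Q m (h : R) f : 0 < h -> L1 mu f ->
  iter m.+1 (Q h) f = Q (m.+1%:R * h) f.
Proof.
move=> h0 Lf; elim: m => [|m IH]; first by rewrite mul1r.
rewrite iterS IH; apply/funext => x.
rewrite -Q_add ?mulr_gt0 ?ltr0n //; congr (Q _ f x).
by rewrite -[m.+2]addn1 natrD; lra.
Qed.

(* With [kap = (1 - L)^-1 z], telescope [D j = P_jh u - u + (1+h)^j kap - P_jh kap]
   over the time steps [h = 1/m]. *)
Lemma generator_lower_bound u v z k : in_generator u v ->
  L1 mu z -> (forall x, 0 <= z x) -> in_generator k (fun x => k x - z x) ->
  Nneg mu (fun x => Q 1 u x - u x + (expR 1 * `|k x| + `|Q 1 k x|)) <=
  Nneg mu (fun x => v x + z x).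
Proof.
move=> [Lu Lv uv] Lz z0 [Lk _ kz].
set e1 : R := expR 1.
have e10 : 0 < e1 by exact: expR_gt0.
apply/ler_addgt0Pr => e e0.
(* The two generator errors enter one step with weights 1 and [(1 + h)^j <= e1], so
   [c + e1 c = e]. *)
set c := e / (1 + e1); have c0 : 0 < c by rewrite divr_gt0 // addr_gt0.
have uv' : \forall t \near (0 : R)^'+, I1 mu (fun x => `|t^-1 * (Q t u x - u x) - v x|) <= c.
  by have /cvgrPdist_le/(_ c c0) := uv; apply: filterS => t; rewrite sub0r normrN; apply: le_trans; rewrite ler_norm.
have kz' : \forall t \near (0 : R)^'+, I1 mu (fun x => `|t^-1 * (Q t k x - k x) - (k x - z x)|) <= c.
  by have /cvgrPdist_le/(_ c c0) := kz; apply: filterS => t; rewrite sub0r normrN; apply: le_trans; rewrite ler_norm.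
have [dl /= dl0 dlP] : \forall t \near (0 : R)^'+,
    I1 mu (fun x => `|t^-1 * (Q t u x - u x) - v x|) <= c /\
    I1 mu (fun x => `|t^-1 * (Q t k x - k x) - (k x - z x)|) <= c.
  by apply: filterS2 uv' kz'.
have [m mdl] : exists m : nat, m.+1%:R^-1 < dl.
  exists (Num.bound dl^-1); rewrite invf_plt ?posrE // (lt_trans (archi_boundP _)) ?invr_ge0 ?ltW //.
  by rewrite ltr_nat.
set h : R := m.+1%:R^-1.
have h0 : 0 < h by rewrite invr_gt0.
have [] : I1 mu (fun x => `|h^-1 * (Q h u x - u x) - v x|) <= c /\
    I1 mu (fun x => `|h^-1 * (Q h k x - k x) - (k x - z x)|) <= c.
  by apply: dlP => //; rewrite /ball /= sub0r normrN gtr0_norm.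
set r := fun x => h^-1 * (Q h u x - u x) - v x.
set rk := fun x => h^-1 * (Q h k x - k x) - (k x - z x) => Ir Irk.
have Lr : L1 mu r by apply: L1B => //; apply: L1Z; apply: L1B => //; exact: Q_L1.
have Lrk : L1 mu rk.
  by apply: L1B; [apply: L1Z; apply: L1B => //; exact: Q_L1|exact: L1B].
have Lit j f : L1 mu f -> L1 mu (iter j (Q h) f).
  by move=> Lf; elim: j => //= j IH; exact: Q_L1.
pose D j x := iter j (Q h) u x - u x + ((1 + h) ^+ j * k x - iter j (Q h) k x).
have LD j : L1 mu (D j).
  by apply: L1D; apply: L1B => //; (try exact: Lit); exact: L1Z.
pose b j x := (Q h u x - u x) + (1 + h) ^+ j * ((1 + h) * k x - Q h k x).
have Lb j : L1 mu (b j).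
  by apply: L1D; [apply: L1B|apply: L1Z; apply: L1B]; (try exact: L1Z); (try exact: Q_L1).
have QB f g x : L1 mu f -> L1 mu g -> Q h (fun y => f y - g y) x = Q h f x - Q h g x.
  move=> Lf Lg; rewrite (_ : (fun y => f y - g y) = fun y => -1 * g y + f y).
    by rewrite Q_linear //; lra.
  by apply/funext => y; lra.
(* The factor [(1 + h)^j] is a discrete exponential: since [(1 + h) k - Q h k] is approximately
   [h z], each step adds about [h (v + (1 + h)^j z)]. *)
have DS j : D j.+1 = fun x => Q h (D j) x + b j x.
  apply/funext => x; rewrite {2}/D.
  pose w := (1 + h) ^+ j.
  have -> : (fun x => iter j (Q h) u x - u x + (w * k x - iter j (Q h) k x)) =
    (fun x => w * k x + ((iter j (Q h) u x - u x) - iter j (Q h) k x)).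
    by apply/funext => y; lra.
  have L1' : L1 mu (fun x => iter j (Q h) u x - u x) by apply: L1B => //; exact: Lit.
  rewrite Q_linear //; last by apply: L1B => //; exact: Lit.
  rewrite QB //; last exact: Lit.
  rewrite QB //; last exact: Lit.
  rewrite /D /b /= exprS -/w; lra.
have wle j : (j <= m)%N -> 1 <= (1 + h) ^+ j <= e1.
  move=> jm; have h1 : 1 <= 1 + h by rewrite lerDl ltW.
  rewrite exprn_ege1 //=; apply: (@le_trans _ _ (expR h ^+ j)).
    by apply: lerXn2r; rewrite ?nnegrE ?expR_ge0 ?expR_ge1Dx // addr_ge0 // ltW.
  rewrite -expRM_natl ler_expR /h ler_pdivrMr ?ltr0n // mul1r ler_nat; exact: leqW.
(* As [(1 + h)^j >= 1] and [z >= 0], the surplus [h ((1 + h)^j - 1) z] is nonnegative and may be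
   dropped. *)
have Nb j : (j <= m)%N -> Nneg mu (b j) <= h * (Nneg mu (fun x => v x + z x) + e).
  move=> /wle /andP[w1 w2]; set w := (1 + h) ^+ j in w1 w2.
  apply: (@le_trans _ _ (Nneg mu (fun x => h * ((v x + z x) + (r x - w * rk x))))).
    apply: Nneg_mono => //.
      by apply: L1Z; apply: L1D; [exact: L1D|apply: L1B => //; exact: L1Z].
    apply: nearW => x; rewrite /b -/w.
    have E1 : Q h u x - u x = h * (v x + r x) by rewrite /r [v x + _]addrC subrK mulVKf // gt_eqF.
    have E2 : (1 + h) * k x - Q h k x = h * (z x - rk x).
      have : h * rk x = (Q h k x - k x) - h * (k x - z x).
        by rewrite /rk mulrBr mulVKf // gt_eqF.
      by lra.
    rewrite E1 E2; have := z0 x.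
    have -> : h * (v x + r x) + w * (h * (z x - rk x)) =
      h * (v x + z x + (r x - w * rk x)) + h * ((w - 1) * z x) by ring.
    move=> zx; rewrite lerDl mulr_ge0 ?mulr_ge0 ?subr_ge0 //; exact: ltW.
  have LL : L1 mu (fun x => r x - w * rk x) by apply: L1B => //; exact: L1Z.
  rewrite NnegZ ?(ltW h0) //; last by apply: L1D => //; exact: L1D.
  rewrite ler_wpM2l ?(ltW h0) //.
  apply: le_trans (NnegD (L1D Lv Lz) LL) _; rewrite lerD2l.
  apply: le_trans (Nneg_le LL) _.
  apply: (@le_trans _ _ (c + w * c)).
    apply: le_trans (I1_normD Lr (L1N (L1Z w Lrk))) _; apply: lerD => //.
    have -> : (fun x => `|- (w * rk x)|) = (fun x => w * `|rk x|).
      by apply/funext => x; rewrite normrN normrM ger0_norm //; lra.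
    by rewrite I1Z ?ler_wpM2l //; [lra|exact: L1_norm].
  have -> : e = c + e1 * c by rewrite /c; field; rewrite gt_eqF // addr_gt0.
  by rewrite lerD2l ler_wpM2r // ltW.
have ND j : (j <= m.+1)%N -> Nneg mu (D j) <= j%:R * (h * (Nneg mu (fun x => v x + z x) + e)).
  elim: j => [_|j IH jm].
    rewrite mul0r (_ : D 0%N = fun=> 0); last by apply/funext => x; rewrite /D expr0 /=; lra.
    by rewrite /Nneg oppr0 maxxx /I1 Rintegral_cst // mul0r.
  rewrite DS; apply: le_trans (NnegD (Q_L1 h0 (LD j)) (Lb j)) _.
  rewrite -natr1 mulrDl mul1r; apply: lerD; last exact: Nb.
  exact: le_trans (Nneg_contract h0 (LD j)) (IH (ltnW jm)).
have := ND m.+1 (leqnn _); rewrite mulVKf ?gt_eqF // => {}ND.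
have hm : m.+1%:R * h = 1 by rewrite /h mulfV.
apply: le_trans ND; apply: Nneg_mono => //.
  apply: L1D; first by apply: L1B => //; exact: Q_L1.
  by apply: L1D; [apply: L1Z|]; apply: L1_norm => //; exact: Q_L1.
apply: nearW => x; rewrite /D !iter_Q // hm lerD2l lerD //; last first.
  by rewrite -normrN ler_norm.
have w0 : 0 <= (1 + h) ^+ m.+1 by rewrite exprn_ge0 // addr_ge0 // ltW.
apply: (@le_trans _ _ ((1 + h) ^+ m.+1 * `|k x|)); first by rewrite ler_wpM2l // ler_norm.
rewrite ler_wpM2r // (@le_trans _ _ (expR h ^+ m.+1)) //.
  by apply: lerXn2r; rewrite ?nnegrE ?expR_ge0 ?expR_ge1Dx // addr_ge0 // ltW.
by rewrite -expRM_natl hm.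
Qed.

End semigroup_inequality.

(** * The measure [rho dx]: local integrability and full support *)

Section density.
Context {R : realType} {n : nat}.
Local Notation E := 'rV[R]_n.
Local Notation leb := (@lebesgue_rV R n).
Variables (rho : E -> R) (mu : {measure set E -> \bar R}).
Hypothesis rho_cont : continuous rho.
Hypothesis rho_gt0 : forall x, 0 < rho x.
Hypothesis rho_dens : is_density rho mu.

Definition cball (r : R) : set E := [set x | `|x| <= r].

Lemma measurable_cball r : measurable (cball r).
Proof. exact: measurable_closed_ball. Qed.

Let mrho : measurable_fun setT (EFin \o rho).
Proof. by apply/measurable_EFinP; exact: continuous_measurable_rV. Qed.

Lemma ae_density (P : E -> Prop) : {ae leb, forall x, P x} -> {ae mu, forall x, P x}.
Proof.
move=> [A [mA A0 sA]]; exists A; split => //.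
rewrite rho_dens //.
under eq_integral => x _ do rewrite -(@gee0_abs _ (rho x)%:E) ?lee_fin ?ltW //.
by apply: integral_abs_eq0 => //; exact: measurable_funTS.
Qed.

Lemma density_bounded r : exists2 M : R, 0 <= M & forall A, measurable A -> A `<=` cball r ->
  (mu A <= M%:E * leb A)%E.
Proof.
have [r0|r0] := leP 0 r; last first.
  exists 0 => // A mA sA; rewrite (_ : A = set0) ?measure0 ?mule0 //.
  by apply/seteqP; split => x // /sA; rewrite /cball /= => h; have := normr_ge0 x; lra.
have [|c _ cP] := EVT_max_rV _ (@closed_ball_compact R n r) (continuous_subspaceT rho_cont).
  by exists 0; rewrite /= normr0.
exists (rho c); first exact: ltW.
move=> A mA sA; rewrite rho_dens // -integral_cst //.
apply: ge0_le_integral => //.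
- by move=> x _; rewrite lee_fin ltW.
- exact: measurable_funTS.
- by move=> x Ax; rewrite lee_fin; apply: cP; apply: mem_set; exact: sA.
Qed.

(** On the ball [rho] is bounded by some [M], so [mu] restricted to it is dominated by [M] times
    Lebesgue measure. *)
Lemma density_integrable r (f : E -> R) : leb.-integrable setT (fun x => (f x * \1_(cball r) x)%:E) ->
  L1 mu (fun x => f x * \1_(cball r) x).
Proof.
move=> /integrableP[mf fi]; apply/integrableP; split => //.
have [M M0 MP] := density_bounded r.
have mB := measurable_cball r.
have E1 (m : {measure set E -> \bar R}) : (\int[m]_x `|(f x * \1_(cball r) x)%:E| =
    \int[m]_(x in cball r) `|(f x * \1_(cball r) x)%:E|)%E.
  rewrite [RHS]integral_mkcond; apply: eq_integral => x _; rewrite /patch.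
  by case: ifPn => // xB; rewrite indicE (negbTE xB) mulr0 abse0.
have {}fi : (\int[leb]_x `|(f x * \1_(cball r) x)%:E| < +oo)%E by exact: fi.
rewrite E1 in fi; rewrite -[X in (X < _)%E]/(\int[mu]_x `|(f x * \1_(cball r) x)%:E|)%E E1.
have -> : (\int[mu]_(x in cball r) `|(f x * \1_(cball r) x)%:E| =
  \int[mrestr mu mB]_(x in cball r) `|(f x * \1_(cball r) x)%:E|)%E.
  by apply: eq_measure_integral => A mA AB; rewrite /= /mrestr setIidl.
have mf' : measurable_fun setT (fun x => `|(f x * \1_(cball r) x)%:E|)%E.
  exact: measurableT_comp.
apply: le_lt_trans (ge0_le_measure_integral (m2 := mscale (NngNum M0) leb) _ mB _ mf') _.
- move=> S mS; rewrite /mrestr /mscale /=.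
  apply: le_trans (MP _ _ _) _; [exact: measurableI|by move=> x []|].
  rewrite lee_wpmul2l ?lee_fin // le_measure ?inE //; exact: measurableI.
- by [].
rewrite ge0_integral_mscale //; last exact: measurable_funTS.
by rewrite lte_mul_pinfty // lee_fin.
Qed.

Lemma lebesgue_rV_ball_center x (r : R) : leb [set y | `|x - y| <= r] = leb (cball r).
Proof. by rewrite -(lebesgue_rV_refl x (measurable_cball r)). Qed.

Lemma density_open (U : set E) : open U -> U !=set0 -> (0 < mu U)%E.
Proof.
move=> oU [x Ux].
have /nbhs_ballP[r /= r0 rU] : nbhs x U by exact: open_nbhs_nbhs.
have /nbhs_ballP[s /= s0 sP] : \forall z \near x, rho x / 2 < rho z.
  have p0 : 0 < rho x / 2 by rewrite divr_gt0.
  have /cvgrPdist_lt/(_ _ p0) := rho_cont (x := x).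
  by apply: filterS => z; rewrite ltr_distlC => /andP[]; lra.
pose t := Num.min r s / 2.
have m0 : 0 < Num.min r s by rewrite lt_min r0.
have t0 : 0 < t by rewrite divr_gt0.
pose B := [set y | `|x - y| <= t].
have mB : measurable B.
  rewrite (_ : B = (fun y => x - y) @^-1` cball t) //.
  by rewrite -[X in measurable X]setTI; apply: measurable_rV_refl => //; exact: measurable_cball.
have Bsub y : B y -> ball x r y /\ ball x s y.
  rewrite /B /= -!ball_normE /= => h; have : t < Num.min r s by rewrite /t; lra.
  by rewrite lt_min => /andP[h1 h2]; split; apply: le_lt_trans h _.
have mU : measurable U by exact: sub_sigma_algebra.
apply: (@lt_le_trans _ _ (mu B)); last first.
  by apply: le_measure; rewrite ?inE // => y /Bsub[yr _]; exact: rU.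
have LB : (0 < leb B)%E.
  rewrite [leb B](lebesgue_rV_ball_center x t) /cball lebesgue_rV_ball ?ltW // prodEFin lte_fin.
  by apply: prodr_gt0 => i _; rewrite pmulrn_lgt0.
rewrite rho_dens //; apply: (@lt_le_trans _ _ (\int[leb]_(y in B) (rho x / 2)%:E)%E).
  by rewrite integral_cst // mule_gt0 ?lte_fin ?divr_gt0.
apply: ge0_le_integral => //.
- by move=> y _; rewrite lee_fin divr_ge0 // ltW.
- exact: measurable_funTS.
- by move=> y /Bsub[_ /sP /ltW]; rewrite lee_fin.
Qed.

Lemma ae_dense (P : E -> Prop) : {ae mu, forall x, P x} ->
  forall U, open U -> U !=set0 -> exists2 x, U x & P x.
Proof.
move=> [A [mA A0 sA]] U oU U0; apply: contrapT => H.
have UA : U `<=` A by move=> x Ux; apply: sA => /= Px; apply: H; exists x.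
have := density_open oU U0; rewrite lt0e => /andP[/eqP + _]; apply.
apply/eqP; rewrite -measure_le0 -A0; apply: le_measure; rewrite ?inE //.
exact: sub_sigma_algebra.
Qed.

(** The set where [g < f] is open; were it nonempty, full support of [mu] would produce in it a
    point with [f <= g]. *)
Lemma ae_continuous_le (f g : E -> R) : continuous f -> continuous g ->
  {ae mu, forall x, f x <= g x} -> forall x, f x <= g x.
Proof.
move=> cf cg fg x; rewrite leNgt; apply/negP => gf.
have oU : open [set y | g y < f y].
  rewrite (_ : [set _ | _] = (fun y => f y - g y) @^-1` [set t | 0 < t]).
    apply: open_comp => [y _|]; last exact: open_gt.
    by apply: continuousB; [exact: cf|exact: cg].
  by apply/seteqP; split => y /=; rewrite subr_gt0.
have [y /= yU] := ae_dense fg oU (ex_intro _ x gf).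
by rewrite leNgt yU.
Qed.

End density.

(** * Continuous versions of the L^1-semigroup *)

Section L1_semigroup.
Context {R : realType} {n : nat}.
Local Notation E := 'rV[R]_n.
Variables (mu : {measure set E -> \bar R}) (T Pt : R -> (E -> R) -> E -> R).
Hypothesis ae_le : forall f g : E -> R, continuous f -> continuous g ->
  {ae mu, forall x, f x <= g x} -> forall x, f x <= g x.
Hypothesis sg : subMarkov_C0_contraction_semigroup mu T.
Hypothesis cv : continuous_version mu T Pt.
Implicit Types f g u v : E -> R.

Lemma Lfun1P f : f \in Lfun mu 1 <-> L1 mu f.
Proof. exact: Lfun1_integrable. Qed.

Lemma Lnorm_I1 f : L1 mu f -> Lnorm mu 1 (fun x => (f x)%:E) = (I1 mu (fun x => `|f x|))%:E.
Proof. by move=> Lf; rewrite Lnorm1 /I1 /Rintegral fineK //; exact: integrable_fin_num (L1_norm Lf). Qed.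

Lemma Lp_cvg_I1 (un : nat -> E -> R) u : (forall k, L1 mu (un k)) -> L1 mu u ->
  Lp_cvg mu 1 un u -> I1 mu (fun x => `|un k x - u x|) @[k --> \oo] --> 0.
Proof.
move=> Lun Lu; rewrite /Lp_cvg.
rewrite (_ : (fun k => _) = fun k => (I1 mu (fun x => `|un k x - u x|))%:E).
  by move/fine_cvg.
by apply/funext => k; rewrite Lnorm_I1 //; exact: L1B.
Qed.

Lemma T_L1 t f : 0 < t -> L1 mu f -> L1 mu (T t f).
Proof. by move=> t0 /Lfun1P Lf; apply/Lfun1P; exact: sg_L1. Qed.

Lemma T_lin t a f g : 0 < t -> L1 mu f -> L1 mu g ->
  {ae mu, forall x, T t (fun y => a * f y + g y) x = a * T t f x + T t g x}.
Proof. by move=> t0 /Lfun1P Lf /Lfun1P Lg; exact: sg_linear. Qed.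

Lemma T_contract t f : 0 < t -> L1 mu f ->
  I1 mu (fun x => `|T t f x|) <= I1 mu (fun x => `|f x|).
Proof.
move=> t0 Lf; rewrite -lee_fin -!Lnorm_I1 //; last exact: T_L1.
by apply: sg_contraction => //; exact/Lfun1P.
Qed.

Lemma I1_ae_eq f g : L1 mu f -> L1 mu g -> {ae mu, forall x, f x = g x} -> I1 mu f = I1 mu g.
Proof.
move=> Lf Lg fg; apply/eqP; rewrite eq_le; apply/andP; split; apply: ae_le_I1 => //;
  apply: filterS fg => x ->; exact: lexx.
Qed.

Lemma T_dist t f g : 0 < t -> L1 mu f -> L1 mu g ->
  I1 mu (fun x => `|T t f x - T t g x|) <= I1 mu (fun x => `|f x - g x|).
Proof.
move=> t0 Lf Lg.
have Lfg : L1 mu (fun x => -1 * g x + f x) by apply: L1D => //; exact: L1Z.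
have -> : (fun x => `|f x - g x|) = (fun x => `|-1 * g x + f x|).
  by apply/funext => x; rewrite mulN1r addrC.
apply: le_trans (T_contract t0 Lfg).
apply: ae_le_I1; [by apply/L1_norm/L1B; exact: T_L1|exact/L1_norm/T_L1|].
by apply: filterS (T_lin (-1) t0 Lg Lf) => x ->; rewrite mulN1r addrC.
Qed.

Lemma T_0 t : 0 < t -> {ae mu, forall x, T t (fun=> 0) x = 0}.
Proof.
move=> t0; have := T_lin 1 t0 (L1_0 mu) (L1_0 mu).
apply: filterS => x; rewrite (_ : (fun=> _) = fun=> 0); last first.
  by apply/funext => y; rewrite mulr0 addr0.
by rewrite mul1r => /eqP; rewrite -subr_eq subrr => /eqP <-.
Qed.

Lemma truncation_cvg f : L1 mu f -> (forall x, 0 <= f x) ->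
  I1 mu (fun x => `|f x - Num.min (f x) k.+1%:R|) @[k --> \oo] --> 0.
Proof.
move=> Lf f0.
pose F k x := (`|f x - Num.min (f x) k.+1%:R|)%:E : \bar R.
have mF k : measurable_fun setT (F k).
  apply/measurable_EFinP; apply: measurableT_comp => //.
  apply: measurable_funB; first exact: L1_measurable Lf.
  by apply: measurable_minr => //; exact: L1_measurable Lf.
have Ff x : F ^~ x @ \oo --> (0 : \bar R)%E.
  apply: cvg_near_cst; near=> k; rewrite /F min_l ?subrr ?normr0 //.
  apply: ltW; apply: lt_le_trans (archi_boundP (f0 x)) _.
  by rewrite ler_nat leqW //; near: k; exact: nbhs_infty_ge.
have bF k x : (`|F k x| <= (f x)%:E)%E.
  rewrite /F /= normr_id lee_fin ger0_norm.
    by rewrite gerBl // le_min f0 /=.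
  by rewrite subr_ge0 ge_min lexx.
have := @dominated_cvg _ _ _ mu _ measurableT F (cst 0%E) (EFin \o f) mF (fun x _ => Ff x)
  (fun x _ => isT) Lf (fun k x _ => bF k x).
by rewrite integral0 => /fine_cvg.
Unshelve. all: by end_near. Qed.

(** The sub-Markov property concerns functions with values in [0, 1]. Truncations of [f] at [k.+1]
    reduce to it by scaling, and they converge to [f] in L^1, where [T t] is a contraction. *)
Lemma T_ge0 t f : 0 < t -> L1 mu f -> (forall x, 0 <= f x) -> {ae mu, forall x, 0 <= T t f x}.
Proof.
move=> t0 Lf f0; apply: Nneg_eq0; first exact: T_L1.
pose fk k x := Num.min (f x) k.+1%:R.
have Lfk k : L1 mu (fk k).
  apply: (L1_le _ Lf).
    by apply: measurable_minr => //; exact: L1_measurable Lf.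
  by move=> x; rewrite ger0_norm ?le_min ?f0 //= /fk ge_min lexx.
have Tfk k : {ae mu, forall x, 0 <= T t (fk k) x}.
  have k0 : 0 < k.+1%:R :> R by [].
  pose w x := k.+1%:R^-1 * fk k x.
  have Lw : L1 mu w by exact: L1Z.
  have -> : fk k = fun x => k.+1%:R * w x + 0.
    by apply/funext => x; rewrite addr0 mulVKf // gt_eqF.
  have w01 : {ae mu, forall x, 0 <= w x <= 1}.
    apply: nearW => x; rewrite mulr_ge0 ?invr_ge0 ?le_min ?f0 //=.
    by rewrite /w mulrC ler_pdivrMr // mul1r ge_min lexx orbT.
  have Tw := sg_subMarkov sg t0 ((Lfun1P w).2 Lw) w01.
  apply: filterS3 (T_lin k.+1%:R t0 Lw (L1_0 mu)) Tw (T_0 t0) => x -> /andP[w0 _] ->.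
  by rewrite addr0 mulr_ge0.
have bd k : Nneg mu (T t f) <= I1 mu (fun x => `|f x - fk k x|).
  apply: le_trans (T_dist t0 Lf (Lfk k)).
  apply: ae_le_I1; [exact/L1_neg/T_L1|by apply/L1_norm/L1B; exact: T_L1|].
  apply: filterS (Tfk k) => x h; rewrite ge_max normr_ge0 andbT.
  by rewrite -normrN ler_normr; apply/orP; left; lra.
have := truncation_cvg Lf f0 => H.
apply: (@cvgr_to_ge _ _ _ _ _ _ _ H); exact: nearW.
Qed.

Lemma Pt_continuous t f : 0 < t -> L1 mu f -> continuous (Pt t f).
Proof. by move=> t0 /Lfun1P Lf; exact: (cv.2 1%E t f (lexx _) t0 Lf).1. Qed.

Lemma Pt_L1 t f : 0 < t -> L1 mu f -> L1 mu (Pt t f).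
Proof. by move=> t0 /Lfun1P Lf; apply/Lfun1P; exact: (cv.2 1%E t f (lexx _) t0 Lf).2.1. Qed.

(** [Pt t f] is given as an L^1 limit of [T t] along some sequence tending to [f]; by contraction
    the same sequence tends to [T t f]. *)
Lemma Pt_ae t f : 0 < t -> L1 mu f -> {ae mu, forall x, Pt t f x = T t f x}.
Proof.
move=> t0 Lf; have LP := Pt_L1 t0 Lf; have LT := T_L1 t0 Lf.
have [_ [_]] := cv.2 1%E t f (lexx _) t0 ((Lfun1P f).2 Lf).
rewrite /= => -[fk fkP [fkf Tfk]].
have Lfk k : L1 mu (fk k) by apply/Lfun1P; exact: (fkP k).1.
have c1 := Lp_cvg_I1 Lfk Lf fkf.
have c2 := Lp_cvg_I1 (fun k => T_L1 t0 (Lfk k)) LP Tfk.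
have : {ae mu, forall x, `|Pt t f x - T t f x| = 0}.
  apply: I1_eq0 => //; first exact/L1_norm/L1B.
  have c12 : I1 mu (fun x => `|fk k x - f x|) + I1 mu (fun x => `|T t (fk k) x - Pt t f x|)
      @[k --> \oo] --> (0 + 0 : R) by exact: cvgD.
  rewrite addr0 in c12.
  apply: (@cvgr_to_ge _ _ _ _ _ _ _ c12); apply: nearW => k /=.
  have := T_dist t0 (Lfk k) Lf; rewrite -(lerD2r (I1 mu (fun x => `|T t (fk k) x - Pt t f x|))).
  move=> h; apply: le_trans h.
  have LTk := T_L1 t0 (Lfk k).
  rewrite -I1D; [|exact/L1_norm/L1B|exact/L1_norm/L1B].
  apply: le_I1; [exact/L1_norm/L1B|by apply: L1D; exact/L1_norm/L1B|].
  move=> x; have := ler_distD (T t (fk k) x) (Pt t f x) (T t f x).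
  by rewrite [`|Pt t f x - T t (fk k) x|]distrC; lra.
by apply: filterS => x /eqP; rewrite normr_eq0 subr_eq0 => /eqP.
Qed.

Lemma ae_eq_continuous f g : continuous f -> continuous g ->
  {ae mu, forall x, f x = g x} -> forall x, f x = g x.
Proof.
move=> cf cg fg x; apply/eqP; rewrite eq_le; apply/andP; split;
  apply: ae_le => //; apply: filterS fg => y ->; exact: lexx.
Qed.

(** The identity holds a.e. for [T], and both sides are continuous for [Pt]. The same passage gives
    [Pt_mono] and [Pt_add] at every point. *)
Lemma Pt_linear t a f g x : 0 < t -> L1 mu f -> L1 mu g ->
  Pt t (fun y => a * f y + g y) x = a * Pt t f x + Pt t g x.
Proof.
move=> t0 Lf Lg; have Lfg : L1 mu (fun y => a * f y + g y) by apply: L1D => //; exact: L1Z.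
apply: (ae_eq_continuous (f := Pt t _) (g := fun x => a * Pt t f x + Pt t g x)).
- exact: Pt_continuous.
- have c1 : continuous (fun x => a * Pt t f x).
    by move=> y; apply: continuousM; [exact: cst_continuous|exact: Pt_continuous].
  by move=> y; apply: (continuousD (c1 y)); exact: Pt_continuous.
- have H' := T_lin a t0 Lf Lg.
  have H : {ae mu, forall y, Pt t (fun y => a * f y + g y) y = T t (fun y => a * f y + g y) y /\
    a * Pt t f y + Pt t g y = a * T t f y + T t g y}.
    by apply: filterS3 (Pt_ae t0 Lfg) (Pt_ae t0 Lf) (Pt_ae t0 Lg) => y -> -> ->.
  by apply: filterS2 H H' => y [-> ->] ->.
Qed.

Lemma Pt_mono t f g : 0 < t -> L1 mu f -> L1 mu g ->
  {ae mu, forall x, f x <= g x} -> forall x, Pt t f x <= Pt t g x.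
Proof.
move=> t0 Lf Lg fg; apply: ae_le; [exact: Pt_continuous|exact: Pt_continuous|].
(* Order becomes positivity through [g = w + f] a.e. with [w >= 0] everywhere; [sg_ae] allows the
   a.e. replacement. *)
pose w x := Num.max (g x - f x) 0.
have Lw : L1 mu w by apply: L1_max; [exact: L1B|exact: L1_0].
have Lgf : L1 mu (fun x => 1 * w x + f x) by apply: L1D => //; exact: L1Z.
have e : {ae mu, forall x, g x = 1 * w x + f x}.
  by apply: filterS fg => x h; rewrite /w max_l ?subr_ge0 // mul1r subrK.
have Tg := sg_ae sg t0 ((Lfun1P _).2 Lg) ((Lfun1P _).2 Lgf) e.
have w0 : {ae mu, forall x, 0 <= T t w x}.
  by apply: T_ge0 => // x; rewrite le_max lexx orbT.
have H1 : {ae mu, forall x, T t f x <= T t g x}.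
  by apply: filterS3 Tg w0 (T_lin 1 t0 Lw Lf) => x -> h ->; rewrite mul1r lerDr.
by apply: filterS3 H1 (Pt_ae t0 Lf) (Pt_ae t0 Lg) => x h -> ->.
Qed.

Lemma Pt_contract t f : 0 < t -> L1 mu f -> (forall x, 0 <= f x) ->
  I1 mu (Pt t f) <= I1 mu f.
Proof.
move=> t0 Lf f0.
have -> : I1 mu f = I1 mu (fun x => `|f x|).
  by congr (I1 mu _); apply/funext => x; rewrite ger0_norm.
apply: le_trans (T_contract t0 Lf).
apply: ae_le_I1; [exact: Pt_L1|exact/L1_norm/T_L1|].
by apply: filterS (Pt_ae t0 Lf) => x ->; exact: ler_norm.
Qed.

Lemma Pt_add s t f x : 0 < s -> 0 < t -> L1 mu f -> Pt (s + t) f x = Pt s (Pt t f) x.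
Proof.
move=> s0 t0 Lf; have st0 : 0 < s + t by exact: addr_gt0.
have LP := Pt_L1 t0 Lf.
apply: (ae_eq_continuous (f := Pt (s + t) f)); [exact: Pt_continuous|exact: Pt_continuous|].
have e1 := sg_add sg s0 t0 ((Lfun1P _).2 Lf).
have e2 := sg_ae sg s0 ((Lfun1P _).2 LP) ((Lfun1P _).2 (T_L1 t0 Lf)) (Pt_ae t0 Lf).
have H : {ae mu, forall x, Pt (s + t) f x = T s (Pt t f) x}.
  by apply: filterS3 (Pt_ae st0 Lf) e1 e2 => y -> -> ->.
by apply: filterS2 H (Pt_ae s0 LP) => y -> ->.
Qed.

Lemma generator_Pt u v : generator mu T u v -> in_generator mu Pt u v.
Proof.
move=> [/Lfun1P Lu /Lfun1P Lv uv]; split => //.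
have LL t : 0 < t -> L1 mu (fun x => t^-1 * (T t u x - u x) - v x).
  by move=> t0; apply: L1B => //; apply: L1Z; apply: L1B => //; exact: T_L1.
have LL' t : 0 < t -> L1 mu (fun x => t^-1 * (Pt t u x - u x) - v x).
  by move=> t0; apply: L1B => //; apply: L1Z; apply: L1B => //; exact: Pt_L1.
move/fine_cvg : uv; apply: cvg_trans; apply: near_eq_cvg; near=> t.
have t0 : 0 < t by near: t; exact: nbhs_right_gt.
rewrite /= Lnorm_I1 /=; last exact: LL.
apply: I1_ae_eq; [exact/L1_norm/LL|exact/L1_norm/LL'|].
by apply: filterS (Pt_ae t0 Lu) => x ->.
Unshelve. all: by end_near. Qed.

End L1_semigroup.

Lemma continuous_scale (R : realType) (V : topologicalType) (a : R) (f : V -> R) :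
  continuous f -> continuous (fun x => a * f x).
Proof. by move=> cf x; apply: (@continuousM _ _ (fun=> a) f); [exact: cst_continuous|exact: cf]. Qed.

(** * Lyapunov functions *)

Section cutoff.
Context {R : realType}.
Implicit Types s t : R.

Definition pos s : R := Num.max s 0.

Lemma pos_ge0 s : 0 <= pos s. Proof. by rewrite le_max lexx orbT. Qed.

Lemma posE s : 0 <= s -> pos s = s. Proof. exact: max_l. Qed.

Lemma pos0 s : s <= 0 -> pos s = 0. Proof. exact: max_r. Qed.

Lemma pos_continuous : continuous pos.
Proof. by move=> s; apply: (@continuous_max _ _ id (fun=> 0)); [exact: cvg_id|exact: cst_continuous]. Qed.

(** Exponents from 2 on make the power differentiable across 0: there the quotient is at most [|h|]
    in absolute value. *)
Lemma is_derive_pos k s : is_derive s 1 (fun t => pos t ^+ k.+2) (k.+2%:R * pos s ^+ k.+1).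
Proof.
case: (ltgtP s 0) => s0.
- rewrite pos0 ?ltW // expr0n mulr0.
  apply: (@near_eq_is_derive R R R (cst 0)).
  near=> t; rewrite pos0 ?expr0n //; apply: ltW.
  by near: t; exact: (@cvgr_lt R R (nbhs s) _ id s cvg_id).
- rewrite posE ?ltW //.
  apply: (@near_eq_is_derive R R R (fun t : R => t ^+ k.+2)).
    near=> t; rewrite posE //; apply: ltW.
    by near: t; exact: (@cvgr_gt R R (nbhs s) _ id s cvg_id).
  have := is_deriveX k.+2 (is_derive_id s 1); rewrite exprfctE.
  by move/is_derive_eq; apply; rewrite /GRing.scale /= mulr1.
- rewrite s0 (@pos0 0) // expr0n mulr0.
  apply: is_derive_cvg; apply/cvgrPdist_le => e e0; near=> h.
  have h0 : h != 0 by near: h; exact: nbhs_dnbhs_neq.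
  have hr : `|h| < e by near: h; exact: dnbhs0_lt.
  have h1 : `|h| < 1 by near: h; exact: dnbhs0_lt.
  rewrite addr0 /GRing.scale /= mulr1 (@pos0 0) // expr0n subr0 sub0r normrN.
  rewrite normrM normrX normfV mulrC ler_pdivrMr ?normr_gt0 //.
  have ph : `|pos h| <= `|h|.
    by rewrite [leLHS]ger0_norm ?pos_ge0 // /pos ge_max ler_norm normr_ge0.
  apply: (@le_trans _ _ (`|h| ^+ k.+2)).
    by apply: lerXn2r; rewrite ?nnegrE.
  rewrite !exprSr ler_wpM2r //.
  apply: (@le_trans _ _ `|h|); last exact: ltW.
  by rewrite ler_piMl // exprn_ile1 // ltW.
Unshelve. all: by end_near. Qed.

(* [bump] is the hat function on [0, 2] and [tau], [tau1] are its iterated primitives. *)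
Definition bump s : R := 6 * (pos s - 2 * pos (s - 1) + pos (s - 2)).
Definition tau1 s : R := 3 * (pos s ^+ 2 - 2 * pos (s - 1) ^+ 2 + pos (s - 2) ^+ 2).
Definition tau s : R := pos s ^+ 3 - 2 * pos (s - 1) ^+ 3 + pos (s - 2) ^+ 3.

Lemma is_derive_pos_shift k (c : R) s :
  is_derive s 1 (fun t => pos (t - c) ^+ k.+2) (k.+2%:R * pos (s - c) ^+ k.+1).
Proof.
rewrite -[X in is_derive _ _ _ X]mulr1.
apply: (@is_derive1_comp R (fun t => pos t ^+ k.+2) (fun t => t - c) s _ _ (is_derive_pos k (s - c))).
have := is_deriveB (is_derive_id s 1) (is_derive_cst c s 1).
by move/is_derive_eq; apply; rewrite subr0.
Qed.

Lemma is_derive_tau s : is_derive s 1 tau (tau1 s).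
Proof.
have := is_deriveD (is_deriveB (is_derive_pos 1 s) (is_deriveZ 2 (is_derive_pos_shift 1 1 s)))
  (is_derive_pos_shift 1 2 s).
by move/is_derive_eq; apply; rewrite /tau1 /GRing.scale /=; ring.
Qed.

Lemma is_derive_tau1 s : is_derive s 1 tau1 (bump s).
Proof.
have := is_deriveZ 3 (is_deriveD (is_deriveB (is_derive_pos 0 s)
  (is_deriveZ 2 (is_derive_pos_shift 0 1 s))) (is_derive_pos_shift 0 2 s)).
by move/is_derive_eq; apply; rewrite /bump /GRing.scale /= !expr1; ring.
Qed.

Lemma posP s : (s <= 0 /\ pos s = 0) \/ (0 <= s /\ pos s = s).
Proof.
by case: (leP s 0) => s0; [left; rewrite pos0|right; rewrite posE ltW].
Qed.

Ltac pos_cases s := case: (posP s) => -[? ->]; case: (posP (s - 1)) => -[? ->];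
  case: (posP (s - 2)) => -[? ->].

Lemma bump_ge0 s : 0 <= bump s.
Proof. by rewrite /bump; pos_cases s; lra. Qed.

Lemma bump_le s : bump s <= 6.
Proof. by rewrite /bump; pos_cases s; lra. Qed.

Lemma bump_out s : 2 <= s -> bump s = 0.
Proof. by move=> s2; rewrite /bump; pos_cases s; lra. Qed.

Lemma bump_neg s : s <= 0 -> bump s = 0.
Proof. by move=> s2; rewrite /bump; pos_cases s; lra. Qed.

Lemma tau1_ge0 s : 0 <= tau1 s.
Proof. by rewrite /tau1; pos_cases s; nra. Qed.

Lemma tau1_neg s : s <= 0 -> tau1 s = 0.
Proof. by move=> s0; rewrite /tau1 !pos0 ?expr0n /=; lra. Qed.

Lemma tau_neg s : s <= 0 -> tau s = 0.
Proof. by move=> s0; rewrite /tau !pos0 ?expr0n /=; lra. Qed.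

Lemma tau_ge s : 2 <= s -> s <= tau s.
Proof. by move=> s2; rewrite /tau !posE ?exprS ?expr0; nra. Qed.

Lemma tau_ge0 s : 0 <= tau s.
Proof.
have [s0|s0] := leP s 0; first by rewrite tau_neg.
have [|t _ E] := MVT s0 (fun t _ => is_derive_tau t).
  apply: continuous_subspaceT => t.
  by apply/differentiable_continuous/derivable1_diffP; have [] := is_derive_tau t.
rewrite -[tau s](subrK (tau 0)) E (@tau_neg 0) // addr0 subr0.
by rewrite mulr_ge0 ?tau1_ge0 // ltW.
Qed.

Lemma tau1_continuous : continuous tau1.
Proof.
move=> t; apply/differentiable_continuous/derivable1_diffP; by have [] := is_derive_tau1 t.
Qed.

Lemma bump_continuous : continuous bump.
Proof.
have cs (c : R) : continuous (fun s => pos (s - c)).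
  move=> s; apply: (@continuous_comp _ _ _ (fun s => s - c) pos); last exact: pos_continuous.
  by apply: continuousB; [exact: cvg_id|exact: cst_continuous].
have c2 : continuous (fun s : R => 2 * pos (s - 1)).
  exact: continuous_scale.
have c3 : continuous (fun s => pos s - 2 * pos (s - 1)).
  by move=> s; apply: (continuousB (pos_continuous (x := s)) (c2 s)).
have c4 : continuous (fun s => pos s - 2 * pos (s - 1) + pos (s - 2)).
  by move=> s; apply: (continuousD (c3 s) (cs 2 s)).
exact: continuous_scale.
Qed.

Variable m : R.
Hypothesis m_gt0 : 0 < m.

(** The cube makes it C^2 across the edge of its support. It equals [m] for [s <= 0], decreases, and
    tends to infinity with [m] at each fixed [s]. Beyond 2 [tau] is affine, so the cutoff is convex
    there and its second derivative can be negative only on the support of [bump], whatever [m]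
    is. *)
Definition cutoff s : R := m * pos (1 - m^-1 * tau s) ^+ 3.
Definition cutoff1 s : R := - 3 * pos (1 - m^-1 * tau s) ^+ 2 * tau1 s.
Definition cutoff2 s : R :=
  6 * m^-1 * pos (1 - m^-1 * tau s) * tau1 s ^+ 2 - 3 * pos (1 - m^-1 * tau s) ^+ 2 * bump s.

Let is_derive_inner s : is_derive s 1 (fun t => 1 - m^-1 * tau t) (- (m^-1 * tau1 s)).
Proof.
have := is_deriveB (is_derive_cst (1 : R) s 1) (is_deriveZ m^-1 (is_derive_tau s)).
by move/is_derive_eq; apply; rewrite sub0r.
Qed.

Lemma is_derive_cutoff s : is_derive s 1 cutoff (cutoff1 s).
Proof.
have := is_deriveZ m (@is_derive1_comp R (fun t => pos t ^+ 3)
  (fun t => 1 - m^-1 * tau t) s _ _ (is_derive_pos 1 (1 - m^-1 * tau s)) (is_derive_inner s)).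
move/is_derive_eq; apply; rewrite /cutoff1 /GRing.scale /=; field; exact: lt0r_neq0.
Qed.

Lemma is_derive_cutoff1 s : is_derive s 1 cutoff1 (cutoff2 s).
Proof.
have := is_deriveM (is_deriveZ (- 3) (@is_derive1_comp R (fun t => pos t ^+ 2)
  (fun t => 1 - m^-1 * tau t) s _ _ (is_derive_pos 0 (1 - m^-1 * tau s)) (is_derive_inner s)))
  (is_derive_tau1 s).
move/is_derive_eq; apply; rewrite /cutoff2 /GRing.scale /= expr1.
rewrite -[- 3 *: pos _ ^+ 2]/(- 3 * pos (1 - m^-1 * tau s) ^+ 2); ring.
Qed.

Let inner_continuous : continuous (fun s => pos (1 - m^-1 * tau s)).
Proof.
move=> s; apply: (@continuous_comp _ _ _ (fun s => 1 - m^-1 * tau s) pos); last exact: pos_continuous.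
by apply/differentiable_continuous/derivable1_diffP; have [] := is_derive_inner s.
Qed.

Lemma cutoff_continuous : continuous cutoff.
Proof.
move=> t; apply/differentiable_continuous/derivable1_diffP; by have [] := is_derive_cutoff t.
Qed.

Lemma cutoff1_continuous : continuous cutoff1.
Proof.
move=> t; apply/differentiable_continuous/derivable1_diffP; by have [] := is_derive_cutoff1 t.
Qed.

Lemma cutoff2_continuous : continuous cutoff2.
Proof.
have c1 : continuous (fun s => 6 * m^-1 * pos (1 - m^-1 * tau s)).
  exact: continuous_scale.
have c2 : continuous (fun s => tau1 s ^+ 2).
  by move=> s; apply: (@continuousM _ _ tau1 tau1); exact: tau1_continuous.
have c3 : continuous (fun s => pos (1 - m^-1 * tau s) ^+ 2).
  by move=> s; exact: (continuousM (inner_continuous (x := s)) (inner_continuous (x := s))).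
have c4 : continuous (fun s => 3 * pos (1 - m^-1 * tau s) ^+ 2).
  exact: continuous_scale.
have c5 : continuous (fun s => 6 * m^-1 * pos (1 - m^-1 * tau s) * tau1 s ^+ 2).
  by move=> s; exact: (continuousM (c1 s) (c2 s)).
have c6 : continuous (fun s => 3 * pos (1 - m^-1 * tau s) ^+ 2 * bump s).
  by move=> s; exact: (continuousM (c4 s) (bump_continuous (x := s))).
by move=> s; exact: (continuousB (c5 s) (c6 s)).
Qed.

Let inner_le s : 0 <= pos (1 - m^-1 * tau s) <= 1.
Proof.
rewrite pos_ge0 ge_max ler01 andbT gerBl mulr_ge0 ?tau_ge0 //.
by rewrite invr_ge0 ltW.
Qed.

Lemma cutoff_ge0 s : 0 <= cutoff s.
Proof. by rewrite mulr_ge0 ?exprn_ge0 ?pos_ge0 // ltW. Qed.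

Lemma cutoff_neg s : s <= 0 -> cutoff s = m.
Proof. by move=> s0; rewrite /cutoff tau_neg // mulr0 subr0 posE // expr1n mulr1. Qed.

Lemma cutoff_out s : 2 <= s -> m <= s -> cutoff s = 0.
Proof.
move=> s2 ms; rewrite /cutoff pos0 ?expr0n ?mulr0 // subr_le0 -ler_pdivrMl ?invr_gt0 //.
by rewrite invrK mulr1; apply: le_trans ms (tau_ge s2).
Qed.

Lemma cutoff1_le0 s : cutoff1 s <= 0.
Proof.
have := tau1_ge0 s; have : 0 <= pos (1 - m^-1 * tau s) ^+ 2 by rewrite exprn_ge0 ?pos_ge0.
rewrite /cutoff1; nra.
Qed.

Lemma cutoff1_neg s : s <= 0 -> cutoff1 s = 0.
Proof. by move=> s0; rewrite /cutoff1 tau1_neg // mulr0. Qed.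

Lemma cutoff2_neg s : s <= 0 -> cutoff2 s = 0.
Proof. by move=> s0; rewrite /cutoff2 tau1_neg // bump_neg // expr0n /= !mulr0 subr0. Qed.

(** The square term is nonnegative and the weight of [bump] is at most 3. The bound is independent
    of [m], as required for a single [k']. *)
Lemma cutoff2_ge s : - 3 * bump s <= cutoff2 s.
Proof.
have /andP[h0 h1] := inner_le s; rewrite /cutoff2.
set w := pos _ in h0 h1 *.
have b0 := bump_ge0 s.
have : 0 <= 6 * m^-1 * w * tau1 s ^+ 2.
  have mi : 0 <= m^-1 by rewrite invr_ge0 ltW.
  by apply: mulr_ge0; [apply: mulr_ge0 => //; apply: mulr_ge0|exact: sqr_ge0].
have : w ^+ 2 <= 1 by rewrite exprn_ile1.
nra.
Qed.

End cutoff.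

Section enorm.
Context {R : realType} {n : nat}.
Local Notation E := 'rV[R]_n.

Lemma continuous_sum (V : topologicalType) (I : Type) (s : seq I) (F : I -> V -> R) :
  (forall i, continuous (F i)) -> continuous (fun x => \sum_(i <- s) F i x).
Proof.
move=> cF; elim: s => [|i s IH] x.
  rewrite (_ : (fun x => _) = fun=> 0); first exact: cst_continuous.
  by apply/funext => y; rewrite big_nil.
rewrite (_ : (fun x => _) = fun x => F i x + \sum_(j <- s) F j x).
  exact: (continuousD (cF i x) (IH x)).
by apply/funext => y; rewrite big_cons.
Qed.

Lemma enorm_continuous : continuous (@enorm R n).
Proof.
move=> x; apply: (@continuous_comp _ _ _ (fun x : E => \sum_(i < n) x 0 i ^+ 2) Num.sqrt).
  apply: continuous_sum => i y.
  by apply: (@continuousM _ _ (fun y : E => y 0 i) (fun y : E => y 0 i)); exact: coord_continuous.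
exact: sqrt_continuous.
Qed.

Lemma norm_le_enorm (x : E) : `|x| <= enorm x.
Proof.
apply: norm_le_coord => [|i]; first exact: sqrtr_ge0.
rewrite -sqrtr_sqr; apply: ler_wsqrtr.
rewrite (bigD1 i) //= lerDl; apply: sumr_ge0 => j _; exact: sqr_ge0.
Qed.

Lemma open_enorm_lt (r : R) : open [set x : E | enorm x < r].
Proof.
apply: (@open_comp _ _ (@enorm R n) [set t | t < r]); last exact: open_lt.
by move=> x _; exact: enorm_continuous.
Qed.

Lemma closed_enorm_le (r : R) : closed [set x : E | enorm x <= r].
Proof.
apply: (@closed_comp _ _ (@enorm R n) [set t | t <= r]); last exact: closed_le.
by move=> x _; exact: enorm_continuous.
Qed.

Lemma compact_enorm_le (r : R) : compact [set x : E | enorm x <= r].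
Proof.
apply: (subclosed_compact (@closed_enorm_le r) (@closed_ball_compact R n r)).
by move=> x /=; apply: le_trans; exact: norm_le_enorm.
Qed.

Lemma closure_eball (r : R) : closure (@eball R n r) `<=` [set x | enorm x <= r].
Proof.
rewrite [X in _ `<=` X](closure_id _).1; last exact: closed_enorm_le.
by apply: closure_subset => x; exact: ltW.
Qed.

End enorm.

(** * Compositions of [g] with the cutoffs *)

Section composition.
Context {R : realType} {n : nat}.
Local Notation E := 'rV[R]_n.
Local Notation e_ i := (delta_mx 0 i : E).
Variables (N0 : nat) (g : E -> R) (M m : R).
Local Notation O2 := (~` closure (@eball R n N0%:R)).
Hypothesis g_C2 : Ck 2 O2 g.
Hypothesis g_cont : continuous g.
Hypothesis g_le : forall x, enorm x < N0%:R + 1 -> g x <= M.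
Hypothesis m_gt0 : 0 < m.

Definition lyap x := cutoff m (g x - M).
Definition lyap1 i x := cutoff1 m (g x - M) * pd i g x.
Definition lyap2 i j x :=
  cutoff1 m (g x - M) * pd i (pd j g) x + pd j g x * (cutoff2 m (g x - M) * pd i g x).

(** Two overlapping open regions: on the inner one [g <= M] and the cutoff of [g - M] is locally
    constant; on the outer one [g] is C^2 and the chain rule applies. Each regularity proof below
    splits along them. *)
Lemma inner_or_outer (x : E) : enorm x < N0%:R + 1 \/ O2 x.
Proof.
have [xN|] := ltP (enorm x) (N0%:R + 1); first by left.
by move=> xN; right => /closure_eball /=; lra.
Qed.

Let near_inner x : enorm x < N0%:R + 1 -> \forall y \near x, g y - M <= 0.
Proof.
move=> xN; have : \forall y \near x, enorm y < N0%:R + 1.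
  by apply: open_nbhs_nbhs; split => //; exact: open_enorm_lt.
by apply: filterS => y /g_le; rewrite subr_le0.
Qed.

Let inner x : enorm x < N0%:R + 1 -> g x - M <= 0.
Proof. by move=> /g_le; rewrite subr_le0. Qed.

Let g_derive x i : O2 x -> is_derive x (e_ i) (fun y => g y - M) (pd i g x).
Proof.
move=> xO; have dg : is_derive x (e_ i) g (pd i g x).
  by apply: derivableP; exact: (g_C2 (s := [::]) isT).2.
by apply: (is_derive_eq (is_deriveB dg (is_derive_cst M x (e_ i)))); rewrite subr0.
Qed.

Lemma is_derive_lyap i x : is_derive x (e_ i) lyap (lyap1 i x).
Proof.
have [xN|xO] := inner_or_outer x.
  rewrite /lyap1 cutoff1_neg ?inner // mul0r.
  apply: (@near_eq_is_derive _ _ _ (cst m)).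
  by apply: filterS (near_inner xN) => y yM; rewrite /lyap cutoff_neg.
exact: (is_derive_chain (is_derive_cutoff m_gt0 _) (g_derive i xO)).
Qed.

Lemma is_derive_lyap1 i j x : is_derive x (e_ i) (lyap1 j) (lyap2 i j x).
Proof.
have [xN|xO] := inner_or_outer x.
  rewrite /lyap2 cutoff1_neg ?cutoff2_neg ?inner // !mul0r mulr0 addr0.
  apply: (@near_eq_is_derive _ _ _ (cst 0)).
  by apply: filterS (near_inner xN) => y yM; rewrite /lyap1 cutoff1_neg // mul0r.
have d1 := is_derive_chain (is_derive_cutoff1 m _) (g_derive i xO).
have d2 : is_derive x (e_ i) (pd j g) (pd i (pd j g) x).
  by apply: derivableP; exact: (g_C2 (s := [:: j]) isT).2.
exact: (is_deriveM d1 d2).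
Qed.

Lemma near_continuous (h k : E -> R) x : (\forall y \near x, k y = h y) ->
  {for x, continuous k} -> {for x, continuous h}.
Proof.
move=> kh ck; rewrite /prop_for /continuous_at -(nbhs_singleton kh).
exact: cvg_trans (near_eq_cvg kh) ck.
Qed.

Let c_inner (phi : R -> R) : continuous phi -> continuous (fun x => phi (g x - M)).
Proof.
move=> cphi x; apply: (@continuous_comp _ _ _ (fun x => g x - M) phi); last exact: cphi.
exact: (continuousB (g_cont (x := x)) (@cst_continuous _ _ M x)).
Qed.

Lemma lyap_continuous : continuous lyap.
Proof. exact: c_inner (cutoff_continuous m_gt0). Qed.

Lemma lyap1_continuous i : continuous (lyap1 i).
Proof.
move=> x; have [xN|xO] := inner_or_outer x.
  apply: (@near_continuous _ (cst 0)); last exact: cst_continuous.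
  by apply: filterS (near_inner xN) => y yM; rewrite /lyap1 cutoff1_neg // mul0r.
have c1 := c_inner (cutoff1_continuous (m := m)) (x := x).
have g1 : {for x, continuous (pd i g)} by exact: (g_C2 (s := [:: i]) isT).1.
exact: (continuousM c1 g1).
Qed.

Lemma lyap2_continuous i j : continuous (lyap2 i j).
Proof.
move=> x; have [xN|xO] := inner_or_outer x.
  apply: (@near_continuous _ (cst 0)); last exact: cst_continuous.
  apply: filterS (near_inner xN) => y yM.
  by rewrite /lyap2 cutoff1_neg ?cutoff2_neg // !mul0r mulr0 addr0.
have c1 := c_inner (cutoff1_continuous (m := m)) (x := x).
have c2 := c_inner (cutoff2_continuous (m := m)) (x := x).
have g1 k : {for x, continuous (pd k g)} by exact: (g_C2 (s := [:: k]) isT).1.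
have g2 : {for x, continuous (pd i (pd j g))} by exact: (g_C2 (s := [:: i; j]) isT).1.
exact: (continuousD (continuousM c1 g2) (continuousM (g1 j) (continuousM c2 (g1 i)))).
Qed.

Lemma pd_lyap i : pd i lyap = lyap1 i.
Proof. by apply/funext => x; have [] := is_derive_lyap i x. Qed.

Lemma pd_lyap1 i j : pd i (lyap1 j) = lyap2 i j.
Proof. by apply/funext => x; have [] := is_derive_lyap1 i j x. Qed.

Lemma Ck_lyap : Ck 2 setT lyap.
Proof.
case=> [|j [|i [|//]]] _ /=; rewrite ?pd_lyap ?pd_lyap1; split => //.
- by move=> x _; exact: lyap_continuous.
- by move=> _ x i _; have [] := is_derive_lyap i x.
- by move=> x _; exact: lyap1_continuous.
- by move=> _ x i _; have [] := is_derive_lyap1 i j x.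
- by move=> x _; exact: lyap2_continuous.
Qed.

(** Second-order chain rule. With [cutoff1 <= 0] and [L g <= 0] the first term is nonnegative, which
    leaves only the quadratic form to be bounded below. *)
Lemma Lop_lyap (A : E -> 'M[R]_n) (G : E -> E) x :
  Lop A G lyap x = cutoff1 m (g x - M) * Lop A G g x +
    2^-1 * cutoff2 m (g x - M) * dotp (mapv (A x) (grad g x)) (grad g x).
Proof.
rewrite /Lop; set c1 := cutoff1 _ _; set c2 := cutoff2 _ _.
have -> : dotp (G x) (grad lyap x) = c1 * dotp (G x) (grad g x).
  rewrite /dotp mulr_sumr; apply: eq_bigr => i _.
  by rewrite !mxE pd_lyap /lyap1 -/c1; ring.
have -> : \sum_(i < n) \sum_(j < n) A x i j * pd i (pd j lyap) x =
    c1 * (\sum_(i < n) \sum_(j < n) A x i j * pd i (pd j g) x) +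
    c2 * dotp (mapv (A x) (grad g x)) (grad g x).
  rewrite /dotp /mapv !mulr_sumr -big_split; apply: eq_bigr => i _ /=.
  rewrite !mxE mulr_suml !mulr_sumr -big_split; apply: eq_bigr => j _ /=.
  by rewrite pd_lyap pd_lyap1 /lyap2 !mxE -/c1 -/c2; ring.
ring.
Qed.

End composition.

Section growth.
Context {R : realType} {n : nat}.
Local Notation E := 'rV[R]_n.

Lemma inf_growth (g : E -> R) : (forall x, 0 <= g x) ->
  inf [set g x | x in [set x | enorm x = r]] @[r --> +oo] --> +oo ->
  forall C, exists2 r : R, 0 < r & forall x, r <= `|x| -> C <= g x.
Proof.
move=> g0 ginf C.
have /cvgryPge/(_ C) [r [_ rP]] := ginf.
exists (Num.max r 0 + 1).
  by rewrite ltr_wpDl // le_max lexx orbT.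
move=> x rx; apply: (@le_trans _ _ (inf [set g y | y in [set y | enorm y = enorm x]])).
  apply: rP; have := norm_le_enorm x.
  have : r <= Num.max r 0 by rewrite le_max lexx.
  lra.
(* [inf] bounds the values from below because the set is itself bounded below; this uses
   [g >= 0]. *)
apply: ge_inf; last by exists x.
by exists 0 => _ [y _ <-].
Qed.

Lemma pd_out (f : E -> R) (r : R) i : (forall x, r < `|x| -> f x = 0) ->
  forall x, r < `|x| -> pd i f x = 0.
Proof.
move=> fr x xr; rewrite /pd -[RHS](derive_cst (0 : R) x (delta_mx 0 i)).
apply: near_eq_derive.
have H : \forall y \near x, `]r, +oo[%classic `|y|.
  apply: (@norm_continuous _ _ x); apply: open_nbhs_nbhs; split; first exact: interval_open.
  by rewrite /= in_itv /= xr.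
by apply: filterS H => y; rewrite /= in_itv /= andbT => /fr ->.
Qed.

End growth.

Section Lfun_local.
Context {d : measure_display} {T : measurableType d} {R : realType}.
Variable mu : {measure set T -> \bar R}.

(** On a set of finite measure, [|f| <= 1 + |f|^q]. *)
Lemma Lfun_L1 (q : R) (f : T -> R) (A : set T) : 1 <= q -> measurable A -> (mu A < +oo)%E ->
  f \in Lfun mu q%:E -> (forall x, ~ A x -> f x = 0) -> L1 mu f.
Proof.
move=> q1 mA Afin Lf fA.
have Lq := Lfun_integrable q1 Lf.
have mf : measurable_fun setT f by move: Lf; rewrite inE => /andP[/[!inE]].
have LA : L1 mu \1_A.
  apply/integrableP; split; first exact/measurable_EFinP/measurable_indic.
  rewrite (eq_integral (fun x => (\1_A x)%:E)) ?integral_indic ?setIT //.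
  by move=> x _ /=; rewrite ger0_norm.
apply: (L1_le mf (L1D LA Lq)) => x /=.
have [Ax|nA] := pselect (A x); last first.
  by rewrite fA // normr0 addr_ge0 // powR_ge0.
rewrite indicE mem_set //=; have [f1|f1] := leP `|f x| 1.
  by apply: le_trans f1 _; rewrite lerDl powR_ge0.
apply: (@le_trans _ _ (`|f x| `^ q)); last by rewrite lerDr.
by rewrite -[leLHS](powRr1 (normr_ge0 _)); apply: ler_powR => //; exact: ltW.
Qed.

End Lfun_local.

(** * Lower bounds for [L] on compactly supported C^2 functions *)

Section lyapunov.
Context {R : realType} {n : nat}.
Local Notation E := 'rV[R]_n.
Local Notation leb := (@lebesgue_rV R n).
Variables (A : E -> 'M[R]_n) (G : E -> E) (q : R) (rho : E -> R)
  (mu : {measure set E -> \bar R}) (T Pt : R -> (E -> R) -> E -> R).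
Hypothesis A_cont : forall i j, continuous (fun x => A x i j).
Hypothesis A_pos : forall x v, 0 <= dotp (mapv (A x) v) v.
Hypothesis q_ge1 : 1 <= q.
Hypothesis G_loc : assumption_b q G.
Hypothesis rho_cont : continuous rho.
Hypothesis rho_gt0 : forall x, 0 < rho x.
Hypothesis rho_dens : is_density rho mu.
Hypothesis sg : global_semigroup mu T A G rho.
Hypothesis cv : continuous_version mu T Pt.

Let ae_le := ae_continuous_le rho_cont rho_gt0 rho_dens.
Let sgT : subMarkov_C0_contraction_semigroup mu T. Proof. by case: sg. Qed.

Lemma L1_cball r : L1 mu \1_(cball r).
Proof.
have := density_integrable rho_cont rho_gt0 rho_dens (r := r) (f := fun=> 1).
rewrite (_ : (fun x => 1 * _) = \1_(cball r)); last by apply/funext => x; rewrite mul1r.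
apply; apply/integrableP; split.
  apply/measurable_EFinP; apply: measurable_funM => //.
  by apply: measurable_indic; exact: measurable_cball.
rewrite (eq_integral (fun x => (\1_(cball r) x)%:E)).
  rewrite integral_indic ?setIT //; last exact: measurable_cball.
  exact: lebesgue_rV_ball_fin.
by move=> x _ /=; rewrite mul1r ger0_norm.
Qed.

Lemma L1_continuous_cball r (a : E -> R) : continuous a -> L1 mu (fun x => a x * \1_(cball r) x).
Proof.
move=> ca.
have [M M0 MP] : exists2 M : R, 0 <= M & forall x, cball r x -> `|a x| <= M.
  have [r0|r0] := leP 0 r; last first.
    by exists 0 => // x; rewrite /cball /= => h; have := normr_ge0 x; lra.
  have cn : continuous (fun x => `|a x|).
    by move=> x; apply: continuous_comp; [exact: ca|exact: norm_continuous].
  have [|c _ cP] := EVT_max_rV _ (@closed_ball_compact R n r) (continuous_subspaceT cn).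
    by exists 0; rewrite /= normr0.
  by exists `|a c| => // x xr; apply: cP; exact: mem_set.
apply: (L1_le _ (L1Z M (L1_cball r))).
  apply: measurable_funM; first exact: continuous_measurable_rV.
  by apply: measurable_indic; exact: measurable_cball.
move=> x; rewrite normrM indicE; have [/set_mem xr|_] := boolP (x \in _).
  by rewrite normr1 !mulr1; exact: MP.
by rewrite normr0 !mulr0.
Qed.

Lemma L1_drift_cball r i : L1 mu (fun x => `|G x 0 i| * \1_(cball r) x).
Proof.
have LG : L1 mu (fun x => G x 0 i * \1_(cball r) x).
  apply: (density_integrable rho_cont rho_gt0 rho_dens).
  apply: (Lfun_L1 q_ge1 (measurable_cball r) (lebesgue_rV_ball_fin r)).
    by apply: G_loc; exact: closed_ball_compact.
  by move=> x nx; rewrite indicE memNset // mulr0.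
rewrite (_ : (fun x => _) = fun x => `|G x 0 i * \1_(cball r) x|); first exact: L1_norm.
by apply/funext => x; rewrite normrM; congr (_ * _); rewrite ger0_norm.
Qed.

Lemma L1_sum (I : Type) (s : seq I) (F : I -> E -> R) :
  (forall i, L1 mu (F i)) -> L1 mu (fun x => \sum_(i <- s) F i x).
Proof.
move=> LF; elim: s => [|i s IH].
  rewrite (_ : (fun x => _) = fun=> 0); first exact: L1_0.
  by apply/funext => y; rewrite big_nil.
rewrite (_ : (fun x => _) = fun x => F i x + \sum_(j <- s) F j x); first exact: L1D.
by apply/funext => y; rewrite big_cons.
Qed.

(** Integrable majorant of the coefficients on a ball: functions supported there and [e]-close in
    C^2 have images under [L] that differ by at most [e] times it. *)
Definition coef_bound r x : R :=
  2^-1 * (\sum_(i < n) \sum_(j < n) `|A x i j| * \1_(cball r) x) +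
  \sum_(i < n) `|G x 0 i| * \1_(cball r) x.

Lemma L1_coef_bound r : L1 mu (coef_bound r).
Proof.
apply: L1D; last by apply: L1_sum => i; exact: L1_drift_cball.
apply: L1Z; apply: L1_sum => i; apply: L1_sum => j; apply: L1_continuous_cball => x.
by apply: continuous_comp; [exact: A_cont|exact: norm_continuous].
Qed.

Lemma Lop_dist (u f : E -> R) (r e : R) : 0 <= e ->
  (forall x, r < `|x| -> u x = 0) -> (forall x, r < `|x| -> f x = 0) ->
  (forall s, (size s <= 2)%N -> forall x, `|iter_pd s u x - iter_pd s f x| <= e) ->
  forall x, `|Lop A G u x - Lop A G f x| <= e * coef_bound r x.
Proof.
move=> e0 ur fr uf x.
have d1 i : `|pd i u x - pd i f x| <= e * \1_(cball r) x.
  rewrite indicE; have [_|] := boolP (x \in _); first by rewrite mulr1; exact: (uf [:: i]).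
  move=> /negP; rewrite in_setE /cball /= => /negP; rewrite -ltNge => xr.
  by rewrite (pd_out i ur) // (pd_out i fr) // subrr normr0 mulr0.
have d2 i j : `|pd i (pd j u) x - pd i (pd j f) x| <= e * \1_(cball r) x.
  rewrite indicE; have [_|] := boolP (x \in _); first by rewrite mulr1; exact: (uf [:: i; j]).
  move=> /negP; rewrite in_setE /cball /= => /negP; rewrite -ltNge => xr.
  by rewrite (pd_out i (pd_out j ur)) // (pd_out i (pd_out j fr)) // subrr normr0 mulr0.
have -> : Lop A G u x - Lop A G f x =
  2^-1 * (\sum_(i < n) \sum_(j < n) A x i j * (pd i (pd j u) x - pd i (pd j f) x)) +
  \sum_(i < n) G x 0 i * (pd i u x - pd i f x).
  have E1 : \sum_(i < n) G x 0 i * (pd i u x - pd i f x) =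
      dotp (G x) (grad u x) - dotp (G x) (grad f x).
    by rewrite /dotp -sumrB; apply: eq_bigr => i _; rewrite !mxE mulrBr.
  have E2 : \sum_(i < n) \sum_(j < n) A x i j * (pd i (pd j u) x - pd i (pd j f) x) =
      \sum_(i < n) \sum_(j < n) A x i j * pd i (pd j u) x -
      \sum_(i < n) \sum_(j < n) A x i j * pd i (pd j f) x.
    rewrite -sumrB; apply: eq_bigr => i _; rewrite -sumrB; apply: eq_bigr => j _.
    by rewrite mulrBr.
  by rewrite E1 E2 /Lop; ring.
rewrite /coef_bound mulrDr; apply: le_trans (ler_normD _ _) _; apply: lerD.
  rewrite mulrCA normrM ger0_norm // ler_wpM2l //.
  rewrite mulr_sumr; apply: le_trans (ler_norm_sum _ _ _) _; apply: ler_sum => i _.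
  rewrite mulr_sumr; apply: le_trans (ler_norm_sum _ _ _) _; apply: ler_sum => j _.
  by rewrite normrM mulrCA ler_wpM2l.
rewrite mulr_sumr; apply: le_trans (ler_norm_sum _ _ _) _; apply: ler_sum => i _.
by rewrite normrM mulrCA ler_wpM2l.
Qed.

Lemma exists_exhaustion : exhaustion (fun k => @eball R n k.+1%:R).
Proof.
split.
- by move=> k; exact: open_enorm_lt.
- move=> k; apply: (subclosed_compact (@closed_closure _ _) (@compact_enorm_le R n k.+1%:R)).
  exact: closure_eball.
- by move=> k x /= xk; apply: lt_le_trans xk _; rewrite ler_nat.
- apply/seteqP; split => // x _; exists (Num.bound (enorm x)) => //.
  rewrite /eball /=; apply: lt_le_trans (archi_boundP _) _; first exact: sqrtr_ge0.
  by rewrite ler_nat.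
Qed.

(* Only test functions are known to lie in the domain of the generator: [f] is
   approximated by them in C^2. *)
Lemma C2_lower_bound (f z kap : E -> R) (r : R) : Ck 2 setT f -> 0 < r ->
  (forall x, r <= `|x| -> f x = 0) -> L1 mu f ->
  L1 mu z -> (forall x, 0 <= z x) -> in_generator mu Pt kap (fun x => kap x - z x) ->
  {ae mu, forall x, - z x <= Lop A G f x} ->
  {ae mu, forall x, f x - Pt 1 f x <= expR 1 * `|kap x| + `|Pt 1 kap x|}.
Proof.
move=> fC r0 fr Lf Lz z0 kz Lfz.
have Q_L1 t h : 0 < t -> L1 mu h -> L1 mu (Pt t h).
  by move=> t0 Lh; exact: (Pt_L1 cv t0 Lh).
have Q_lin t a h k x := @Pt_linear _ _ mu T Pt ae_le sgT cv t a h k x.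
have Q_mono t h k := @Pt_mono _ _ mu T Pt ae_le sgT cv t h k.
have Q_con t h := @Pt_contract _ _ mu T Pt sgT cv t h.
have Q_add s t h x := @Pt_add _ _ mu T Pt ae_le sgT cv s t h x.
have Lkap : L1 mu kap by case: kz.
pose k' x := expR 1 * `|kap x| + `|Pt 1 kap x|.
have Lk' : L1 mu k' by apply: L1D; [apply/L1Z/L1_norm|apply/L1_norm/Q_L1].
have LPf : L1 mu (Pt 1 f) by exact: Q_L1.
pose W := coef_bound (r + 1).
have LW : L1 mu W := L1_coef_bound (r + 1).
have W0 : 0 <= I1 mu (fun x => `|W x|) by exact: I1_ge0.
have LB := L1_cball (r + 1).
have B0 : 0 <= I1 mu (\1_(cball (r + 1))) by exact: I1_ge0.
have D0 : 0 < I1 mu (fun x => `|W x|) + 2 * I1 mu (\1_(cball (r + 1))) + 1.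
  by rewrite ltr_wpDl // addr_ge0 // mulr_ge0.
have LD : L1 mu (fun x => Pt 1 f x - f x + k' x) by apply: L1D => //; exact: L1B.
suff H : Nneg mu (fun x => Pt 1 f x - f x + k' x) <= 0.
  by apply: filterS (Nneg_eq0 LD H) => x; rewrite -/(k' x); lra.
apply/ler_addgt0Pr => e1 e10; rewrite add0r.
(* The replacement of [f] by a test function [u] costs [e] times the integral of [|W|] for [L u],
   and [e] times the volume of the ball for each of [u - f] and [Pt 1 f - Pt 1 u]. *)
pose e := e1 / (I1 mu (fun x => `|W x|) + 2 * I1 mu (\1_(cball (r + 1))) + 1).
have e0 : 0 < e by exact: divr_gt0.
have [u tu [ur uf]] := test_function_dense fC r0 fr e0.
have gu : in_generator mu Pt u (Lop A G u).
  by apply: (generator_Pt sgT cv); case: sg => _ _; exact.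
have Lu : L1 mu u by case: gu.
have LLu : L1 mu (Lop A G u) by case: gu.
have LPu : L1 mu (Pt 1 u) by exact: Q_L1.
have K := generator_lower_bound Q_L1 Q_lin Q_mono Q_con Q_add gu Lz z0 kz.
have K2 : Nneg mu (fun x => Lop A G u x + z x) <= e * I1 mu (fun x => `|W x|).
  rewrite -I1Z; last exact: L1_norm.
  apply: ae_le_I1; [by apply: L1_neg; exact: L1D|by apply: L1Z; exact: L1_norm|].
  apply: filterS Lfz => x Lfz.
  have := Lop_dist (ltW e0) (fun x h => ur x (ltW h)) (r := r + 1) (f := f)
    (fun x h => fr x (ltW (lt_trans (_ : r < r + 1) h))) uf x.
  rewrite ltrDl => /(_ ltr01); rewrite -/(W x) => Ld.
  have W0x : 0 <= e * `|W x| by rewrite mulr_ge0 // ltW.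
  rewrite ge_max W0x andbT.
  have : e * W x <= e * `|W x| by rewrite ler_wpM2l ?ler_norm // ltW.
  by move: Ld; rewrite ler_norml => /andP[+ _]; lra.
have Luf : L1 mu (fun x => u x - f x) by exact: L1B.
have K3 : I1 mu (fun x => `|u x - f x|) <= e * I1 mu (\1_(cball (r + 1))).
  rewrite -I1Z //; apply: le_I1; [exact: L1_norm|exact: L1Z|move=> x].
  rewrite indicE; have [_|] := boolP (x \in _); first by rewrite mulr1; exact: (uf [::]).
  move=> /negP; rewrite in_setE /cball /= => /negP; rewrite -ltNge => xr.
  by rewrite ur ?(ltW xr) // fr ?subrr ?normr0 ?mulr0 //; lra.
have K4 : I1 mu (fun x => `|Pt 1 f x - Pt 1 u x|) <= I1 mu (fun x => `|u x - f x|).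
  have := T_dist sgT ltr01 Lf Lu.
  rewrite (_ : (fun x => `|f x - u x|) = fun x => `|u x - f x|); last first.
    by apply/funext => x; rewrite distrC.
  apply: le_trans; apply: ae_le_I1; [exact/L1_norm/L1B|by apply/L1_norm/L1B; apply: (T_L1 sgT ltr01)|].
  by apply: filterS2 (Pt_ae sgT cv ltr01 Lf) (Pt_ae sgT cv ltr01 Lu) => x -> ->.
have E : (fun x => Pt 1 f x - f x + k' x) =
  (fun x => (Pt 1 u x - u x + k' x) + ((Pt 1 f x - Pt 1 u x) + (u x - f x))).
  by apply/funext => x; lra.
have LPP : L1 mu (fun x => Pt 1 f x - Pt 1 u x) by exact: L1B.
have Luk : L1 mu (fun x => Pt 1 u x - u x + k' x) by apply: L1D => //; exact: L1B.
rewrite E; apply: le_trans (NnegD Luk (L1D LPP Luf)) _.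
have N2 : Nneg mu (fun x => (Pt 1 f x - Pt 1 u x) + (u x - f x)) <=
  2 * (e * I1 mu (\1_(cball (r + 1)))).
  apply: le_trans (Nneg_le (L1D LPP Luf)) _.
  apply: le_trans (I1_normD LPP Luf) _; lra.
have : e * (I1 mu (fun x => `|W x|) + 2 * I1 mu (\1_(cball (r + 1))) + 1) = e1.
  by rewrite /e divfK // gt_eqF.
by move: K; rewrite -/k' => K; lra.
Qed.

Variables (N0 : nat) (g : E -> R).
Hypothesis g_C2 : Ck 2 (~` closure (eball N0%:R)) g.
Hypothesis g_cont : continuous g.
Hypothesis g_ge0 : forall x, 0 <= g x.
Hypothesis g_inf : inf [set g x | x in [set x | enorm x = r]] @[r --> +oo] --> +oo.
Hypothesis g_super : {ae leb, forall x, (~` closure (eball N0%:R)) x -> Lop A G g x <= 0}.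

(** [M], the ball and [z] are fixed before [m], so the resolvent [kap] of [z], and with it [k'],
    serves all [m]. *)
Theorem lyapunov_functions : exists (M : R) (k' : E -> R),
  [/\ L1 mu k', forall x, 0 <= k' x,
      forall m : R, 0 < m -> L1 mu (lyap g M m) /\ continuous (lyap g M m) &
      forall m : R, 0 < m ->
        {ae mu, forall x, lyap g M m x - Pt 1 (lyap g M m) x <= k' x}].
Proof.
have [M g_le] : exists M : R, forall x, enorm x < N0%:R + 1 -> g x <= M.
  have [|c _ cP] := EVT_max_rV _ (@compact_enorm_le R n (N0%:R + 1)) (continuous_subspaceT g_cont).
    exists 0; rewrite /= /enorm big1 ?sqrtr0 ?addr_ge0 // => i _.
    by rewrite mxE expr0n.
  by exists (g c) => x xN; apply: cP; apply: mem_set; exact: ltW.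
exists M.
(* Off the ball of radius [r], [g - M >= 3] lies beyond the support [0, 2] of [bump]. *)
have [r r0 rP] := inf_growth g_ge0 g_inf (M + 3).
pose a x := dotp (mapv (A x) (grad g x)) (grad g x).
(* The shell is compact and contained in the region where [g] is C^2, so the quadratic form of the
   gradient is bounded on it. *)
have [c c0 cP] : exists2 c : R, 0 <= c & forall x, N0%:R + 1 <= enorm x -> `|x| <= r -> a x <= c.
  pose K := [set x : E | N0%:R + 1 <= enorm x /\ `|x| <= r].
  have cK : compact K.
    apply: (subclosed_compact _ (@closed_ball_compact R n r)); last by move=> x [].
    apply: closedI; last exact: compact_closed (@norm_hausdorff _ _) (@closed_ball_compact R n r).
    apply: (@closed_comp _ _ (@enorm R n) [set t | N0%:R + 1 <= t]); last exact: closed_ge.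
    by move=> x _; exact: enorm_continuous.
  have ca : {within K, continuous a}.
    apply: continuous_in_subspaceT => x /set_mem[xN _].
    have xO : (~` closure (@eball R n N0%:R)) x by move=> /closure_eball /=; lra.
    have gi i : {for x, continuous (fun y => grad g y 0 i)}.
      rewrite (_ : (fun y => _) = pd i g); last by apply/funext => y; rewrite mxE.
      exact: (g_C2 (s := [:: i]) isT).1.
    rewrite /a /dotp.
    have sumc (F : 'I_n -> E -> R) : (forall i, {for x, continuous (F i)}) ->
      {for x, continuous (fun y => \sum_(i < n) F i y)}.
      move=> cF; rewrite (_ : (fun y => _) = \sum_(i < n) F i); last first.
        by apply/funext => y; rewrite fct_sumE.
      elim/big_ind: _ => [|f1 f2 h1 h2|i _]; [exact: cst_continuous|exact: continuousD|exact: cF].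
    apply: (sumc (fun i y => mapv (A y) (grad g y) 0 i * grad g y 0 i)) => i.
    apply: continuousM => //.
    rewrite (_ : (fun y => _) = fun y => \sum_(j < n) A y i j * grad g y 0 j); last first.
      by apply/funext => y; rewrite mxE.
    apply: (sumc (fun j y => A y i j * grad g y 0 j)) => j.
    by apply: continuousM; [exact: A_cont|exact: gi].
  have [K0|/set0P/negP/negPn/eqP K0] := pselect (K !=set0).
    have [x0 /set_mem _ x0P] := EVT_max_rV K0 cK ca.
    exists (Num.max (a x0) 0); first by rewrite le_max lexx orbT.
    by move=> x h1 h2; rewrite le_max x0P ?mem_set.
  exists 0 => // x h1 h2; have : K x by [].
  by rewrite K0.
(* 9 is one half of 3 times 6: the factor 1/2 in [Lop], the 3 of [cutoff2_ge], and the maximum 6 of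
   [bump]. *)
pose z (x : E) := (9 * c) * \1_(cball r) x.
have Lz : L1 mu z by apply: L1Z; exact: L1_cball.
have z0 x : 0 <= z x by rewrite !mulr_ge0.
have [kap gkap] : exists kap, in_generator mu Pt kap (fun x => kap x - z x).
  case: sg => _ /(_ 1 z _ ltr01 ((Lfun1P mu z).2 Lz) exists_exhaustion) [w [kap [_ res _]]] _.
  exists kap; have := generator_Pt sgT cv res.
  by rewrite (_ : (fun x => 1 * kap x - z x) = fun x => kap x - z x) //; apply/funext => x; rewrite mul1r.
have Lkap : L1 mu kap by case: gkap.
have Lm (m : R) : 0 < m -> continuous (lyap g M m) /\
    exists2 r', 0 < r' & forall x, r' <= `|x| -> lyap g M m x = 0.
  move=> m0; split; first exact: lyap_continuous.
  have [r' r'0 r'P] := inf_growth g_ge0 g_inf (M + 2 + m).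
  by exists r' => // x /r'P gx; apply: cutoff_out => //; lra.
have LL (m : R) : 0 < m -> L1 mu (lyap g M m).
  move=> m0; have [cm [r' r'0 fr']] := Lm m m0.
  have := L1_continuous_cball r' cm; rewrite (_ : (fun x => _) = lyap g M m) //.
  apply/funext => x; rewrite indicE; have [_|] := boolP (x \in _); first by rewrite mulr1.
  move=> /negP; rewrite in_setE /cball /= => /negP; rewrite -ltNge => /ltW /fr' ->.
  by rewrite mul0r.
exists (fun x => expR 1 * `|kap x| + `|Pt 1 kap x|); split.
- by apply: L1D; [apply/L1Z/L1_norm|apply/L1_norm; exact: (Pt_L1 cv ltr01 Lkap)].
- by move=> x; rewrite addr_ge0 // mulr_ge0 // expR_ge0.
- by move=> m m0; split; [exact: LL|exact: (Lm m m0).1].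
- move=> m m0; have [_ [r' r'0 fr']] := Lm m m0.
  apply: (C2_lower_bound (Ck_lyap g_C2 g_cont g_le m0) r'0 fr' (LL m m0) Lz z0 gkap).
  have := ae_density rho_cont rho_gt0 rho_dens g_super; apply: filterS => x gx.
  rewrite (Lop_lyap g_C2 g_le m0) -/(a x).
  have a0 : 0 <= a x := A_pos x _.
  have [xN|xN] := ltP (enorm x) (N0%:R + 1).
    have gM : g x - M <= 0 by rewrite subr_le0 g_le.
    by rewrite cutoff1_neg // cutoff2_neg // mul0r mulr0 mul0r addr0 oppr_le0.
  have xO : (~` closure (@eball R n N0%:R)) x by move=> /closure_eball /=; lra.
  have h1 : 0 <= cutoff1 m (g x - M) * Lop A G g x.
    by apply: mulr_le0; [exact: cutoff1_le0|exact: gx].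
  have h2 := cutoff2_ge m0 (g x - M).
  have h3 : bump (g x - M) * a x <= 6 * (c * \1_(cball r) x).
    rewrite indicE; have [/set_mem xr|] := boolP (x \in _).
      by rewrite mulr1; apply: ler_pM; rewrite ?bump_ge0 ?bump_le // cP.
    move=> /negP; rewrite in_setE /cball /= => /negP; rewrite -ltNge => /ltW /rP gx3.
    by rewrite bump_out ?mul0r ?mulr0 //; lra.
  have h4 : - 3 * bump (g x - M) * a x <= cutoff2 m (g x - M) * a x by rewrite ler_wpM2r.
  by rewrite /z; lra.
Qed.

End lyapunov.

(** * The chain at integer times *)

Section recurrence.
Context {R : realType} {n : nat}.
Local Notation E := 'rV[R]_n.
Variables (mu : {measure set E -> \bar R}) (K : (E -> R) -> E -> R).

Definition bounded_measurable (f : E -> R) :=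
  measurable_fun setT f /\ exists M : R, forall x, `|f x| <= M.

Local Notation bm := bounded_measurable.

Hypothesis K_linear : forall a f g x, bm f -> bm g ->
  K (fun y => a * f y + g y) x = a * K f x + K g x.
Hypothesis K_mono : forall f g x, bm f -> bm g -> (forall x, f x <= g x) -> K f x <= K g x.
Hypothesis K_le1 : forall x, K (fun=> 1) x <= 1.
Hypothesis K_cont : forall f, bm f -> continuous (K f).
Hypothesis K_dct : forall (fk : nat -> E -> R) f x, (forall k, bm (fk k)) -> bm f ->
  (forall k x, `|fk k x| <= 1) -> (forall x, fk k x @[k --> \oo] --> f x) ->
  K (fk k) x @[k --> \oo] --> K f x.
Hypothesis Q_L1 : forall f, L1 mu f -> L1 mu (K f).
Hypothesis Q_linear : forall a f g x, L1 mu f -> L1 mu g ->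
  K (fun y => a * f y + g y) x = a * K f x + K g x.
Hypothesis Q_mono : forall f g, L1 mu f -> L1 mu g ->
  {ae mu, forall x, f x <= g x} -> forall x, K f x <= K g x.
Hypothesis Q_contract : forall f, L1 mu f -> (forall x, 0 <= f x) ->
  I1 mu (K f) <= I1 mu f.
Hypothesis ae_le : forall f g : E -> R, continuous f -> continuous g ->
  {ae mu, forall x, f x <= g x} -> forall x, f x <= g x.
Hypothesis ae_dense' : forall P : E -> Prop, {ae mu, forall x, P x} ->
  forall U, open U -> U !=set0 -> exists2 x, U x & P x.
Hypothesis L1_ball : forall r, L1 mu \1_(cball r).

Variables (g : E -> R) (M : R) (k' : E -> R).
Hypothesis k'_L1 : L1 mu k'.
Hypothesis k'_ge0 : forall x, 0 <= k' x.
Hypothesis lyap_L1 : forall m : R, 0 < m -> L1 mu (lyap g M m).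
Hypothesis lyap_super : forall m : R, 0 < m ->
  {ae mu, forall x, lyap g M m x - K (lyap g M m) x <= k' x}.

Lemma bm_cst c : bm (fun=> c).
Proof. by split => //; exists `|c|. Qed.

Lemma bm_comb a f h : bm f -> bm h -> bm (fun x => a * f x + h x).
Proof.
move=> [mf [B fB]] [mh [C hC]]; split.
  by apply: measurable_funD => //; apply: measurable_funM.
exists (`|a| * B + C) => x; apply: le_trans (ler_normD _ _) _.
by rewrite normrM lerD // ler_wpM2l.
Qed.

Lemma bmM f h : bm f -> bm h -> bm (fun x => f x * h x).
Proof.
move=> [mf [B fB]] [mh [C hC]]; split; first exact: measurable_funM.
exists (B * C) => x; rewrite normrM; exact: ler_pM.
Qed.

Lemma bm_indic (A : set E) : measurable A -> bm \1_A.
Proof.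
move=> mA; split; first exact: measurable_indic.
by exists 1 => x; rewrite indicE; case: (_ \in _); rewrite ?normr1 ?normr0.
Qed.

Lemma bm_01 (f : E -> R) : measurable_fun setT f -> (forall x, 0 <= f x <= 1) -> bm f.
Proof. by move=> mf f01; split => //; exists 1 => x; have /andP[? ?] := f01 x; rewrite ger0_norm. Qed.

Lemma K_0 x : K (fun=> 0) x = 0.
Proof.
have := @K_linear 1 (fun=> 0) (fun=> 0) x (bm_cst 0) (bm_cst 0).
rewrite (_ : (fun y => _) = (fun=> 0)); last by apply/funext => y; rewrite mulr0 addr0.
by rewrite mul1r => /eqP; rewrite -subr_eq subrr => /eqP <-.
Qed.

Lemma K_ge0 f x : bm f -> (forall x, 0 <= f x) -> 0 <= K f x.
Proof. by move=> bf f0; rewrite -(K_0 x); apply: K_mono => //; exact: bm_cst. Qed.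

Lemma K_bm f : bm f -> bm (K f).
Proof.
move=> bf; have [mf [B fB]] := bf; split; first by apply: continuous_measurable_rV; exact: K_cont.
have B0 : 0 <= B by apply: le_trans (fB 0).
have KB x : K (fun=> B) x <= B.
  rewrite (_ : (fun=> B) = fun y : E => B * 1 + 0); last by apply/funext => y; rewrite mulr1 addr0.
  have -> := K_linear B x (bm_cst 1) (bm_cst 0).
  by rewrite K_0 addr0 -[leRHS]mulr1 ler_wpM2l.
exists B => x; rewrite ler_norml; apply/andP; split.
  have := @K_linear (-1) f (fun=> 0) x bf (bm_cst 0); rewrite K_0 addr0 => E1.
  have : K (fun y => -1 * f y + 0) x <= K (fun=> B) x.
    apply: K_mono => [||y]; [exact: bm_comb (bm_cst 0)|exact: bm_cst|].
    by rewrite mulN1r addr0; have := fB y; rewrite ler_norml => /andP[+ _]; lra.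
  by rewrite E1; have := KB x; lra.
apply: le_trans (KB x); apply: K_mono => // [|y]; first exact: bm_cst.
exact: le_trans (ler_norm _) (fB y).
Qed.

Lemma K_01 (f : E -> R) x : measurable_fun setT f -> (forall x, 0 <= f x <= 1) -> 0 <= K f x <= 1.
Proof.
move=> mf f01; have bf := bm_01 mf f01; apply/andP; split.
  by apply: K_ge0 => // y; have /andP[] := f01 y.
apply: le_trans (K_le1 x); apply: K_mono => // [|y]; first exact: bm_cst.
by have /andP[] := f01 y.
Qed.

Lemma L1_bm f r : bm f -> L1 mu (fun x => f x * \1_(cball r) x).
Proof.
move=> [mf [B fB]]; apply: (L1_le _ (L1Z B (L1_ball r))).
  by apply: measurable_funM => //; apply: measurable_indic; exact: measurable_cball.
by move=> x; rewrite normrM [X in _ * X]ger0_norm // ler_wpM2r.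
Qed.

Local Notation psum := (psum K).

(** The Horner recursion peels the first term off; peeling off the last one exhibits the iterates,
    whose lower bound makes the potential diverge. *)
Lemma psum_iter N f x : L1 mu f -> psum N.+1 f x = psum N f x + iter N K f x.
Proof.
have Lit j : L1 mu f -> L1 mu (iter j K f) by move=> Lf; elim: j => //= j IH; exact: Q_L1.
move=> Lf; elim: N x => [|N IH] x /=.
  by rewrite (Q0 Q_linear) addr0 add0r.
rewrite -[X in f x + K X x]/(psum N.+1 f).
rewrite (_ : psum N.+1 f = fun y => 1 * psum N f y + iter N K f y); last first.
  by apply/funext => y; rewrite mul1r IH.
rewrite Q_linear ?mul1r; [by rewrite addrA|exact: (psum_L1 Q_L1)|exact: Lit].
Qed.

Lemma lyap_iter (m : R) N : 0 < m ->
  {ae mu, forall x, lyap g M m x <= iter N K (lyap g M m) x + psum N k' x}.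
Proof.
move=> m0; have Lm := lyap_L1 m0.
have Lit j : L1 mu (iter j K (lyap g M m)) by elim: j => //= j IH; exact: Q_L1.
elim: N => [|N IH]; first by apply: nearW => x; rewrite addr0.
apply: filterS (lyap_super m0) => x h /=.
have Lp := psum_L1 Q_L1 N k'_L1.
have Ls : L1 mu (fun x => 1 * iter N K (lyap g M m) x + psum N k' x).
  by apply: L1D => //; exact: L1Z.
have := Q_mono Lm Ls _ x; rewrite Q_linear // mul1r => H.
have : K (lyap g M m) x <= K (iter N K (lyap g M m)) x + K (psum N k') x.
  by apply: H; apply: filterS IH => y; rewrite mul1r.
lra.
Qed.

Lemma lyap_unbounded x C : exists k : nat, C < lyap g M k.+1%:R x.
Proof.
set t := tau (g x - M); have t0 : 0 <= t := tau_ge0 _.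
(* If [m > 2 t], the inner factor is at least 1/2 and its cube at least 1/8; then [m > 8 C] gives a
   value above [C]. *)
pose B := Num.max (8 * C) (2 * t).
have B0 : 0 <= B by rewrite le_max; apply/orP; right; rewrite mulr_ge0.
exists (Num.bound B); rewrite /lyap /cutoff -/t.
set m : R := _.+1%:R.
have mB : B < m by apply: lt_trans (archi_boundP B0) _; rewrite ltr_nat.
have [h1 h2] : 8 * C < m /\ 2 * t < m.
  by move: mB; rewrite gt_max => /andP[].
have m0 : 0 < m by [].
have h : 2^-1 <= pos (1 - m^-1 * t).
  apply: (@le_trans _ _ (1 - m^-1 * t)); last by rewrite le_max lexx.
  have : m^-1 * t <= 2^-1 by rewrite mulrC ler_pdivrMr //; lra.
  move: (m^-1 * t) => y y2; have : 2^-1 + 2^-1 = 1 :> R by field.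
  lra.
have h3 : 2^-1 ^+ 3 <= pos (1 - m^-1 * t) ^+ 3 by apply: lerXn2r; rewrite ?nnegrE ?pos_ge0.
have h4 : m * 2^-1 ^+ 3 <= m * pos (1 - m^-1 * t) ^+ 3 by rewrite ler_wpM2l // ltW.
by apply: lt_le_trans h4; rewrite !exprS expr0; lra.
Qed.

(** Cutting [u - K u] to balls makes it integrable, so that the comparison of potentials applies,
    with [k'] or with some Lyapunov function of integer index. Integer indices leave only countably
    many null sets. *)
Lemma superharmonic_harmonic (u : E -> R) : measurable_fun setT u -> (forall x, 0 <= u x <= 1) ->
  (forall x, K u x <= u x) -> {ae mu, forall x, K u x = u x}.
Proof.
move=> mu_ u01 Ku; have bu := bm_01 mu_ u01.
have bKu : bm (fun x => -1 * K u x + u x) by apply: bm_comb => //; exact: K_bm.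
pose v (r : nat) x := (-1 * K u x + u x) * \1_(cball r%:R) x.
have Lv r : L1 mu (v r) by exact: L1_bm.
have v0 r x : 0 <= v r x.
  by rewrite mulr_ge0 // mulN1r addrC subr_ge0.
have vle r x : v r x <= u x - K u x.
  rewrite /v mulN1r addrC indicE; case: (_ \in _); rewrite ?mulr1 ?mulr0 //.
  by rewrite subr_ge0.
(* Telescoping: [v + K (psum N v) <= (u - K u) + K u]. *)
have psum_le r N : forall x, 0 <= psum N (v r) x <= u x.
  elim: N => [|N IH] x /=; first by rewrite lexx; have /andP[] := u01 x.
  have bp : bm (psum N (v r)).
    apply: bm_01; first exact: L1_measurable (psum_L1 Q_L1 N (Lv r)).
    move=> y; have /andP[-> h] := IH y; apply: le_trans h _; by have /andP[] := u01 y.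
  rewrite addr_ge0 ?K_ge0 //=; last by move=> y; have /andP[] := IH y.
  have : K (psum N (v r)) x <= K u x by apply: K_mono => // y; have /andP[] := IH y.
  have := vle r x; lra.
have psum1 r N x : psum N (v r) x <= 1.
  by have /andP[_ h] := psum_le r N x; apply: le_trans h _; have /andP[] := u01 x.
have BP f (Lf : L1 mu f) f0 r := bounded_potential_vanishes Q_L1 Q_linear Q_mono Q_contract
  Lf (Lv r) f0 (v0 r) (fun N x => psum1 r N x).
have lyap0 (k : nat) x : 0 <= lyap g M k.+1%:R x by apply: cutoff_ge0.
have v_eq0 r : {ae mu, forall x, v r x = 0}.
  have A1 := BP k' k'_L1 k'_ge0 r.
  have A2 : {ae mu, forall x, forall k : nat,
      (forall C, exists N, C < psum N (lyap g M k.+1%:R) x) -> v r x = 0}.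
    by apply/ae_foralln => k; exact: BP (lyap_L1 (ltr0Sn _ _)) (lyap0 k) r.
  have A3 : {ae mu, forall x, forall k N : nat,
      lyap g M k.+1%:R x <= iter N K (lyap g M k.+1%:R) x + psum N k' x}.
    by apply/ae_foralln => k; apply/ae_foralln => N; exact: lyap_iter.
  apply: filterS3 A1 A2 A3 => x a1 a2 a3; apply: contrapT => vx.
  (* Assume [v] nonzero at [x]: then the potential of [k'] is bounded at [x], and the Lyapunov
     function chosen next has all its iterates at least 1 there. *)
  have [C Cb] : exists C, forall N, psum N k' x <= C.
    apply: contrapT => H; apply: vx; apply: a1 => C; apply: contrapT => H'; apply: H.
    by exists C => N; rewrite leNgt; apply/negP => h; apply: H'; exists N.
  have [k Ck] := lyap_unbounded x (C + 1).
  set f := lyap g M k.+1%:R in Ck.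
  apply: vx; apply: (a2 k) => D; apply: contrapT => HD.
  have Db N : psum N f x <= D by rewrite leNgt; apply/negP => h; apply: HD; exists N.
  have it N : 1 <= iter N K f x by have := a3 k N; have := Cb N; rewrite -/f; lra.
  have pN N : N%:R <= psum N f x.
    elim: N => // N IH; rewrite psum_iter; last exact: lyap_L1.
    by rewrite -natr1 lerD.
  have := pN (Num.bound D); have := Db (Num.bound D).
  have D0 : 0 <= D by apply: le_trans (Db 0%N).
  have := archi_boundP D0; lra.
have : {ae mu, forall x, forall r, v r x = 0} by exact/ae_foralln.
apply: filterS => x /(_ (Num.bound `|x|)).
rewrite /v indicE mem_set; last by rewrite /cball /=; apply: ltW; exact: archi_boundP.
by rewrite mulr1 mulN1r addrC => /eqP; rewrite subr_eq0 => /eqP.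
Qed.

(** [Q_mono] applies to integrable functions only. It gives [K] of the indicator of a null set [N]
    as at most 0 everywhere; bounded functions that agree off [N] are then compared by adding a
    multiple of this indicator. *)
Lemma K_ae_eq f h : bm f -> bm h -> {ae mu, forall x, f x = h x} -> forall x, K f x = K h x.
Proof.
move=> bf bh [N [mN N0 sN]] x.
have LN : L1 mu \1_N.
  apply/integrableP; split; first exact/measurable_EFinP/measurable_indic.
  rewrite (eq_integral (fun x => (\1_N x)%:E)) ?integral_indic ?setIT ?N0 //.
  by move=> y _ /=; rewrite ger0_norm.
have KN y : K \1_N y <= 0.
  rewrite -(Q0 Q_linear y); apply: Q_mono => //; first exact: L1_0.
  exists N; split => // z /= hz; apply: contrapT => nz; apply: hz.
  by rewrite indicE memNset.
have le f1 h1 : bm f1 -> bm h1 -> (forall x, ~ N x -> f1 x = h1 x) -> K f1 x <= K h1 x.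
  move=> b1 b2 e1; have [_ [B1 B1P]] := b1; have [_ [B2 B2P]] := b2.
  have B0 : 0 <= B1 + B2.
    by apply: addr_ge0; [apply: le_trans (B1P 0)|apply: le_trans (B2P 0)].
  have bN := bm_indic mN.
  have : K f1 x <= K (fun y => (B1 + B2) * \1_N y + h1 y) x.
    apply: K_mono => [//||y]; first exact: bm_comb.
    rewrite indicE; have [_|ny] := boolP (y \in N).
      have := B1P y; have := B2P y; rewrite !ler_norml => /andP[? ?] /andP[? ?].
      by rewrite mulr1; lra.
    rewrite mulr0 add0r e1 // => Ny; move: ny; by rewrite mem_set.
  by rewrite K_linear //; have := KN x; nra.
have eN y : ~ N y -> f y = h y by move=> nN; apply: contrapT => hy; apply: nN; exact: sN.
by apply/eqP; rewrite eq_le !le // => y ny; rewrite eN.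
Qed.

Lemma conservative x : K (fun=> 1) x = 1.
Proof.
have H := superharmonic_harmonic (u := fun=> 1) (measurable_cst _).
have {}H := H (fun x => ltac:(by rewrite ler01 lexx)) K_le1.
by apply: (ae_eq_continuous ae_le (f := K (fun=> 1)) (g := fun=> 1)) => //;
  [exact: K_cont (bm_cst 1)|move=> y; exact: cst_continuous].
Qed.

(** * The probability of avoiding [U] *)

Variable U : set E.
Hypothesis U_open : open U.
Hypothesis U_nonempty : U !=set0.

(* [avoid N x] is the probability of avoiding [U] at the times [1, ..., N]. *)
Fixpoint avoid (N : nat) : E -> R :=
  if N is N'.+1 then K (fun x => \1_(~` U) x * avoid N' x) else fun=> 1.

Let mU : measurable (~` U).
Proof. by apply: measurableC; exact: sub_sigma_algebra. Qed.

Lemma avoid_01 N : measurable_fun setT (avoid N) /\ forall x, 0 <= avoid N x <= 1.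
Proof.
elim: N => [|N [mN N01]] /=; first by split => // x; rewrite ler01 lexx.
have b : bm (fun x => \1_(~` U) x * avoid N x).
  by apply: bmM; [exact: bm_indic|exact: bm_01].
split; first exact: (K_bm b).1.
move=> x; apply: K_01 => [|y]; first exact: b.1.
rewrite indicE; case: (_ \in _); rewrite ?mul1r ?mul0r //.
by rewrite lexx ler01.
Qed.

Let b_step N : bm (fun x => \1_(~` U) x * avoid N x).
Proof.
by have [mN N01] := avoid_01 N; apply: bmM; [exact: bm_indic|exact: bm_01].
Qed.

Lemma avoid_nonincr x : nonincreasing_seq (avoid ^~ x).
Proof.
apply/nonincreasing_seqP => N; elim: N x => [|N IH] x.
  by have [_ /(_ x) /andP[]] := avoid_01 1.
apply: (K_mono (f := fun y => \1_(~` U) y * avoid N.+1 y)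
  (g := fun y => \1_(~` U) y * avoid N y)); [exact: b_step N.+1|exact: b_step|move=> y].
by rewrite ler_wpM2l.
Qed.

Definition avoid_all x := limn (avoid ^~ x).

Lemma avoid_cvg x : avoid N x @[N --> \oo] --> avoid_all x.
Proof.
apply: nonincreasing_is_cvgn; first exact: avoid_nonincr.
by exists 0 => _ [N _ <-]; have [_ /(_ x) /andP[]] := avoid_01 N.
Qed.

Lemma avoid_all_01 x : 0 <= avoid_all x <= 1.
Proof.
have h N : 0 <= avoid N x <= 1 by exact: (avoid_01 N).2.
apply/andP; split.
  by apply: (@cvgr_to_ge _ _ _ _ _ _ _ (@avoid_cvg x)); apply: nearW => N; have /andP[] := h N.
by apply: (@cvgr_to_le _ _ _ _ _ _ _ (@avoid_cvg x)); apply: nearW => N; have /andP[] := h N.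
Qed.

Lemma avoid_all_measurable : measurable_fun setT avoid_all.
Proof.
apply: (measurable_fun_cvg (h := avoid)) => [N|x _]; first exact: (avoid_01 N).1.
exact: avoid_cvg.
Qed.

Let s x := \1_(~` U) x * avoid_all x.

Let s_01 x : 0 <= s x <= 1.
Proof.
rewrite /s indicE; case: (_ \in _); rewrite ?mul1r ?mul0r ?avoid_all_01 //.
by rewrite lexx ler01.
Qed.

Let s_meas : measurable_fun setT s.
Proof. by apply: measurable_funM; [exact: measurable_indic|exact: avoid_all_measurable]. Qed.

Let bs : bm s. Proof. exact: bm_01. Qed.
Let bw : bm avoid_all. Proof. by apply: bm_01; [exact: avoid_all_measurable|exact: avoid_all_01]. Qed.

Lemma K_avoid_step x : K s x = avoid_all x.
Proof.
have H : K (fun y => \1_(~` U) y * avoid N y) x @[N --> \oo] --> K s x.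
  apply: (K_dct (fk := fun N y => \1_(~` U) y * avoid N y)) => // [N y|y].
    have /andP[h0 h1] := (avoid_01 N).2 y.
    rewrite indicE; case: (_ \in _); rewrite ?mul1r ?mul0r ?normr0 //.
    by rewrite ger0_norm.
  by apply: cvgMr; exact: avoid_cvg.
have H' : avoid N.+1 x @[N --> \oo] --> avoid_all x by rewrite (cvg_shiftS (avoid ^~ x)); exact: avoid_cvg.
exact: cvg_unique H H'.
Qed.

(** Since [K s = avoid_all >= s] and [K 1 = 1], the function [1 - s] is superharmonic, hence
    harmonic a.e. *)
Lemma avoid_all_ae : {ae mu, forall x, s x = avoid_all x}.
Proof.
pose u x := -1 * s x + 1.
have bu : bm u by apply: bm_comb => //; exact: bm_cst.
have Ku y : K u y = -1 * avoid_all y + 1.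
  by rewrite /u K_linear ?K_avoid_step ?conservative //; exact: bm_cst.
have sw y : s y <= avoid_all y.
  rewrite /s indicE; have /andP[h0 _] := avoid_all_01 y.
  by case: (_ \in _); rewrite ?mul1r ?mul0r.
have : {ae mu, forall y, K u y = u y}.
  apply: superharmonic_harmonic; first exact: bu.1.
    by move=> y; have /andP[? ?] := s_01 y; rewrite /u; apply/andP; split; lra.
  by move=> y; rewrite Ku /u; have := sw y; lra.
by apply: filterS => y; rewrite Ku /u; lra.
Qed.

Lemma avoid_all_harmonic x : K avoid_all x = avoid_all x.
Proof.
rewrite -[RHS]K_avoid_step; apply: K_ae_eq => //.
by apply: filterS avoid_all_ae => y ->.
Qed.

Lemma avoid_all_continuous : continuous avoid_all.
Proof.
rewrite (_ : avoid_all = K avoid_all); first exact: K_cont.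
by apply/funext => x; rewrite avoid_all_harmonic.
Qed.

(** On [U] the function [s] vanishes and equals [avoid_all] a.e.; if the continuous [avoid_all] were
    positive at [x], it would be so on an open subset of [U]. *)
Lemma avoid_all_U x : U x -> avoid_all x = 0.
Proof.
move=> Ux; apply/eqP; rewrite eq_le; have /andP[-> _] := avoid_all_01 x; rewrite andbT.
rewrite leNgt; apply/negP => w0.
pose V := U `&` [set y | 0 < avoid_all y].
have oV : open V.
  apply: openI => //; apply: (@open_comp _ _ avoid_all [set t | 0 < t]); last exact: open_gt.
  by move=> y _; exact: avoid_all_continuous.
have [y] : exists2 y, V y & s y = avoid_all y.
  by apply: ae_dense' => //; [exact: avoid_all_ae|exists x].
move=> [Uy /= wy]; rewrite /s indicE memNset ?mul0r; last by move=> /(_ Uy).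
by move=> E0; rewrite -E0 ltxx in wy.
Qed.

(* The truncations [min(k w, 1)] are superharmonic, hence harmonic and
   continuous, and increase to the indicator of [w > 0]; that indicator is thus
   harmonic, hence continuous, hence constant. *)
Lemma avoid_all_eq0 x : avoid_all x = 0.
Proof.
pose u (k : nat) y := Num.min (k%:R * avoid_all y) 1.
have w0 y : 0 <= avoid_all y by have /andP[] := avoid_all_01 y.
have u01 k y : 0 <= u k y <= 1.
  by rewrite /u le_min ler01 ge_min lexx orbT !andbT mulr_ge0.
have um k : measurable_fun setT (u k).
  apply: measurable_minr => //; apply: measurable_funM => //; exact: avoid_all_measurable.
have bu k : bm (u k) by exact: bm_01.
have bk k : bm (fun y => k%:R * avoid_all y + 0) by apply: bm_comb => //; exact: bm_cst.
have uK k y : K (u k) y = u k y.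
  apply: (ae_eq_continuous ae_le (f := K (u k)) (g := u k)); first exact: K_cont.
    have -> : u k = fun y => Num.min (k%:R * avoid_all y) 1 by [].
    move=> z; apply: (@continuous_min _ _ (fun y => k%:R * avoid_all y) (fun=> 1)).
      by apply: (@continuousM _ _ (fun=> k%:R)); [exact: cst_continuous|exact: avoid_all_continuous].
    exact: cst_continuous.
  apply: superharmonic_harmonic => // z; rewrite {2}/u le_min; apply/andP; split.
    apply: (@le_trans _ _ (K (fun y => k%:R * avoid_all y + 0) z)).
      by apply: K_mono => // t; rewrite addr0 /u ge_min lexx.
    by rewrite K_linear ?K_0 ?avoid_all_harmonic ?addr0 //; exact: bm_cst.
  by have /andP[] := K_01 z (um k) (u01 k).
pose P := [set y | 0 < avoid_all y].
have mP : measurable P.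
  rewrite -[X in measurable X]setTI (_ : P = avoid_all @^-1` `]0, +oo[).
    by apply: avoid_all_measurable => //; exact: measurable_itv.
  by apply/seteqP; split => y /=; rewrite in_itv /= andbT.
have cu y : u k y @[k --> \oo] --> (\1_P y : R).
  apply: cvg_near_cst; near=> k; rewrite /u indicE.
  have [wy|wy] := ltP 0 (avoid_all y); last first.
    have -> : avoid_all y = 0 by apply/eqP; rewrite eq_le wy w0.
    by rewrite mulr0 min_l // memNset //; rewrite /P /= => h; rewrite ltNge wy in h.
  rewrite mem_set // min_r // -ler_pdivrMr // mul1r; apply: ltW.
  apply: lt_le_trans (archi_boundP _) _; first by rewrite invr_ge0.
  by rewrite ler_nat; near: k; exact: nbhs_infty_ge.
have KP y : K \1_P y = \1_P y.
  have h : K (u k) y @[k --> \oo] --> K \1_P y.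
    apply: (K_dct (fk := u)) => //; first exact: bm_indic.
    by move=> k z; have /andP[? ?] := u01 k z; rewrite ger0_norm.
  by move: h; under eq_fun do rewrite uK; move=> h; exact: (cvg_unique _ h (cu y)).
have cP : continuous (\1_P : E -> R).
  by rewrite (_ : \1_P = K \1_P); [exact: K_cont (bm_indic mP)|apply/funext => y; rewrite KP].
have [y0 Uy0] := U_nonempty.
have Py0 : \1_P y0 = 0 :> R.
  by rewrite indicE memNset // /P /= avoid_all_U // ltxx.
apply: contrapT => wx.
have Px : \1_P x = 1 :> R.
  by rewrite indicE mem_set // /P /= lt_def w0 andbT; apply/eqP.
(* Connectedness enters as the intermediate value theorem along the segment from [y0] to [x]: a
   continuous indicator cannot take the value 1/2. *)
pose l (t : R) : R := \1_P (t *: (x - y0) + y0).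
have cl : continuous l.
  move=> t; apply: (@continuous_comp _ _ _ (fun t : R => t *: (x - y0) + y0) (\1_P : E -> R)); last exact: cP.
  by apply: continuousD; [exact: scalel_continuous|exact: cst_continuous].
have [|t _] := @IVT R l 0 1 (1 / 2) ler01 (continuous_subspaceT cl).
  rewrite /l scale0r add0r Py0 scale1r subrK Px.
  by rewrite min_l // max_r //; apply/andP; split; lra.
rewrite /l indicE; case: (_ \in _) => /=; lra.
Unshelve. all: by end_near. Qed.

End recurrence.

(** * From the chain to the process *)

Section process.
Context {R : realType} {n : nat}.
Local Notation E := 'rV[R]_n.
Local Notation S := (one_point_compactification 'rV[R]_n).

Lemma measurable_some (D : set E) : measurable D -> measurable (Some @` D : set S).
Proof.
have mE : measurable (Some @` [set: E] : set S).
  by apply: sub_sigma_algebra; apply: one_point_compactification_open_some; exact: openT.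
suff H : <<s @open E >> `<=` [set D : set E | measurable (Some @` D : set S)] by exact: H.
apply: smallest_sub.
  split => [|B mB|F mF].
  - by rewrite /= image_set0.
  - rewrite /= (_ : Some @` (setT `\` B) = Some @` setT `\` (Some @` B)); first exact: measurableD.
    apply/seteqP; split => [_ [x [_ nBx] <-]|_ [[x _ <-] nB]].
      by split; [exists x|move=> [y By [yx]]; apply: nBx; rewrite -yx].
    by exists x => //; split => // Bx; apply: nB; exists x.
  - by rewrite /= image_bigcup; exact: bigcupT_measurable.
by move=> U oU; apply: sub_sigma_algebra; exact: one_point_compactification_open_some.
Qed.

Lemma measurable_none : measurable ([set None] : set S).
Proof.
rewrite (_ : [set None] = ~` (Some @` [set: E])).
  by apply: measurableC; apply: measurable_some.
by apply/seteqP; split => [_ -> [x _]|[x|//] h] //; case: h; exists x.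
Qed.

Lemma measurable_oapp (f : E -> R) : measurable_fun setT f ->
  measurable_fun setT (fun s : S => oapp f 0 s).
Proof.
move=> mf _ B mB; rewrite setTI.
have mfB : measurable (f @^-1` B) by rewrite -[X in measurable X]setTI; exact: mf.
have [B0|B0] := pselect (B 0).
  rewrite (_ : _ @^-1` _ = (Some @` (f @^-1` B)) `|` [set None]).
    by apply: measurableU; [exact: measurable_some|exact: measurable_none].
  apply/seteqP; split => [[x|] /= h|_ [[x /= h <-]|->]] //; first by left; exists x.
  by right.
rewrite (_ : _ @^-1` _ = Some @` (f @^-1` B)); first exact: measurable_some.
by apply/seteqP; split => [[x|] /= h|_ [x /= h <-]] //; exists x.
Qed.

Context {d' : measure_display} {Om : measurableType d'}.
Variables (F : R -> set (set Om)) (X : R -> Om -> S) (P : S -> probability Om R).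
Variable Pt : R -> (E -> R) -> E -> R.
Hypothesis hunt : Hunt_process F X P.
Hypothesis tr : has_transition X P Pt.
Hypothesis K_cont : forall f, bounded_measurable f -> continuous (Pt 1 f).

Local Notation bm := bounded_measurable.
Local Notation K := (Pt 1).

Lemma X_measurable t : 0 <= t -> measurable_fun setT (X t).
Proof.
move=> t0 _ B mB; rewrite setTI.
by have [_] := hunt_filtration hunt t0; apply; exact: (hunt_adapted hunt t0 mB).
Qed.

Lemma F_measurable t B : 0 <= t -> F t B -> measurable B.
Proof. by move=> t0; have [_] := hunt_filtration hunt t0; apply. Qed.

Lemma L1_prob s (h : Om -> R) (C : R) : measurable_fun setT h -> (forall w, `|h w| <= C) -> L1 (P s) h.
Proof.
move=> mh hC; apply: measurable_bounded_integrable => //.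
  by apply: le_lt_trans (probability_le1 _ _) _ => //; exact: ltry.
exists C; split; first exact: num_real.
by move=> D CD w _ /=; exact: le_trans (hC w) (ltW CD).
Qed.

Lemma oapp_measurable t (f : E -> R) : 0 <= t -> measurable_fun setT f ->
  measurable_fun setT (fun w => oapp f 0 (X t w)).
Proof.
by move=> t0 mf; apply: (measurableT_comp (measurable_oapp mf)); exact: X_measurable.
Qed.

Lemma oapp_le (f : E -> R) C : (forall x, `|f x| <= C) -> forall s : S, `|oapp f 0 s| <= C.
Proof. by move=> fC [x|] /=; [exact: fC|rewrite normr0; apply: le_trans (fC 0)]. Qed.

Lemma oapp_L1 s t (f : E -> R) : 0 <= t -> bm f -> L1 (P s) (fun w => oapp f 0 (X t w)).
Proof.
move=> t0 [mf [C fC]]; apply: (L1_prob _ (C := C)); first exact: oapp_measurable.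
by move=> w; exact: oapp_le.
Qed.

Lemma Pt_expectation t f x : 0 <= t -> bm f ->
  Pt t f x = I1 (P (Some x)) (fun w => oapp f 0 (X t w)).
Proof.
by move=> t0 [mf fC]; have := tr x t0 mf fC; rewrite unlock => /(congr1 fine).
Qed.

Lemma oapp_comb a (f g : E -> R) (s : S) :
  oapp (fun y => a * f y + g y) 0 s = a * oapp f 0 s + oapp g 0 s.
Proof. by case: s => //=; rewrite mulr0 addr0. Qed.

Lemma kernel_linear a f g x : bm f -> bm g -> K (fun y => a * f y + g y) x = a * K f x + K g x.
Proof.
move=> bf bg; rewrite !Pt_expectation ?ler01 //; last exact: bm_comb.
have Lf := oapp_L1 (Some x) ler01 bf; have Lg := oapp_L1 (Some x) ler01 bg.
rewrite -I1Z // -I1D //; last exact: L1Z.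
by congr (I1 _ _); apply/funext => w; rewrite oapp_comb.
Qed.

Lemma kernel_mono f g x : bm f -> bm g -> (forall x, f x <= g x) -> K f x <= K g x.
Proof.
move=> bf bg fg; rewrite !Pt_expectation ?ler01 //.
apply: le_I1; [exact: oapp_L1|exact: oapp_L1|].
by move=> w; case: (X 1 w).
Qed.

Lemma I1_prob_cst s (c : R) : I1 (P s) (fun=> c) = c.
Proof.
rewrite /I1 Rintegral_cst // -[RHS]mulr1; congr (_ * _).
exact: (congr1 fine (probability_setT (P s))).
Qed.

Lemma kernel_le1 x : K (fun=> 1) x <= 1.
Proof.
rewrite Pt_expectation ?ler01 //; last exact: bm_cst.
rewrite -[leRHS](I1_prob_cst (Some x)); apply: le_I1.
- by apply: oapp_L1 => //; exact: bm_cst.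
- by apply: (L1_prob _ (C := 1)) => // w; rewrite normr1.
- by move=> w; case: (X 1 w) => [y|] /=.
Qed.

Lemma I1_dct s (hk : nat -> Om -> R) h (C : R) : (forall k, measurable_fun setT (hk k)) ->
  (forall k w, `|hk k w| <= C) -> (forall w, hk k w @[k --> \oo] --> h w) ->
  I1 (P s) (hk k) @[k --> \oo] --> I1 (P s) h.
Proof.
move=> mh hC hh.
have C0 : 0 <= C.
  have [w _] : [set: Om] !=set0.
    by apply/set0P/negP => /eqP T0; have := probability_setT (P s); rewrite T0 measure0 => /eqP; rewrite eq_sym onee_eq0.
  by apply: le_trans (hC 0%N w).
have H := @dominated_cvg _ _ _ (P s) _ measurableT (fun k w => (hk k w)%:E) (fun w => (h w)%:E)
  (fun=> C%:E) (fun k => (measurable_EFinP _ _).2 (mh k)).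
have Lc : L1 (P s) (fun=> C) by apply: (L1_prob _ (C := C)) => // w; rewrite ger0_norm.
have mhl : measurable_fun setT h by apply: (measurable_fun_cvg (h := hk)) => // w _; exact: hh.
have Lh : L1 (P s) h.
  apply: (L1_prob _ (C := C)) => // w.
  have hn : `|hk k w| @[k --> \oo] --> `|h w| by apply: cvg_norm; exact: hh.
  by apply: (@cvgr_to_le _ _ _ _ _ _ _ hn); exact: nearW.
have {}H : (\int[P s]_w (hk k w)%:E @[k --> \oo] --> \int[P s]_w (h w)%:E)%E.
  apply: H => //.
  - by move=> w _; apply: cvg_EFin; [exact: nearW|exact: hh].
  - by move=> k w _; rewrite /= lee_fin.
have Hf : (\int[P s]_w (h w)%:E)%E = (I1 (P s) h)%:E by rewrite /I1 /Rintegral fineK // integrable_fin_num.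
by move: H; rewrite Hf => /fine_cvg.
Qed.

Lemma kernel_dct (fk : nat -> E -> R) f x : (forall k, bm (fk k)) -> bm f ->
  (forall k x, `|fk k x| <= 1) -> (forall x, fk k x @[k --> \oo] --> f x) ->
  K (fk k) x @[k --> \oo] --> K f x.
Proof.
move=> bk bf f1 ff; rewrite Pt_expectation ?ler01 //.
rewrite (_ : (fun k => _) = fun k => I1 (P (Some x)) (fun w => oapp (fk k) 0 (X 1 w))); last first.
  by apply/funext => k; rewrite Pt_expectation ?ler01.
apply: (I1_dct (C := 1)).
- by move=> k; apply: oapp_measurable => //; exact: (bk k).1.
- by move=> k w; exact: oapp_le.
- by move=> w; case: (X 1 w) => [y|] /=; [exact: ff|exact: cvg_cst].
Qed.

(** Under [P None] the path starts at the cemetery almost surely, so its lifetime is 0 and it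
    remains there. *)
Lemma cemetery_absorbing : P None (X 1 @^-1` (Some @` [set: E])) = 0%E.
Proof.
have mN : measurable (X 0 @^-1` [set None]).
  by rewrite -[X in measurable X]setTI; apply: X_measurable => //; exact: measurable_none.
have := hunt_normal hunt None; rewrite -[X in P None X]/(X 0 @^-1` [set None]) => H0.
apply/eqP; rewrite -measure_le0.
have H1 : P None (~` (X 0 @^-1` [set None])) = 0%E by rewrite probability_setC // H0 subee.
rewrite -H1; apply: le_measure; rewrite ?inE.
- by rewrite -[X in measurable X]setTI; apply: X_measurable => //; apply: measurable_some.
- exact: measurableC.
move=> w /= [y _ yX] X0.
have lt0 : (lifetime X w <= 0)%E.
  by apply: ereal_inf_lbound; exists 0 => //; split.
by have := hunt_cemetery hunt ler01 (le_trans lt0 _); rewrite -yX lee_fin ler01 => /(_ isT).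
Qed.

Lemma F_mono s t B : 0 <= s -> s <= t -> F s B -> F t B.
Proof.
move=> s0; rewrite le_eqVlt => /predU1P[->//|st].
by rewrite (hunt_right_continuous_filtration hunt s0) => /(_ t st).
Qed.

Lemma F_set0 t : 0 <= t -> F t set0.
Proof. by move=> t0; have [[]] := hunt_filtration hunt t0. Qed.

Lemma F_setT t : 0 <= t -> F t setT.
Proof.
move=> t0; have [[h0 hC _] _] := hunt_filtration hunt t0.
by have := hC _ h0; rewrite setD0.
Qed.

Lemma F_setI t A B : 0 <= t -> F t A -> F t B -> F t (A `&` B).
Proof.
move=> t0 FA FB; have [sF _] := hunt_filtration hunt t0.
have E1 := sigma_algebra_id sF; rewrite -E1 in FA FB *.
exact: (@measurableI _ (g_sigma_algebraType (F t)) A B FA FB).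
Qed.

Lemma preX_measurable t (D : set S) : 0 <= t -> measurable D -> measurable (X t @^-1` D).
Proof. by move=> t0 mD; rewrite -[X in measurable X]setTI; exact: X_measurable. Qed.

Lemma oapp_indic (V : set E) (s : S) : oapp (\1_V : E -> R) 0 s = \1_(Some @` V) s.
Proof.
case: s => [y|] /=; rewrite !indicE.
  congr (_%:R); congr nat_of_bool; apply/idP/idP => /set_mem h; apply/mem_set.
    by exists y.
  by case: h => z Vz [<-].
by rewrite memNset // => -[].
Qed.

Lemma I1_indic_prob s (A : set Om) : measurable A -> (I1 (P s) \1_A)%:E = P s A.
Proof.
move=> mA; rewrite /I1 /Rintegral integral_indic // setIT fineK //.
by rewrite fin_numElt (lt_le_trans _ (measure_ge0 _ _)) //= (le_lt_trans (probability_le1 _ mA)) // ltry.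
Qed.

Lemma kernel_indic (V : set E) (s : S) : measurable V ->
  P s (X 1 @^-1` (Some @` V)) = (oapp (K \1_V) 0 s)%:E.
Proof.
move=> mV; have mX := preX_measurable ler01 (measurable_some mV).
case: s => [y|] /=.
  rewrite Pt_expectation ?ler01 //; last exact: bm_indic.
  rewrite -I1_indic_prob //; congr (I1 _ _)%:E; apply/funext => w.
  by rewrite oapp_indic !indicE.
apply/eqP; rewrite -measure_le0 -cemetery_absorbing; apply: le_measure; rewrite ?inE //.
  exact: preX_measurable (measurable_some measurableT).
by move=> w [y Vy yX]; exists y.
Qed.

(** The strong Markov property at the constant stopping time [m], with [B] a prior event. Extending
    [K] by 0 at the cemetery is legitimate by [cemetery_absorbing]. *)
Lemma markov_indic x (m : nat) (B : set Om) (V : set E) : F m%:R B -> measurable V ->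
  I1 (P (Some x)) (fun w => \1_B w * oapp (\1_V : E -> R) 0 (X m.+1%:R w)) =
  I1 (P (Some x)) (fun w => \1_B w * oapp (K \1_V) 0 (X m%:R w)).
Proof.
move=> FB mV.
have m0 : 0 <= m%:R :> R by [].
have mB := F_measurable m0 FB.
pose tau (w : Om) : \bar R := (m%:R)%:E.
have st : stopping_time F tau.
  split=> [w|t t0]; first by rewrite lee_fin.
  have [mt|tm] := leP (m%:R : R) t.
    rewrite (_ : mkset _ = setT); first exact: F_setT.
    by apply/seteqP; split => // w _; rewrite /= lee_fin.
  rewrite (_ : mkset _ = set0); first exact: F_set0.
  by apply/seteqP; split => // w; rewrite /= lee_fin leNgt tm.
have pe : prior_event F tau B.
  split=> // t t0; have [mt|tm] := leP (m%:R : R) t.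
    rewrite (_ : _ `&` _ = B); first exact: F_mono FB.
    by apply/seteqP; split => [w []|w Bw] //; split => //=; rewrite lee_fin.
  rewrite (_ : _ `&` _ = set0); first exact: F_set0.
  by apply/seteqP; split => // w [_]; rewrite /= lee_fin leNgt tm.
have SM := hunt_strong_Markov hunt (Some x) st pe ler01 (measurable_some mV).
have tT : [set w | (tau w < +oo)%E] = setT by apply/seteqP; split => // w _; rewrite /= ltry.
rewrite tT setIT in SM.
have stE s : stopped X tau s = X (m%:R + s) by [].
have m1 : m%:R + 1 = m.+1%:R :> R by rewrite natr1.
have mX : measurable (X m.+1%:R @^-1` (Some @` V)) by apply: preX_measurable => //; exact: measurable_some.
have bK := K_bm kernel_linear kernel_mono kernel_le1 K_cont (bm_indic mV).
have -> : (fun w => \1_B w * oapp (\1_V : E -> R) 0 (X m.+1%:R w)) =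
  \1_(B `&` (X m.+1%:R @^-1` (Some @` V))).
  apply/funext => w; rewrite oapp_indic !indicE in_setI -natrM mulnb.
  have -> // : (w \in X m.+1%:R @^-1` (Some @` V)) = (X m.+1%:R w \in Some @` V).
  by apply/idP/idP => /set_mem h; exact/mem_set.
apply: EFin_inj; rewrite I1_indic_prob; last exact: measurableI.
have -> : X m.+1%:R @^-1` (Some @` V) = [set w | (Some @` V) (stopped X tau 1 w)].
  by apply/seteqP; split => w; rewrite /= stE m1.
rewrite SM.
have LK : L1 (P (Some x)) (fun w => \1_B w * oapp (K \1_V) 0 (X m%:R w)).
  rewrite (_ : (fun w => _) = fun w => oapp (K \1_V) 0 (X m%:R w) * \1_B w).
    by apply: L1_indic => //; exact: oapp_L1.
  by apply/funext => w; rewrite mulrC.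
rewrite /I1 /Rintegral fineK ?integrable_fin_num //.
rewrite [LHS]integral_mkcond; apply: eq_integral => w _; rewrite /patch indicE.
case: ifPn => _; last by rewrite mul0r.
by rewrite mul1r stE addr0 -kernel_indic.
Qed.

Let markov_eq x m B (f : E -> R) := bm f /\
  I1 (P (Some x)) (fun w => \1_B w * oapp f 0 (X m.+1%:R w)) =
  I1 (P (Some x)) (fun w => \1_B w * oapp (K f) 0 (X m%:R w)).

Lemma L1_indic_oapp s t B (f : E -> R) : 0 <= t -> measurable B -> bm f ->
  L1 (P s) (fun w => \1_B w * oapp f 0 (X t w)).
Proof.
move=> t0 mB bf; rewrite (_ : (fun w => _) = fun w => oapp f 0 (X t w) * \1_B w).
  by apply: L1_indic => //; exact: oapp_L1.
by apply/funext => w; rewrite mulrC.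
Qed.

Let kernel_bm f : bm f -> bm (K f).
Proof. exact: K_bm kernel_linear kernel_mono kernel_le1 K_cont _. Qed.

Lemma markov_comb x (m : nat) (B : set Om) a f g : F m%:R B ->
  markov_eq x m B f -> markov_eq x m B g -> markov_eq x m B (fun y => a * f y + g y).
Proof.
move=> FB [bf ef] [bg eg]; split; first exact: bm_comb.
have mB : measurable B by exact: F_measurable FB.
have bKf := kernel_bm bf; have bKg := kernel_bm bg.
have LL s t h k (t0 : 0 <= t) : bm h -> bm k -> I1 (P s) (fun w => \1_B w * (a * oapp h 0 (X t w) + oapp k 0 (X t w))) =
   a * I1 (P s) (fun w => \1_B w * oapp h 0 (X t w)) + I1 (P s) (fun w => \1_B w * oapp k 0 (X t w)).
  move=> bh bk; have L1h := L1_indic_oapp s t0 mB bh; have L1k := L1_indic_oapp s t0 mB bk.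
  rewrite -I1Z // -I1D //; last exact: L1Z.
  by congr (I1 _ _); apply/funext => w; ring.
have -> : (fun w => \1_B w * oapp (fun y => a * f y + g y) 0 (X m.+1%:R w)) =
  (fun w => \1_B w * (a * oapp f 0 (X m.+1%:R w) + oapp g 0 (X m.+1%:R w))).
  by apply/funext => w; rewrite oapp_comb.
have -> : (fun w => \1_B w * oapp (K (fun y => a * f y + g y)) 0 (X m%:R w)) =
  (fun w => \1_B w * (a * oapp (K f) 0 (X m%:R w) + oapp (K g) 0 (X m%:R w))).
  apply/funext => w; rewrite -oapp_comb; congr (_ * oapp _ _ _).
  by apply/funext => y; rewrite kernel_linear.
by rewrite !LL // ef eg.
Qed.

(** The sum counts the positive integers up to [k] that are at most [y], i.e. the integer part of
    [y] capped at [k]. The induction also carries the saturated case [k <= y]. *)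
Lemma count_levels (k : nat) (y : R) : 0 <= y ->
  \sum_(i < k) ((i.+1%:R <= y)%R)%:R <= y /\
  (y <= k%:R -> y - 1 <= \sum_(i < k) ((i.+1%:R <= y)%R)%:R).
Proof.
move=> y0.
have H j : \sum_(i < j) ((i.+1%:R <= y)%R)%:R <= y :> R /\
  (y <= j%:R -> y - 1 <= \sum_(i < j) ((i.+1%:R <= y)%R)%:R) /\
  (j%:R <= y -> \sum_(i < j) ((i.+1%:R <= y)%R)%:R = j%:R :> R).
  elim: j => [|j [IH1 [IH2 IH3]]].
    by rewrite big_ord0; split => //; split => // h; lra.
  rewrite big_ord_recr /= -natr1; have [jy|jy] := leP (j%:R + 1) y.
    rewrite IH3 -?[(nat_of_bool true)%:R]/(1 : R); last by lra.
    by split; [lra|split => h; lra].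
  rewrite -?[(nat_of_bool false)%:R]/(0 : R) addr0.
  split => //; split => [h|h]; last by lra.
  have [h1|h1] := leP y j%:R; first exact: IH2.
  by rewrite IH3; lra.
by have [h1 [h2 _]] := H k.
Qed.

(** A function with values in [0, 1] is within [1/(k+1)] of a scaled sum of indicators of its
    superlevel sets; linearity and dominated convergence do the rest. *)
Lemma markov_fun x (m : nat) (B : set Om) (f : E -> R) : F m%:R B ->
  measurable_fun setT f -> (forall y, 0 <= f y <= 1) ->
  I1 (P (Some x)) (fun w => \1_B w * oapp f 0 (X m.+1%:R w)) =
  I1 (P (Some x)) (fun w => \1_B w * oapp (K f) 0 (X m%:R w)).
Proof.
move=> FB mf f01; have bf : bm f by exact: bm_01.
have mB : measurable B by exact: F_measurable FB.
pose V k (i : nat) := [set y | i.+1%:R <= k.+1%:R * f y].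
have mV k i : measurable (V k i).
  rewrite -[X in measurable X]setTI (_ : V k i = (fun y => k.+1%:R * f y) @^-1` `[i.+1%:R, +oo[).
    have mkf : measurable_fun setT (fun y => k.+1%:R * f y) by exact: measurable_funM.
    by apply: mkf => //; exact: measurable_itv.
  by apply/seteqP; split => y /=; rewrite in_itv /= andbT.
pose S k j y : R := \sum_(i < j) \1_(V k i) y.
have mS k j : markov_eq x m B (S k j).
  elim: j => [|j IH].
    (* The zero function is written through indicators so that [markov_indic] and [markov_comb]
       cover the base case. *)
    have -> : S k 0%N = fun y => -1 * (\1_set0 : E -> R) y + \1_set0 y.
      by apply/funext => y; rewrite /S big_ord0 indic0; lra.
    have h0 : markov_eq x m B \1_set0 by split; [exact: bm_indic|exact: markov_indic].
    exact: markov_comb.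
  have -> : S k j.+1 = fun y => 1 * (\1_(V k j) : E -> R) y + S k j y.
    by apply/funext => y; rewrite /S big_ord_recr /= mul1r addrC.
  apply: markov_comb => //; split; [exact: bm_indic|exact: markov_indic].
pose fk k y := k.+1%:R^-1 * S k k.+1 y.
have h0 : markov_eq x m B (fun=> 0).
  by rewrite (_ : (fun=> 0) = S 0%N 0%N) //; apply/funext => y; rewrite /S big_ord0.
have mfk k : markov_eq x m B (fk k).
  rewrite (_ : fk k = fun y => k.+1%:R^-1 * S k k.+1 y + (fun=> 0) y).
    exact: markov_comb.
  by apply/funext => y; rewrite addr0.
have fk_bd k y : fk k y <= f y /\ f y - k.+1%:R^-1 <= fk k y.
  have k0 : 0 < k.+1%:R :> R by [].
  have /andP[fy0 fy1] := f01 y.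
  have [] := @count_levels k.+1 (k.+1%:R * f y); first by rewrite mulr_ge0.
  have -> : \sum_(i < k.+1) ((i.+1%:R <= k.+1%:R * f y)%R)%:R = S k k.+1 y.
    apply: eq_bigr => i _; rewrite indicE; congr (_%:R).
    by congr nat_of_bool; apply/idP/idP => [h|/set_mem//]; exact/mem_set.
  move=> c1 c2; have {}c2 : k.+1%:R * f y - 1 <= S k k.+1 y.
    by apply: c2; rewrite -[leRHS]mulr1 ler_wpM2l.
  rewrite /fk ler_pdivrMl // c1 ler_pdivlMl // mulrBr mulfV ?gt_eqF //.
have fk_ge0 k y : 0 <= fk k y by rewrite mulr_ge0 ?invr_ge0 // sumr_ge0.
have fk_01 k y : `|fk k y| <= 1.
  rewrite ger0_norm //; apply: le_trans (fk_bd k y).1 _; by have /andP[] := f01 y.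
have fk_cvg y : fk k y @[k --> \oo] --> f y.
  apply/cvgrPdist_le => e e0; near=> k.
  have [h1 h2] := fk_bd k y; rewrite ger0_norm ?subr_ge0 //.
  have : k.+1%:R^-1 < e by near: k; exact: (near_infty_natSinv_lt (PosNum e0)).
  move: h2; move: (k.+1%:R^-1) => z h2 hz; lra.
have mind : measurable_fun setT (\1_B : Om -> R) by exact: measurable_indic.
have ind_le (w : Om) (r : R) : `|r| <= 1 -> `|\1_B w * r| <= 1.
  by rewrite normrM indicE; case: (_ \in _); rewrite ?normr1 ?normr0 ?mul1r ?mul0r.
have c1 : I1 (P (Some x)) (fun w => \1_B w * oapp (fk k) 0 (X m.+1%:R w)) @[k --> \oo] -->
    I1 (P (Some x)) (fun w => \1_B w * oapp f 0 (X m.+1%:R w)).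
  apply: (I1_dct (C := 1)) => [k|k w|w].
  - by apply: measurable_funM => //; apply: oapp_measurable => //; exact: (mfk k).1.1.
  - by apply: ind_le; exact: oapp_le.
  - apply: cvgMr; case: (X _ w) => [y|] /=; [exact: fk_cvg|exact: cvg_cst].
have c2 : I1 (P (Some x)) (fun w => \1_B w * oapp (K (fk k)) 0 (X m%:R w)) @[k --> \oo] -->
    I1 (P (Some x)) (fun w => \1_B w * oapp (K f) 0 (X m%:R w)).
  apply: (I1_dct (C := 1)) => [k|k w|w].
  - apply: measurable_funM => //; apply: oapp_measurable => //.
    exact: (kernel_bm (mfk k).1).1.
  - apply: ind_le; apply: oapp_le => y.
    have /andP[h1 h2] : 0 <= K (fk k) y <= 1.
      apply: (K_01 kernel_linear kernel_mono kernel_le1); first exact: (mfk k).1.1.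
      move=> z; rewrite fk_ge0 /=; apply: le_trans (fk_bd k z).1 _; by have /andP[] := f01 z.
    by rewrite ger0_norm.
  - apply: cvgMr; case: (X _ w) => [y|] /=; last exact: cvg_cst.
    by apply: kernel_dct => // k; exact: (mfk k).1.
move: c1; rewrite (_ : (fun k => I1 _ _) = fun k => I1 (P (Some x)) (fun w => \1_B w * oapp (K (fk k)) 0 (X m%:R w))).
  by move=> c1; exact: (cvg_unique _ c1 c2).
by apply/funext => k; exact: (mfk k).2.
Unshelve. all: by end_near. Qed.

(** * Visits to [U] at integer times *)

Hypothesis K_1 : forall x, K (fun=> 1) x = 1.

Let alive (m : nat) : set Om := X m%:R @^-1` (Some @` [set: E]).

Let F_alive m : F m%:R (alive m).
Proof. by apply: (hunt_adapted hunt) => //; exact: measurable_some. Qed.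

Let alive_measurable m : measurable (alive m).
Proof. by apply: preX_measurable => //; exact: measurable_some. Qed.

Lemma alive_as x m : P (Some x) (~` alive m) = 0%E.
Proof.
rewrite probability_setC //; suff -> : P (Some x) (alive m) = 1%E by rewrite subee.
elim: m => [|m IH].
  apply/eqP; rewrite eq_le probability_le1 //= -(hunt_normal hunt (Some x)).
  rewrite -[X in P _ X]/(X 0 @^-1` [set Some x]); apply: le_measure; rewrite ?inE //.
    apply: preX_measurable => //; rewrite (_ : [set _] = Some @` [set x]).
      apply: measurable_some; rewrite -(setCK [set x]); apply: measurableC.
      apply: sub_sigma_algebra; apply: closed_openC.
      exact/accessible_closed_set1/hausdorff_accessible/norm_hausdorff.
    by rewrite image_set1.
  by move=> w Xw; exists x => //; exact: esym Xw.
have H := @markov_fun x m setT (fun=> 1) (F_setT (ler0n _ _)) (measurable_cst _)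
  (fun=> ltac:(by rewrite ler01 lexx)).
have E1 : (fun w => \1_setT w * oapp (fun=> 1) 0 (X m.+1%:R w)) = \1_(alive m.+1) :> (Om -> R).
  by apply/funext => w; rewrite indicT mul1r (_ : (fun=> 1) = \1_[set: E]) ?oapp_indic ?indicT.
have E0 : (fun w => \1_setT w * oapp (K (fun=> 1)) 0 (X m%:R w)) = \1_(alive m) :> (Om -> R).
  apply/funext => w; rewrite indicT mul1r (_ : K (fun=> 1) = \1_[set: E]) ?oapp_indic //.
  by apply/funext => y; rewrite K_1 indicT.
by rewrite -I1_indic_prob // -E1 H E0 I1_indic_prob.
Qed.

Variable U : set E.
Hypothesis U_open : open U.
Hypothesis avoid_cvg0 : forall x, avoid K U N x @[N --> \oo] --> 0.

(** The times are m+1, ..., m+N, and the image under [Some] demands survival at each. Time m is left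
    to the conditioning event. *)
Fixpoint stay (m N : nat) : set Om :=
  if N is N'.+1 then X m.+1%:R @^-1` (Some @` (~` U)) `&` stay m.+1 N' else setT.

Let mU : measurable (~` U).
Proof. by apply: measurableC; exact: sub_sigma_algebra. Qed.

Let avoid01 N := avoid_01 kernel_linear kernel_mono kernel_le1 K_cont U_open N.

Lemma stay_measurable m N : measurable (stay m N).
Proof.
elim: N m => //= N IH m; apply: measurableI => //.
by apply: preX_measurable => //; exact: measurable_some.
Qed.

(** Keeping [B] arbitrary lets the induction absorb the first avoidance into it. [B] inside
    [alive m] matters for N = 0, where [oapp] would give 0 at the cemetery instead of 1. *)
Lemma stay_prob x N m B : F m%:R B -> B `<=` alive m ->
  P (Some x) (B `&` stay m N) =
  (I1 (P (Some x)) (fun w => \1_B w * oapp (avoid K U N) 0 (X m%:R w)))%:E.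
Proof.
elim: N m B => [|N IH] m B FB Bm.
  rewrite setIT -I1_indic_prob; last exact: F_measurable FB.
  congr (I1 _ _)%:E; apply/funext => w; rewrite indicE.
  by have [/set_mem/Bm [y _ <-]|_] := boolP (w \in B); rewrite /= ?mulr1 ?mul0r.
have FB' : F m.+1%:R (B `&` X m.+1%:R @^-1` (Some @` (~` U))).
  apply: F_setI => //; first by apply: F_mono FB => //; rewrite ler_nat.
  by apply: (hunt_adapted hunt) => //; exact: measurable_some.
rewrite /= setIA IH //; last by move=> w [_ [y _ yX]]; exists y.
have [mN N01] := avoid01 N.
rewrite -markov_fun //.
- congr (I1 _ _)%:E; apply/funext => w; rewrite (indicI _ B) /= -mulrA; congr (_ * _).
  case E1 : (X m.+1%:R w) => [y|] /=; last by rewrite mulr0.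
  congr (_ * _); rewrite !indicE; congr (nat_of_bool _)%:R.
  apply/idP/idP => /set_mem h; apply/mem_set; last by rewrite /= E1; exists y.
  by move: h; rewrite /= E1 => -[z Uz [<-]].
- by apply: measurable_funM => //; exact: measurable_indic.
- move=> y; rewrite indicE; case: (_ \in _); rewrite ?mul1r ?mul0r ?N01 //.
  by rewrite lexx ler01.
Qed.

Lemma stay_forever x m : P (Some x) (alive m `&` \bigcap_N stay m N) = 0%E.
Proof.
have mI : measurable (alive m `&` \bigcap_N stay m N).
  by apply: measurableI => //; apply: bigcapT_measurable => N; exact: stay_measurable.
rewrite -I1_indic_prob //; congr (_%:E); apply/eqP; rewrite eq_le.
have Li A : measurable A -> L1 (P (Some x)) (\1_A : Om -> R).
  move=> mA; apply: (L1_prob _ (C := 1)) => [|w]; first exact: measurable_indic.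
  by rewrite indicE; case: (_ \in _); rewrite ?normr1 ?normr0.
apply/andP; split; last first.
  by rewrite -(I1_prob_cst (Some x) 0); apply: le_I1 => //; [apply: (L1_prob _ (C := 0)) => // w; rewrite normr0|exact: Li].
have cv : I1 (P (Some x)) (fun w => \1_(alive m) w * oapp (avoid K U N) 0 (X m%:R w))
    @[N --> \oo] --> I1 (P (Some x)) (fun=> 0).
  apply: (I1_dct (C := 1)) => [N|N w|w].
  - apply: measurable_funM; first exact: measurable_indic.
    by apply: oapp_measurable => //; exact: (avoid01 N).1.
  - have : `|oapp (avoid K U N) 0 (X m%:R w)| <= 1.
      by apply: oapp_le => y; have /andP[h0 h1] := (avoid01 N).2 y; rewrite ger0_norm.
    by rewrite normrM indicE; case: (_ \in _); rewrite ?normr1 ?normr0 ?mul1r ?mul0r.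
  - have h : oapp (avoid K U N) 0 (X m%:R w) @[N --> \oo] --> (0 : R).
      by case: (X m%:R w) => [y|] /=; [exact: avoid_cvg0|exact: cvg_cst].
    have := cvgMr (a := \1_(alive m) w) h; rewrite mulr0; exact.
rewrite I1_prob_cst in cv; apply: (@cvgr_to_ge _ _ _ _ _ _ _ cv).
apply: nearW => N; rewrite -lee_fin -stay_prob // I1_indic_prob //.
apply: le_measure; rewrite ?inE //; first by apply: measurableI => //; exact: stay_measurable.
by move=> w [aw sw]; split => //; exact: sw.
Qed.

Lemma stay_last_exit w : (forall m, alive m w) ->
  (forall m, ~ (\bigcap_N stay m N) w) -> last_exit X U w = +oo%E.
Proof.
move=> aw nw.
have hit m : exists2 j : nat, (m <= j)%N & (Some @` U) (X j%:R w).
  apply: contrapT => H; apply: (nw m) => N _.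
  have {H} : forall j : nat, (m <= j)%N -> ~ (Some @` U) (X j%:R w).
    by move=> j mj h; apply: H; exists j.
  elim: N m => // N IH m Hm; split; last by apply: IH => j mj; apply: Hm; exact: ltnW.
  have [y _ yX] := aw m.+1; exists y => // Uy.
  by apply: (Hm m.+1 (leqnSn _)); exists y.
apply/eqyP => t t0; have [j tj hj] := hit (Num.bound t).
apply: (@le_trans _ _ (j%:R)%:E).
  rewrite lee_fin; apply: ltW; apply: lt_le_trans (archi_boundP (ltW t0)) _.
  by rewrite ler_nat.
by apply: ereal_sup_ubound; right; exists j%:R.
Qed.

(** [U] is open and paths are right-continuous, so a visit at time t is followed by visits at
    rational times. This makes the event a countable combination of measurable sets. *)
Lemma last_exit_rational w : last_exit X U w = +oo%E <->
  forall m : nat, exists q : rat, m%:R <= ratr q :> R /\ (Some @` U) (X (ratr q) w).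
Proof.
split=> [H m|H].
  have : ((m%:R)%:E < last_exit X U w)%E by rewrite H ltry.
  move=> /ereal_sup_gt [_ [->|[t [t0 Ut] <-]]]; first by rewrite lte_fin ltrn0.
  rewrite lte_fin => mt.
  have oU : open (Some @` U : set S) by exact: one_point_compactification_open_some.
  have nU : nbhs (X t w) (Some @` U : set S) by apply: open_nbhs_nbhs; split.
  have [e /= e0 He] : \forall s \near t^'+, (Some @` U) (X s w).
    exact: (@hunt_right_continuous _ _ _ _ _ _ _ hunt t w t0 _ nU).
  have [q] := @rat_in_itvoo R t (t + e) ltac:(by rewrite ltrDl).
  rewrite in_itv /= => /andP[tq qe]; exists q; split; first by apply: ltW; exact: lt_trans tq.
  by apply: He => //; rewrite /= distrC ger0_norm ?subr_ge0 ?(ltW tq) // ltrBlDl.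
apply/eqyP => t t0; have [q [tq hq]] := H (Num.bound t).
apply: (@le_trans _ _ (ratr q)%:E).
  by rewrite lee_fin; apply: le_trans tq; apply: ltW; exact: archi_boundP (ltW t0).
apply: ereal_sup_ubound; right; exists (ratr q) => //; split => //.
exact: le_trans (ler0n _ _) tq.
Qed.

Lemma last_exit_measurable : measurable [set w | last_exit X U w = +oo%E].
Proof.
have -> : [set w | last_exit X U w = +oo%E] = \bigcap_m \bigcup_(q in [set q : rat | m%:R <= ratr q :> R])
    (X (ratr q) @^-1` (Some @` U)).
  apply/seteqP; split => w.
    by move=> /last_exit_rational h m _; have [q [mq hq]] := h m; exists q.
  by move=> h; apply/last_exit_rational => m; have [q mq hq] := h m I; exists q.
apply: bigcapT_measurable => m; rewrite bigcup_mkcond.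
apply: countable_bigcupT_measurable => [|q]; first exact: countableP.
case: ifPn => // /set_mem /= mq.
apply: preX_measurable; first exact: le_trans (ler0n _ _) mq.
by apply: measurable_some; exact: sub_sigma_algebra.
Qed.

Lemma last_exit_infinite x : P (Some x) [set w | last_exit X U w = +oo%E] = 1%E.
Proof.
set Z := [set w | _]; have mZ : measurable Z := last_exit_measurable.
have mS m : measurable (alive m `&` \bigcap_N stay m N).
  by apply: measurableI => //; apply: bigcapT_measurable => N; exact: stay_measurable.
have P0 : P (Some x) (~` Z) = 0%E.
  apply/negligibleP; first exact: measurableC.
  apply: (@negligibleS _ _ _ _ (\bigcup_m (~` alive m `|` (alive m `&` \bigcap_N stay m N)))); last first.
    apply: negligible_bigcup => m; apply: negligibleU.
      by apply/negligibleP; [exact: measurableC|exact: alive_as].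
    by apply/negligibleP; [|exact: stay_forever].
  move=> w nZ; apply: contrapT => nB; apply: nZ; apply: stay_last_exit => m.
    by apply: contrapT => na; apply: nB; exists m => //; left.
  move=> sw; apply: nB; exists m => //.
  by have [aw|] := pselect (alive m w); [right|left].
by rewrite -(setCK Z) probability_setC ?P0 ?sube0 //; exact: measurableC.
Qed.

End process.

(** Feeds the case [s = +oo] of [continuous_version], whence [Pt 1 f] is continuous for bounded
    measurable [f]: the strong Feller property. *)
Lemma bounded_Lfun (R : realType) (n : nat) (mu : {measure set 'rV[R]_n -> \bar R}) (f : 'rV[R]_n -> R) :
  bounded_measurable f -> f \in Lfun mu +oo.
Proof.
move=> [mf [M fM]]; rewrite inE; apply/andP; split; rewrite inE //.
rewrite /finite_norm unlock /=; case: ifPn => [mu0|//].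
apply: le_lt_trans (ltry M); apply/ess_sup_inf.ess_supP; apply: nearW => x.
by rewrite /= lee_fin.
Qed.

Theorem proposition3p40 (R : realType) (d : nat) (p q : R)
    (A C : 'rV[R]_d -> 'M[R]_d) (H : 'rV[R]_d -> 'rV[R]_d)
    (rho : 'rV[R]_d -> R) (mu : {measure set 'rV[R]_d -> \bar R})
    (T Pt : R -> ('rV[R]_d -> R) -> ('rV[R]_d -> R))
    (dOm : measure_display) (Om : measurableType dOm)
    (F : R -> set (set Om)) (X : R -> Om -> one_point_compactification 'rV[R]_d)
    (P : one_point_compactification 'rV[R]_d -> probability Om R)
    (N0 : nat) (g : 'rV[R]_d -> R) :
  (2 <= d)%N -> d%:R < p -> q = p * d%:R / (p + d%:R) ->
  assumption_a p A C H ->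
  assumption_b q (drift A C H) ->
  invariant_density p A (drift A C H) rho mu ->
  global_semigroup mu T A (drift A C H) rho ->
  continuous_version mu T Pt ->
  Hunt_process F X P ->
  continuous_paths X ->
  has_transition X P Pt ->
  Ck 2 (~` closure (eball N0%:R)) g ->
  continuous g ->
  (forall x, 0 <= g x) ->
  inf [set g x | x in [set x | enorm x = r]] @[r --> +oo] --> +oo ->
  {ae lebesgue_rV d, forall x, (~` closure (eball N0%:R)) x ->
    Lop A (drift A C H) g x <= 0} ->
  recurrent X P.
Proof.
move=> d2 dp qE [Ab1 Ab2 _ _] Gloc [_ rho_cont rho_gt0 rho_dens _] sgl cv hunt _ tr
  g_C2 g_cont g_ge0 g_inf g_super x U oU U0.
have d0 : (2 : R) <= d%:R by rewrite ler_nat.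
(* [p d >= 2 p >= p + d], from [d >= 2] and [p > d]. *)
have q1 : 1 <= q.
  rewrite qE ler_pdivlMr; last by lra.
  by nra.
have A_cont i j : continuous (fun x => A x i j) by have [_ []] := Ab1 i j.
have A_pos y v : 0 <= dotp (mapv (A y) v) v.
  have [|nu nu0 h] := Ab2 [set y].
    rewrite /relatively_compact -(closure_id _).1; first exact: compact_set1.
    exact/accessible_closed_set1/hausdorff_accessible/norm_hausdorff.
  have /andP[+ _] := h y v erefl; apply: le_trans.
  by rewrite mulr_ge0 ?invr_ge0 ?sqr_ge0 // ltW.
have [sg _ _] := sgl.
have ae_le := ae_continuous_le rho_cont rho_gt0 rho_dens.
have K_cont f : bounded_measurable f -> continuous (Pt 1 f).
  move=> bf; have /(cv.2 +oo%E 1 f (leey _) ltr01)[] // : f \in Lfun mu +oo.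
  exact: bounded_Lfun.
have [M [k' [k'_L1 k'_ge0 fL1 f_super]]] := lyapunov_functions A_cont A_pos q1 Gloc
  rho_cont rho_gt0 rho_dens sgl cv g_C2 g_cont g_ge0 g_inf g_super.
have K_lin := kernel_linear hunt tr.
have K_mono := kernel_mono hunt tr.
have K_le1 := kernel_le1 hunt tr.
have K_dct := kernel_dct hunt tr.
have Q_L1 f : L1 mu f -> L1 mu (Pt 1 f) by exact: (Pt_L1 cv ltr01).
have Q_lin a f h y : L1 mu f -> L1 mu h ->
    Pt 1 (fun z => a * f z + h z) y = a * Pt 1 f y + Pt 1 h y.
  exact: (Pt_linear ae_le sg cv).
have Q_mono f h : L1 mu f -> L1 mu h -> {ae mu, forall x, f x <= h x} ->
    forall x, Pt 1 f x <= Pt 1 h x.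
  by move=> Lf Lh fh y; exact: (Pt_mono ae_le sg cv).
have Q_contract f : L1 mu f -> (forall x, 0 <= f x) -> I1 mu (Pt 1 f) <= I1 mu f.
  exact: (Pt_contract sg cv).
have lyap_L1 m : 0 < m -> L1 mu (lyap g M m) by move=> /fL1[].
have ball_L1 := L1_cball rho_cont rho_gt0 rho_dens.
have K1 := conservative K_lin K_mono K_le1 K_cont Q_L1 Q_lin Q_mono Q_contract ae_le
  ball_L1 k'_L1 k'_ge0 lyap_L1 f_super.
apply: (last_exit_infinite hunt tr K_cont K1 oU) => y.
have avoid0 := avoid_all_eq0 K_lin K_mono K_le1 K_cont K_dct Q_L1 Q_lin Q_mono Q_contract ae_le
  (ae_dense rho_cont rho_gt0 rho_dens) ball_L1 k'_L1 k'_ge0 lyap_L1 f_super oU U0.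
rewrite -(avoid0 y).
exact: (@avoid_cvg _ _ _ _ _ _ _ _ _ y).
Qed.
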